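(* For every integer $k\ge 6$, the decision problem \textsc{StarExp($k$)} is NP-complete.
   Context: A temporal star $(G_s,L)$ consists of a star $G_s$ with center $c$ and a map $L$ assigning to each edge a finite set of positive integer labels (the discrete times at which the edge is available). A journey is a sequence of time edges $(u,u_1,l_1),(u_1,u_2,l_2),\dots,(u_{r-1},v,l_r)$, where each $l_t$ is a label of the edge traversed, with $l_1<l_2<\dots<l_r$. The temporal star is explorable if there is a journey starting and ending at $c$ that visits every vertex of $G_s$. \textsc{StarExp($k$)}: given a temporal star in which every edge has at most $k$ labels, decide whether it is explorable. *)

(* Defs.v *)
From mathcomp Require Import all_boot.
Set Implicit Arguments. Unset Strict Implicit. Unset Printing Implicit Defensive.

(* 1. Machine model: deterministic single-tape Turing machines with a       *)
(*    two-way infinite tape, finitely many states 'I_Q.+1 (start = ord0)   *)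
(*    and finitely many tape symbols 'I_S.+3 (0 = blank, 1 = bit false,     *)
(*    2 = bit true, others auxiliary).  A machine halts when delta = None.  *)

Inductive dir := Dleft | Dright | Dstay.

Record TM (Q S : nat) := MkTM {
  tm_delta : 'I_Q.+1 -> 'I_S.+3 -> option ('I_Q.+1 * 'I_S.+3 * dir);
  tm_accept : 'I_Q.+1 -> bool }.

Record config (Q S : nat) := Config {
  cstate : 'I_Q.+1;
  cleft : seq 'I_S.+3;   (* cells left of the head, nearest first *)
  chead : 'I_S.+3;
  cright : seq 'I_S.+3 }.  (* cells right of the head, nearest first *)

Section Machines.
Variables Q S : nat.
Implicit Types (M : TM Q S) (c : config Q S).

Definition blank : 'I_S.+3 := ord0.
Definition sym_of_bit (b : bool) : 'I_S.+3 := if b then inord 2 else inord 1.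

Definition move_left c : config Q S :=
  match cleft c with
  | [::] => Config (cstate c) [::] blank (chead c :: cright c)
  | a :: l => Config (cstate c) l a (chead c :: cright c)
  end.

Definition move_right c : config Q S :=
  match cright c with
  | [::] => Config (cstate c) (chead c :: cleft c) blank [::]
  | a :: r => Config (cstate c) (chead c :: cleft c) a r
  end.

Definition halted M c : bool := if tm_delta M (cstate c) (chead c) is None then true else false.

Definition step M c : config Q S :=
  match tm_delta M (cstate c) (chead c) with
  | None => c
  | Some (q', s', d) =>
      let c1 := Config q' (cleft c) s' (cright c) in
      match d with Dleft => move_left c1 | Dright => move_right c1 | Dstay => c1 end
  end.

Definition init (w : seq bool) : config Q S :=
  match map sym_of_bit w with
  | [::] => Config ord0 [::] blank [::]
  | a :: r => Config ord0 [::] a r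
  end.

Definition run M (w : seq bool) (t : nat) : config Q S := iter t (step M) (init w).

Definition output c : seq bool :=
  let s := chead c :: cright c in
  map (fun x : 'I_S.+3 => val x == 2)
      (take (find (fun x : 'I_S.+3 => (val x != 1) && (val x != 2)) s) s).

End Machines.

Definition poly_bound (c d n : nat) : nat := c * n ^ d + c.

Definition language := seq bool -> Prop.

Definition in_P (L : language) : Prop :=
  exists (Q S : nat) (M : TM Q S) (c d : nat),
    forall w, exists t, t <= poly_bound c d (size w) /\
      halted M (run M w t) /\ (tm_accept M (cstate (run M w t)) <-> L w).

Definition poly_computable (f : seq bool -> seq bool) : Prop :=
  exists (Q S : nat) (M : TM Q S) (c d : nat),
    forall w, exists t, t <= poly_bound c d (size w) /\
      halted M (run M w t) /\ output (run M w t) = f w.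

(* pairing of two strings (self-delimiting first component) *)
Definition pair_enc (w y : seq bool) : seq bool :=
  flatten [seq [:: b; b] | b <- w] ++ [:: true; false] ++ y.

Definition in_NP (L : language) : Prop :=
  exists (V : language) (c d : nat), in_P V /\
    forall w, L w <-> exists y, size y <= poly_bound c d (size w) /\ V (pair_enc w y).

Definition NP_hard (L : language) : Prop :=
  forall L' : language, in_NP L' ->
    exists f, poly_computable f /\ forall w, L' w <-> L (f w).

Definition NP_complete (L : language) : Prop := in_NP L /\ NP_hard L.

(* 2. Temporal stars.  An instance is I : seq (seq nat) with m := size I    *)
(*    leaves.  Vertex 0 is the center c, vertex i.+1 is the i-th leaf, and  *)
(*    the edge {0, i.+1} carries the label set nth [::] I i.               *)

Definition tstar := seq (seq nat).

Definition valid_tstar (k : nat) (I : tstar) : bool :=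
  all (fun s => [&& uniq s, all (fun l => 0 < l) s & size s <= k]) I.

Definition is_vertex (I : tstar) (v : nat) : bool := v <= size I.

Definition is_edge (I : tstar) (u v : nat) : bool :=
  ((u == 0) && (0 < v <= size I)) || ((v == 0) && (0 < u <= size I)).

(* labels of the edge {u, v} (one of u, v being the center 0) *)
Definition edge_labels (I : tstar) (u v : nat) : seq nat := nth [::] I (u + v).-1.

Definition time_edge := (nat * nat * nat)%type.
Definition te_src (e : time_edge) := e.1.1.
Definition te_dst (e : time_edge) := e.1.2.
Definition te_lab (e : time_edge) := e.2.

Definition valid_time_edge (I : tstar) (e : time_edge) : bool :=
  is_edge I (te_src e) (te_dst e) && (te_lab e \in edge_labels I (te_src e) (te_dst e)).

Definition journey (I : tstar) (x y : nat) (p : seq time_edge) : bool :=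
  match p with
  | [::] => false
  | e :: _ =>
      [&& all (valid_time_edge I) p,
          sorted (fun e1 e2 => (te_dst e1 == te_src e2) && (te_lab e1 < te_lab e2)) p,
          te_src e == x & te_dst (last e p) == y]
  end.

Definition visits (p : seq time_edge) (v : nat) : bool :=
  has (fun e => (te_src e == v) || (te_dst e == v)) p.

Definition explorable (I : tstar) : Prop :=
  exists p, journey I 0 0 p /\ forall v, is_vertex I v -> visits p v.

(* 3. Binary encoding of instances (self-delimiting, injective).            *)

Fixpoint bits_aux (fuel n : nat) : seq bool :=
  match fuel with
  | 0 => [::]
  | f.+1 => if n is 0 then [::] else odd n :: bits_aux f n./2
  end.
Definition bits (n : nat) : seq bool := bits_aux n n.

Definition enc_nat (n : nat) : seq bool :=
  flatten [seq [:: true; b] | b <- bits n] ++ [:: false].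
Definition enc_list (s : seq nat) : seq bool :=
  flatten [seq true :: enc_nat x | x <- s] ++ [:: false].
Definition enc_tstar (I : tstar) : seq bool :=
  flatten [seq true :: enc_list s | s <- I] ++ [:: false].

Definition StarExp (k : nat) : language :=
  fun w => exists I, w = enc_tstar I /\ valid_tstar k I /\ explorable I.

(* Main.v *)
(* Hardness. A tour of the star chooses for each leaf an interval between two of its labels, all
   these intervals being disjoint. Cut the time line into one region per literal and separate the
   regions by leaves that have only two consecutive labels. The leaf of a variable v has the four
   end points of the regions of v and of its negation: visiting it fills the region of the literal
   declared false. The leaf of a clause has two consecutive labels in the region of each of its
   three literals, hence six labels, and can be visited iff one of these literals is true.
   A run of a Turing machine is described by clauses with at most three literals, of the form
   "head at i in state q and symbol s at i imply ...": once the input row is fixed, unit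
   propagation forces the whole run, and only the certificate cells need proper disjunctions.

   Machines. FP is the class of functions computed in polynomial time by programs over finitely
   many stacks of bits. It is closed under composition, pairing, case analysis and iteration with
   polynomially bounded values, so that polynomial-time computability is proved by following the
   definition of a function, with no explicit running times. A single tape simulates the stacks as
   parallel tracks, each operation walking from the home cell to the top of a stack and back. *)
Require Import Defs.
From mathcomp Require Import all_boot zify.
From Stdlib Require Import FunctionalExtensionality.
Set Implicit Arguments. Unset Strict Implicit. Unset Printing Implicit Defensive.

(** A leaf with six labels could be entered in one region and left in another. The separators rule
    this out: a leaf with only two labels has to be visited exactly between them, so no other visit
    can span it, and every remaining visit stays inside one region. Six is the price of a clause,
    two labels for each of its three literals; a variable needs only four. Two treatments of numbers
    shape the complexity part. Everything that the reduction computes is polynomially bounded, so it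
    handles numbers in unary and turns a label into binary only when writing it. The labels of a
    given instance may be exponential in its length, so the verifier never evaluates them: it
    compares them as bit strings, and a certificate names two label words per leaf. The run
    described by clauses has a fixed length, an upper bound over all admissible certificates. A
    machine that stops earlier stays in its last configuration, so acceptance can be read at that
    single time. *)

Local Notation str := (seq bool).

(** * Simulation of stack machines on a single tape *)

Section Tape.
Variables Q S : nat.
Implicit Types c : config Q S.

(** Absolute coordinates: [p] is the position attributed to the head. A move then changes [p] and
    leaves every cell as it was; the blank defaults hide where the two lists end. *)
Definition cell c (p i : nat) : 'I_S.+3 :=
  if i < p then nth (blank S) (cleft c) (p - i.+1)
  else nth (blank S) (chead c :: cright c) (i - p).

Lemma cell_head c p : cell c p p = chead c.
Proof. by rewrite /cell ltnn subnn. Qed.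

Lemma cell_write c (q : 'I_Q.+1) (s : 'I_S.+3) p i :
  cell (Config q (cleft c) s (cright c)) p i = if i == p then s else cell c p i.
Proof.
rewrite /cell /=; case: ltngtP => // [lt_pi|->]; last by rewrite subnn.
by rewrite -[i - p]prednK ?subn_gt0.
Qed.

Lemma cell_left c p i : cell (move_left c) p i = cell c p.+1 i.
Proof.
case: c => q [|a l] h r; rewrite /cell /move_left /=.
- case: ltngtP => [lt_ip|lt_pi|->]; rewrite ?ltnS.
  + by rewrite ltnW // !nth_nil.
  + by rewrite leqNgt lt_pi /= -(subnSK lt_pi).
  + by rewrite leqnn subnn subnn.
- case: ltngtP => [lt_ip|lt_pi|->]; rewrite ?ltnS.
  + by rewrite ltnW //= subSS -(subnSK lt_ip).
  + by rewrite leqNgt lt_pi /= -(subnSK lt_pi).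
  + by rewrite leqnn subnn subnn.
Qed.

Lemma cell_right c p i : cell (move_right c) p.+1 i = cell c p i.
Proof.
case: c => q l h r; rewrite /cell /move_right ltnS.
have E : nth (blank S) (head (blank S) r :: behead r) =1 nth (blank S) r.
  by case: r => // -[|n] //=; rewrite nth_nil.
have -> : (match r with
   | [::] => Config q (h :: l) (blank S) [::]
   | a :: r0 => Config q (h :: l) a r0 end) =
   Config q (h :: l) (head (blank S) r) (behead r) by case: r {E}.
rewrite [cleft _]/= [chead _]/= [cright _]/=.
case: ltngtP => [lt_ip|lt_pi|->].
- by rewrite subSS -(subnSK lt_ip).
- by rewrite E -(subnSK lt_pi).
- by rewrite !subnn.
Qed.
End Tape.

(** Tape symbols are numbers in base 3 with one digit per track: 0 for no entry, [b.+1] for the bit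
    [b]. *)
Definition digit (i s : nat) : nat := s %/ 3 ^ i %% 3.

Fixpoint code (n : nat) (d : nat -> nat) : nat :=
  if n is n'.+1 then code n' d + d n' * 3 ^ n' else 0.

Lemma code_lt n d : (forall i, i < n -> d i < 3) -> code n d < 3 ^ n.
Proof.
elim: n => //= n IH H; rewrite expnS.
have := IH (fun i lt_in => H i (ltnW lt_in)); have := H n (ltnSn n).
by move: (3 ^ n) => w; nia.
Qed.

Lemma eq_code n d d' : (forall i, i < n -> d i = d' i) -> code n d = code n d'.
Proof.
elim: n => //= n IH H; rewrite (IH (fun i lt_in => H i (ltnW lt_in))).
by rewrite (H n (ltnSn n)).
Qed.

Lemma digit_code n d i : (forall i, i < n -> d i < 3) -> i < n ->
  digit i (code n d) = d i.
Proof.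
elim: n => //= n IH H; rewrite ltnS leq_eqVlt => /orP[/eqP->|lt_in].
  rewrite /digit addnC divnMDl ?expn_gt0 // divn_small ?addn0 ?modn_small //.
    exact: H.
  by apply: code_lt => j lt_jn; apply: H (ltnW _).
have lt3 j : j < n -> d j < 3 by move=> lt_jn; apply: H (ltnW _).
have E : 3 ^ n = 3 ^ (n - i.+1) * 3 * 3 ^ i.
  by rewrite -expnSr -expnD; congr (3 ^ _); lia.
rewrite -(IH lt3 lt_in) /digit E !mulnA addnC divnMDl ?expn_gt0 //.
by rewrite modnMDl.
Qed.

(** When all other tracks are empty, a symbol equals its digit on track 0. The digits 0, 1, 2 agree
    with the symbols for blank, false and true, so input and output words need no conversion. *)
Lemma code_digit0 n d : 0 < n -> (forall i, 0 < i < n -> d i = 0) -> code n d = d 0.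
Proof.
case: n => // n _; elim: n => [|n IH] H; first by rewrite /= muln1.
have -> : code n.+2 d = code n.+1 d + d n.+1 * 3 ^ n.+1 by [].
by rewrite IH ?(H n.+1) ?ltnS ?leqnn ?addn0 // => i /andP[i0 lt_in]; apply: H; rewrite i0 ltnW.
Qed.

Lemma leq_sumn_map T (x0 : T) f s n : n < size s -> f (nth x0 s n) <= sumn (map f s).
Proof.
elim: s n => // x s IH [|n] /= lt_n; first exact: leq_addr.
exact: leq_trans (IH _ lt_n) (leq_addl _ _).
Qed.

(** * Goto programs on stacks and the machine that runs them *)

Inductive instr := IPush of nat & bool | IPop of nat & nat & nat | IJmp of nat.

Definition store := nat -> str.
Definition upd (st : store) i s : store := fun j => if j == i then s else st j.

Section Goto.
Variable prog : seq instr.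

(** The default instruction [IJmp pc] makes every address outside the program a fixed point. *)
Definition gstep (c : nat * store) : nat * store :=
  let: (pc, st) := c in
  match nth (IJmp pc) prog pc with
  | IPush i b => (pc.+1, upd st i (b :: st i))
  | IPop i a b => if st i is x :: s then (if x then b else a, upd st i s)
                  else (pc.+1, st)
  | IJmp a => (a, st)
  end.

Definition itarget (x : instr) := match x with IPush _ _ => 0 | IPop _ a b => a + b | IJmp a => a end.
Definition ireg (x : instr) := match x with IPush i _ | IPop i _ _ => i | IJmp _ => 0 end.

(* State number [4 * pc + phase], where the phase is 0: mark the home cell, 1: execute the
   instruction, seeking the top of the stack rightwards, 2: pop, 3: return to the home cell. *)
Definition nstates := 4 * (size prog + sumn (map itarget prog) + 3).
Definition ntracks := (sumn (map ireg prog)).+1.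
Definition nsyms := 3 ^ ntracks.+1.

Definition setdig i v s :=
  code ntracks.+1 (fun j => if j == i then v else digit j s).

(** For a pop, an empty digit on the marked home cell means an empty stack; elsewhere it means that
    the top lies one cell to the left. At address [size prog] the mark is erased, so that the tape
    holds a plain word again, and the next address, one or two further, records the first output
    bit; both addresses halt and the second accepts. *)
Definition ndelta (q s : nat) : option (nat * nat * dir) :=
  let pc := q %/ 4 in
  match q %% 4 with
  | 0 => Some (pc * 4 + 1, setdig ntracks 1 s, Dstay)
  | 1 =>
    if pc < size prog then
      match nth (IJmp pc) prog pc with
      | IPush i b => if digit i s == 0 then Some (pc.+1 * 4 + 3, setdig i b.+1 s, Dstay)
                     else Some (q, s, Dright)
      | IPop i a b => if digit i s == 0 then
                        if digit ntracks s == 1 then Some (pc.+1 * 4 + 1, s, Dstay)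
                        else Some (pc * 4 + 2, s, Dleft)
                      else Some (q, s, Dright)
      | IJmp a => Some (a * 4 + 1, s, Dstay)
      end
    else if pc == size prog then
      Some ((pc + (digit 0 s == 2)).+1 * 4 + 1, setdig ntracks 0 s, Dstay)
    else None
  | 2 => if nth (IJmp pc) prog pc is IPop i a b then
           Some ((if digit i s == 2 then b else a) * 4 + 3, setdig i 0 s, Dstay)
         else None
  | _ => if digit ntracks s == 1 then Some (pc * 4 + 1, s, Dstay)
         else Some (q, s, Dleft)
  end.

Definition machine : TM nstates.-1 (nsyms - 3) :=
  MkTM (fun q s => if ndelta q s is Some (q', s', d) then Some (inord q', inord s', d)
                   else None)
       (fun q => q == (size prog).+2 * 4 + 1 :> nat).

Lemma nstatesE : nstates.-1.+1 = nstates.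
Proof. by rewrite /nstates; lia. Qed.

Lemma nsymsE : (nsyms - 3).+3 = nsyms.
Proof.
have : 3 ^ 2 <= nsyms by rewrite /nsyms leq_exp2l.
by lia.
Qed.

(** The head of the list is the top of the stack, hence [rev]: the bottom lies on the home cell, and
    a push or a pop alters a single cell. *)
Definition sdig (s : str) (j : nat) : nat :=
  if j < size s then (nth false (rev s) j).+1 else 0.

(* [mk] is the content of the mark track. *)
Definition symdig (st : store) (mk j i : nat) : nat :=
  if i < ntracks then sdig (st i) j else mk.

Definition symcode st mk j := code ntracks.+1 (symdig st mk j).

Lemma sdig_lt s j : sdig s j < 3.
Proof. by rewrite /sdig; case: ifP => // _; case: (nth _ _ _). Qed.

Lemma symdig_lt st mk j i : mk < 2 -> symdig st mk j i < 3.
Proof. by rewrite /symdig; case: ifP => _; [rewrite sdig_lt|lia]. Qed.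

Lemma symcode_lt st mk j : mk < 2 -> symcode st mk j < nsyms.
Proof. by move=> lt2; apply: code_lt => i _; apply: symdig_lt. Qed.

Lemma digit_symcode st mk j i : mk < 2 -> i < ntracks -> digit i (symcode st mk j) = sdig (st i) j.
Proof.
move=> lt2 lti; by rewrite digit_code ?(leqW lti) => [|? _|]; [rewrite /symdig lti|exact: symdig_lt|].
Qed.

Lemma digit_mark st mk j : mk < 2 -> digit ntracks (symcode st mk j) = mk.
Proof.
move=> lt2; by rewrite digit_code => [|? _|]; [rewrite /symdig ltnn|exact: symdig_lt|].
Qed.

Lemma setdig_symcode st mk j i v s : mk < 2 -> i < ntracks -> sdig s j = v ->
  setdig i v (symcode st mk j) = symcode (upd st i s) mk j.
Proof.
move=> lt2 lti <-; apply: eq_code => l lt_l; rewrite /symdig /upd.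
case: eqP => [->|_]; first by rewrite lti.
by rewrite digit_code // => *; apply: symdig_lt.
Qed.

Lemma setdig_mark st mk mk' j : mk < 2 -> setdig ntracks mk' (symcode st mk j) = symcode st mk' j.
Proof.
move=> lt2; apply: eq_code => l; rewrite ltnS /symdig leq_eqVlt.
case: eqP => [->|/= _ lt_l]; first by rewrite ltnn.
rewrite lt_l digit_symcode //.
Qed.

Lemma ireg_lt pc : ireg (nth (IJmp pc) prog pc) < ntracks.
Proof.
rewrite /ntracks ltnS; have [lt_pc|le_pc] := ltnP pc (size prog).
  exact: leq_sumn_map.
by rewrite nth_default.
Qed.

Lemma itarget_le pc : pc < size prog -> itarget (nth (IJmp pc) prog pc) <= sumn (map itarget prog).
Proof. exact: leq_sumn_map. Qed.

Definition tape_at (c : config nstates.-1 (nsyms - 3)) h q (F : nat -> nat) :=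
  (cstate c = q :> nat) /\ forall j, cell c h j = F j :> nat.

Lemma tape_at_ext c h q F F' : F =1 F' -> tape_at c h q F -> tape_at c h q F'.
Proof. by move=> eqF [cq H]; split=> [|j]; rewrite ?H. Qed.

Lemma tape_step c h q F q' s' d : tape_at c h q F ->
  ndelta q (F h) = Some (q', s', d) -> q' < nstates -> s' < nsyms ->
  (d = Dleft -> 0 < h) ->
  tape_at (step machine c) (match d with Dleft => h.-1 | Dright => h.+1 | Dstay => h end) q'
          (fun j => if j == h then s' else F j).
Proof.
move=> [cq cF] ndq lt_q lt_s dh; rewrite /step /= cq -[chead c](cell_head c h) cF ndq.
set c1 := Config _ _ _ _.
have c1F j : cell c1 h j = (if j == h then s' else F j) :> nat.
  by rewrite cell_write; case: eqP => // _; rewrite inordK ?nsymsE.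
case: d dh {ndq} => [/(_ erefl) h0|_|_]; split.
- by rewrite /move_left; case: (cleft c1) => [|? ?]; rewrite /= inordK ?nstatesE.
- by move=> j; rewrite cell_left prednK.
- by rewrite /move_right; case: (cright c1) => [|? ?]; rewrite /= inordK ?nstatesE.
- by move=> j; rewrite cell_right.
- by rewrite /= inordK ?nstatesE.
- exact: c1F.
Qed.

Definition tapeF st j := symcode st (j == 0) j.

Lemma tapeF_lt st j : tapeF st j < nsyms.
Proof. by apply: symcode_lt; case: (j == 0). Qed.

Lemma tape_stay c h q F q' d : tape_at c h q F -> (forall j, F j < nsyms) ->
  ndelta q (F h) = Some (q', F h, d) -> q' < nstates -> (d = Dleft -> 0 < h) ->
  tape_at (step machine c) (match d with Dleft => h.-1 | Dright => h.+1 | Dstay => h end) q' F.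
Proof.
move=> cF ltF ndq lt_q dh; have := tape_step cF ndq lt_q (ltF h) dh.
by apply: tape_at_ext => j; case: eqP => [->|].
Qed.

Lemma state_lt pc ph : ph < 4 -> pc < size prog + sumn (map itarget prog) + 3 -> pc * 4 + ph < nstates.
Proof. by rewrite /nstates; lia. Qed.

Lemma ndelta4 pc ph s : ph < 4 -> ndelta (pc * 4 + ph) s =
  match ph with
  | 0 => Some (pc * 4 + 1, setdig ntracks 1 s, Dstay)
  | 1 =>
    if pc < size prog then
      match nth (IJmp pc) prog pc with
      | IPush i b => if digit i s == 0 then Some (pc.+1 * 4 + 3, setdig i b.+1 s, Dstay)
                     else Some (pc * 4 + 1, s, Dright)
      | IPop i a b => if digit i s == 0 then
                        if digit ntracks s == 1 then Some (pc.+1 * 4 + 1, s, Dstay)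
                        else Some (pc * 4 + 2, s, Dleft)
                      else Some (pc * 4 + 1, s, Dright)
      | IJmp a => Some (a * 4 + 1, s, Dstay)
      end
    else if pc == size prog then
      Some ((pc + (digit 0 s == 2)).+1 * 4 + 1, setdig ntracks 0 s, Dstay)
    else None
  | 2 => if nth (IJmp pc) prog pc is IPop i a b then
           Some ((if digit i s == 2 then b else a) * 4 + 3, setdig i 0 s, Dstay)
         else None
  | _ => if digit ntracks s == 1 then Some (pc * 4 + 1, s, Dstay)
         else Some (pc * 4 + 3, s, Dleft)
  end.
Proof.
move=> lt4; rewrite /ndelta divnMDl // divn_small // addn0 modnMDl modn_small //.
by case: ph lt4 => [|[|[|[|]]]].
Qed.

Lemma mark_tapeF st j : digit ntracks (tapeF st j) = (j == 0).
Proof. by rewrite digit_mark //; case: (j == 0). Qed.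

Lemma digit_tapeF st i j : i < ntracks -> digit i (tapeF st j) = sdig (st i) j.
Proof. by move=> lti; rewrite digit_symcode //; case: (j == 0). Qed.

Lemma tape_return c h pc st : tape_at c h (pc * 4 + 3) (tapeF st) ->
  pc < size prog + sumn (map itarget prog) + 3 ->
  tape_at (iter h.+1 (step machine) c) 0 (pc * 4 + 1) (tapeF st).
Proof.
move=> cF lt_pc; elim: h c cF => [|h IH] c cF.
  apply: (@tape_stay c 0 _ _ _ Dstay cF) => //; first exact: tapeF_lt.
    by rewrite ndelta4 // mark_tapeF.
  exact: state_lt.
rewrite iterSr; apply: IH.
apply: (@tape_stay c h.+1 _ _ _ Dleft cF) => //; first exact: tapeF_lt.
  by rewrite ndelta4 // mark_tapeF.
exact: state_lt.
Qed.

Definition is_jmp (x : instr) := if x is IJmp _ then true else false.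

Lemma tape_seek c pc st i : pc < size prog -> let x := nth (IJmp pc) prog pc in
  ~~ is_jmp x -> ireg x = i -> tape_at c 0 (pc * 4 + 1) (tapeF st) ->
  tape_at (iter (size (st i)) (step machine) c) (size (st i)) (pc * 4 + 1) (tapeF st).
Proof.
move=> lt_pc x notj xi cF; elim: {-2}(size _) (leqnn (size (st i))) => // n IH lt_n.
have lti : i < ntracks by rewrite -xi ireg_lt.
apply: (@tape_stay _ n _ _ _ Dright (IH (ltnW lt_n))) => //; first exact: tapeF_lt.
  rewrite ndelta4 // lt_pc -/x.
  by case: x notj xi => //= [r b|r a b] _ ->; rewrite digit_tapeF // /sdig lt_n.
by apply: state_lt => //; lia.
Qed.

Lemma sdig_upd st i s j k : (forall l, l != j -> sdig s l = sdig (st i) l) ->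
  i < ntracks -> sdig s j = k ->
  forall l, (if l == j then setdig i k (tapeF st j) else tapeF st l) = tapeF (upd st i s) l.
Proof.
move=> H lti <- l; rewrite /tapeF; case: eqP => [->|/eqP nlj].
  by rewrite (@setdig_symcode st _ j i _ s) //; case: (j == 0).
apply: eq_code => r _; rewrite /symdig /upd; case: ifP => // _.
by case: eqP => // ->; rewrite H.
Qed.

Lemma sdig_cons b s j : sdig (b :: s) j = if j == size s then b.+1 else sdig s j.
Proof.
rewrite /sdig /= rev_cons nth_rcons size_rev ltnS leq_eqVlt.
by case: ltngtP.
Qed.

(** The cost is a walk to the top of the stack and back; the additive constant pays for the changes
    of phase. Jumps and pops of an empty stack never leave the home cell. *)
Lemma tape_gstep c pc st : pc < size prog -> tape_at c 0 (pc * 4 + 1) (tapeF st) ->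
  let: (pc', st') := gstep (pc, st) in
  exists2 k, k <= (size (st (ireg (nth (IJmp pc) prog pc)))).*2 + 3 &
  tape_at (iter k (step machine) c) 0 (pc' * 4 + 1) (tapeF st').
Proof.
move=> lt_pc cF; have lti := ireg_lt pc; have le_t := itarget_le lt_pc.
rewrite /gstep; have := fun i => @tape_seek c pc st i lt_pc.
case E: (nth _ _ _) lti le_t => [i b|i a b|a] /= lti le_t.
- move/(_ i erefl erefl cF); set c1 := iter _ _ _ => c1F.
  exists (size (st i) + 1 + (size (st i)).+1); first by lia.
  rewrite addnC iterD; apply: tape_return; last by lia.
  rewrite addnC iterD -/c1; have := tape_step (d := Dstay) c1F.
  rewrite ndelta4 // lt_pc E digit_tapeF // {1}/sdig ltnn => /(_ _ _ erefl).
  case=> //; first by apply: state_lt => //; lia.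
    apply: code_lt => j _; case: eqP => [_|_]; first by case: (b).
    by rewrite ltn_mod.
  move=> H1 H2; split=> // j; rewrite H2.
  apply: sdig_upd => // [l /negPf nl|]; first by rewrite sdig_cons nl.
  by rewrite sdig_cons eqxx.
- move/(_ i erefl erefl cF); set c1 := iter _ _ _ => c1F.
  case Es: (st i) c1F => [|x s] c1F.
    exists 1 => //; rewrite -/(iter 1 _ _).
    apply: (@tape_stay _ 0 _ _ _ Dstay cF) => //; first exact: tapeF_lt.
      by rewrite ndelta4 // lt_pc E digit_tapeF // {1}/sdig Es /= mark_tapeF.
    by apply: state_lt => //; lia.
  exists (size s).+1.*2.+2 ; first by rewrite /= ; lia.
  pose x' := if x then b else a.
  have -> : (size s).+1.*2.+2 = (size s).+1 + (2 + size (st i)) by rewrite Es /=; lia.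
  rewrite iterD; apply: tape_return; last by case: (x); lia.
  rewrite iterD -/c1.
  have c2F : tape_at (step machine c1) (size s) (pc * 4 + 2) (tapeF st).
    apply: (@tape_stay _ (size s).+1 _ _ _ Dleft c1F) => //; first exact: tapeF_lt.
      by rewrite ndelta4 // lt_pc E digit_tapeF // {1}/sdig Es ltnn mark_tapeF.
    by apply: state_lt => //; lia.
  have := tape_step (d := Dstay) c2F.
  rewrite ndelta4 // E digit_tapeF // Es sdig_cons eqxx => /(_ _ _ erefl).
  have -> : (if x.+1 == 2 then b else a) = x' by rewrite /x'; case: (x).
  case=> //; first by apply: state_lt => //; rewrite /x'; case: (x); lia.
    by apply: code_lt => j _; case: eqP => // _; rewrite ltn_mod.
  move=> H1 H2; split=> // j; rewrite H2.
  apply: sdig_upd => // [l /negPf nl|]; first by rewrite Es sdig_cons nl.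
  by rewrite /sdig ltnn.
- move=> _; exists 1; first by lia.
  apply: (@tape_stay _ 0 _ _ _ Dstay cF) => //; first exact: tapeF_lt.
    by rewrite ndelta4 // lt_pc E.
  by apply: state_lt => //; lia.
Qed.

(** An instruction lengthens a stack by at most one bit, so all heights stay below [h + n] during
    [n] steps and the overhead is at most quadratic. *)
Lemma tape_goto n c pc st pc' st' h : iter n gstep (pc, st) = (pc', st') ->
  (forall i, size (st i) <= h) -> tape_at c 0 (pc * 4 + 1) (tapeF st) ->
  exists2 k, k <= n * ((h + n).*2 + 3) &
  tape_at (iter k (step machine) c) 0 (pc' * 4 + 1) (tapeF st').
Proof.
elim: n c pc st h => [|n IH] c pc st h.
  by move=> /= [<- <-] _ cF; exists 0.
rewrite iterSr => En sth cF; have [lt_pc|le_pc] := ltnP pc (size prog).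
  have := tape_gstep lt_pc cF; case Eg: (gstep (pc, st)) En => [pc1 st1] En [k le_k kF].
  have st1h i : size (st1 i) <= h.+1.
    move: Eg; rewrite /gstep; case: (nth _ _ _) => [r b|r a b|a].
    - by case=> _ <-; rewrite /upd; case: eqP => _ /=; rewrite ?ltnS ?sth // leqW.
    - case Er: (st r) => [|x s] [_ <-]; first by rewrite leqW.
      rewrite /upd; case: eqP => _; rewrite leqW //.
      by apply: leq_trans (sth r); rewrite Er leqW.
    - by case=> _ <-; rewrite leqW.
  have [k' le_k' k'F] := IH _ _ _ _ En st1h kF.
  exists (k' + k); last by rewrite iterD.
  have := sth (ireg (nth (IJmp pc) prog pc)).
  by nia.
have Eg : gstep (pc, st) = (pc, st) by rewrite /gstep nth_default.
rewrite Eg in En; have [k' le_k' k'F] := IH _ _ _ _ En sth cF.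
by exists k' => //; apply: leq_trans le_k' _; nia.
Qed.

Definition store1 (s : str) : store := upd (fun=> [::]) 0 s.

Lemma tape_init w : tape_at (init nstates.-1 (nsyms - 3) w) 0 0 (symcode (store1 (rev w)) 0).
Proof.
split=> [|j]; first by rewrite /init; case: w.
have -> : cell (init nstates.-1 (nsyms - 3) w) 0 j =
    nth (blank _) (map (sym_of_bit _) w) j.
  by rewrite /cell subn0 /init; case: w => //; case: j => [|j] /=; rewrite ?nth_nil.
rewrite /symcode code_digit0 // => [|i /andP[i0 _]]; last first.
  by rewrite /symdig /store1 /upd; case: ifP => // _; case: i i0.
rewrite /symdig /= /store1 /upd /= /sdig revK size_rev.
case: ltnP => [lt_j|le_j]; last by rewrite nth_default // size_map.
by rewrite (nth_map false) // /sym_of_bit; case: (nth _ _ _); rewrite inordK.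
Qed.

(** The first bit of a word lies on the home cell, which is the bottom of stack 0; hence [rev] on
    both sides. The two extra steps place and erase the home mark. *)
Lemma machine_correct w y n : iter n gstep (0, store1 (rev w)) = (size prog, store1 (rev y)) ->
  exists2 t, t <= n * ((size w + n).*2 + 3) + 2 &
  [/\ halted machine (run machine w t), output (run machine w t) = y
    & tm_accept machine (cstate (run machine w t)) = head false y].
Proof.
move=> En.
have c1F : tape_at (step machine (init _ _ w)) 0 (0 * 4 + 1) (tapeF (store1 (rev w))).
  have := tape_step (d := Dstay) (tape_init w) (ndelta4 0 _ (ph := 0) erefl).
  rewrite setdig_mark //; case=> [||//|H1 H2]; first by apply: state_lt => //; lia.
    exact: symcode_lt.
  by split=> // j; rewrite H2; case: j.
have [|k le_k kF] := tape_goto (h := size w) En _ c1F.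
  by move=> i; rewrite /store1 /upd; case: eqP; rewrite ?size_rev.
have /= := tape_step (d := Dstay) kF.
rewrite ndelta4 // ltnn eqxx digit_tapeF // setdig_mark // => /(_ _ _ erefl) [||//|].
- by apply: state_lt => //; case: (_ == _); lia.
- exact: symcode_lt.
set c := step _ _ => cst cF.
have Ec : c = run machine w (k + 2).
  by rewrite /run addn2 iterS iterSr.
have dh : (sdig (store1 (rev y) 0) 0 == 2) = head false y.
  by rewrite /store1 /upd /= /sdig revK size_rev; case: (y) => [|[]].
exists (k + 2); first by rewrite leq_add2r.
rewrite -Ec; split.
- rewrite /halted /= cst ndelta4 //; set b := _ == 2.
  have [-> ->] // : ((size prog + b).+1 < size prog) = false /\
    ((size prog + b).+1 == size prog) = false by split; lia.
- have cE j : cell c 0 j = (if j < size y then (nth false y j).+1 else 0) :> nat.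
    rewrite cF; have -> : (if j == 0 then symcode (store1 (rev y)) 0 0
      else tapeF (store1 (rev y)) j) = symcode (store1 (rev y)) 0 j by case: j.
    rewrite /symcode code_digit0 // => [|i /andP[i0 _]]; last first.
      by rewrite /symdig /store1 /upd; case: ifP => // _; case: i i0.
    by rewrite /symdig /= /store1 /upd /= /sdig revK size_rev.
  rewrite /output.
  have {}cE j : nth (blank (nsyms - 3)) (chead c :: cright c) j =
      (if j < size y then (nth false y j).+1 else 0) :> nat.
    by rewrite -cE /cell subn0.
  clear -cE; elim: y (_ :: _) cE => [|b y IH] [|x s] cE //.
  + by have /= := cE 0; rewrite /blank => ->.
  + by have := cE 0.
  + have x0 : x = b.+1 :> nat := cE 0.
    by have /= E := IH s (fun j => cE j.+1); case: b x0 {cE} => x0; rewrite /= x0 /= E ?x0.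
- by rewrite /= cst -dh; set b := _ == 2; case: b => /=; apply/eqP; lia.
Qed.
End Goto.

(** * Structured programs *)

Inductive cmd :=
  | Skip
  | Push of nat & bool
  | Seq of cmd & cmd
  | Case of nat & cmd & cmd & cmd
  | Loop of nat & cmd & cmd.

(* [Case i c0 c1 c2] and [Loop i c1 c2] pop register [i]; [c1] handles [false], [c2] handles
   [true], and [c0] the empty register. *)
Inductive exec : cmd -> store -> nat -> store -> Prop :=
  | ExSkip st : exec Skip st 0 st
  | ExPush st i b : exec (Push i b) st 1 (upd st i (b :: st i))
  | ExSeq c1 c2 st1 t1 st2 t2 st3 : exec c1 st1 t1 st2 -> exec c2 st2 t2 st3 ->
      exec (Seq c1 c2) st1 (t1 + t2) st3
  | ExCaseNil i c0 c1 c2 st t st' : st i = [::] -> exec c0 st t st' ->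
      exec (Case i c0 c1 c2) st (t + 2) st'
  | ExCaseCons i c0 c1 c2 st t st' b s : st i = b :: s ->
      exec (if b then c2 else c1) (upd st i s) t st' ->
      exec (Case i c0 c1 c2) st (t + 2) st'
  | ExLoopNil i c1 c2 st : st i = [::] -> exec (Loop i c1 c2) st 2 st
  | ExLoopCons i c1 c2 st t st' t' st'' b s : st i = b :: s ->
      exec (if b then c2 else c1) (upd st i s) t st' -> exec (Loop i c1 c2) st' t' st'' ->
      exec (Loop i c1 c2) st (t + t' + 2) st''.

(** The 2 that [exec] charges for a branching is exact: one pop and one closing jump. On an empty
    stack the pop falls through, to [p0] in a case and to the exit jump in a loop. *)
Fixpoint compile (pc : nat) (c : cmd) : seq instr :=
  match c with
  | Skip => [::]
  | Push i b => [:: IPush i b]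
  | Seq c1 c2 => let p1 := compile pc c1 in p1 ++ compile (pc + size p1) c2
  | Case i c0 c1 c2 =>
      let p0 := compile pc.+1 c0 in
      let pc1 := pc.+1 + (size p0).+1 in
      let p1 := compile pc1 c1 in
      let pc2 := pc1 + (size p1).+1 in
      let p2 := compile pc2 c2 in
      let e := pc2 + (size p2).+1 in
      IPop i pc1 pc2 :: p0 ++ IJmp e :: p1 ++ IJmp e :: p2 ++ [:: IJmp e]
  | Loop i c1 c2 =>
      let p1 := compile pc.+2 c1 in
      let pc2 := pc.+2 + (size p1).+1 in
      let p2 := compile pc2 c2 in
      let e := pc2 + (size p2).+1 in
      IPop i pc.+2 pc2 :: IJmp e :: p1 ++ IJmp pc :: p2 ++ [:: IJmp pc]
  end.

Local Arguments gstep : simpl never.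

Lemma gstep_at prog1 x prog2 pc st : size prog1 = pc ->
  gstep (prog1 ++ x :: prog2) (pc, st) = gstep (nseq pc (IJmp 0) ++ [:: x]) (pc, st).
Proof. by move=> <-; rewrite /gstep !nth_cat size_nseq !ltnn !subnn. Qed.

(** Jump addresses are absolute, so the induction is over code placed at an arbitrary offset of a
    larger program. *)
Lemma compile_correct c st t st' : exec c st t st' -> forall prog1 prog2 pc, size prog1 = pc ->
  iter t (gstep (prog1 ++ compile pc c ++ prog2)) (pc, st) = (pc + size (compile pc c), st').
Proof.
have jmp prog1 a prog2 pc st0 : size prog1 = pc -> gstep (prog1 ++ IJmp a :: prog2) (pc, st0) = (a, st0).
  by move=> /gstep_at ->; rewrite /gstep nth_cat size_nseq ltnn subnn.
have pop prog1 i a b prog2 pc st0 : size prog1 = pc ->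
    gstep (prog1 ++ IPop i a b :: prog2) (pc, st0) =
    if st0 i is x :: s then (if x then b else a, upd st0 i s) else (pc.+1, st0).
  by move=> /gstep_at ->; rewrite /gstep nth_cat size_nseq ltnn subnn.
elim=> {c st t st'}.
- by move=> st prog1 prog2 pc _; rewrite addn0.
- move=> st i b prog1 prog2 pc /= /gstep_at ->.
  by rewrite /gstep nth_cat size_nseq ltnn subnn addn1.
- move=> c1 c2 st1 t1 st2 t2 st3 _ IH1 _ IH2 prog1 prog2 pc szp /=.
  rewrite addnC iterD -catA IH1 // catA IH2 ?size_cat ?szp ?addnA //.
- move=> i c0 c1 c2 st t st' sti _ IH prog1 prog2 pc szp /=.
  set p0 := compile _ c0; set pc1 := pc.+1 + _; set p1 := compile _ c1; set pc2 := pc1 + _.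
  set p2 := compile _ c2; set e := pc2 + _; rewrite addn2 iterS iterSr pop // sti -catA.
  rewrite -cat_rcons IH ?size_rcons ?szp // -/p0 catA jmp ?size_cat ?size_rcons ?szp //.
  by congr (_, _); rewrite /= size_cat /= size_cat /= /e /pc2 /pc1; lia.
- move=> i c0 c1 c2 st t st' b s sti _ IH prog1 prog2 pc szp /=.
  set p0 := compile _ c0; set pc1 := pc.+1 + _; set p1 := compile _ c1; set pc2 := pc1 + _.
  set p2 := compile _ c2; set e := pc2 + _; rewrite addn2 iterS iterSr pop // sti.
  have -> : pc + (size (p0 ++ IJmp e :: p1 ++ IJmp e :: p2 ++ [:: IJmp e])).+1 = e.
    by rewrite size_cat /= size_cat /= size_cat /= /e /pc2 /pc1 ; lia.
  case: b IH {sti} => IH.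
  + have -> : prog1 ++ (IPop i pc1 pc2 :: p0 ++ IJmp e :: p1 ++ IJmp e :: p2 ++ [:: IJmp e]) ++ prog2 =
      (prog1 ++ IPop i pc1 pc2 :: p0 ++ IJmp e :: p1 ++ [:: IJmp e]) ++ p2 ++ IJmp e :: prog2.
      by rewrite /= -?catA /= -?catA /= -?catA /= -?catA.
    have sz : size (prog1 ++ IPop i pc1 pc2 :: p0 ++ IJmp e :: p1 ++ [:: IJmp e]) = pc2.
      by rewrite size_cat /= size_cat /= size_cat /= szp /pc2 /pc1; lia.
    by rewrite IH // catA jmp // size_cat sz.
  + have -> : prog1 ++ (IPop i pc1 pc2 :: p0 ++ IJmp e :: p1 ++ IJmp e :: p2 ++ [:: IJmp e]) ++ prog2 =
      (prog1 ++ IPop i pc1 pc2 :: p0 ++ [:: IJmp e]) ++ p1 ++ IJmp e :: p2 ++ IJmp e :: prog2.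
      by rewrite /= -?catA /= -?catA /= -?catA /= -?catA.
    have sz : size (prog1 ++ IPop i pc1 pc2 :: p0 ++ [:: IJmp e]) = pc1.
      by rewrite size_cat /= size_cat /= szp /pc1; lia.
    by rewrite IH // catA jmp // size_cat sz.
- move=> i c1 c2 st sti prog1 prog2 pc szp /=.
  set p1 := compile _ c1; set pc2 := pc.+2 + _; set p2 := compile _ c2; set e := pc2 + _.
  rewrite pop // sti -cat_rcons jmp ?size_rcons ?szp //.
  by congr (_, _); rewrite size_cat /= size_cat /= /e /pc2; lia.
- move=> i c1 c2 st t st' t' st'' b s sti _ IH _ IHL prog1 prog2 pc szp.
  have := IHL prog1 prog2 pc szp; rewrite /=.
  set p1 := compile _ c1; set pc2 := pc.+2 + _; set p2 := compile _ c2; set e := pc2 + _.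
  have -> : t + t' + 2 = t' + t.+2 by lia.
  rewrite iterD => EL; suff -> : iter t.+2 (gstep (prog1 ++ (IPop i pc.+2 pc2 :: IJmp e :: p1 ++
     IJmp pc :: p2 ++ [:: IJmp pc]) ++ prog2)) (pc, st) = (pc, st') by [].
  rewrite iterS iterSr pop // sti; case: b IH {sti} => IH.
  + have -> : prog1 ++ (IPop i pc.+2 pc2 :: IJmp e :: p1 ++ IJmp pc :: p2 ++ [:: IJmp pc]) ++ prog2 =
      (prog1 ++ IPop i pc.+2 pc2 :: IJmp e :: p1 ++ [:: IJmp pc]) ++ p2 ++ IJmp pc :: prog2.
      by rewrite /= -?catA /= -?catA /= -?catA /= -?catA.
    have sz : size (prog1 ++ IPop i pc.+2 pc2 :: IJmp e :: p1 ++ [:: IJmp pc]) = pc2.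
      by rewrite size_cat /= size_cat /= szp /pc2; lia.
    by rewrite IH // catA jmp // size_cat sz.
  + have -> : prog1 ++ (IPop i pc.+2 pc2 :: IJmp e :: p1 ++ IJmp pc :: p2 ++ [:: IJmp pc]) ++ prog2 =
      (prog1 ++ [:: IPop i pc.+2 pc2; IJmp e]) ++ p1 ++ IJmp pc :: p2 ++ IJmp pc :: prog2.
      by rewrite /= -?catA /= -?catA /= -?catA /= -?catA.
    have sz : size (prog1 ++ [:: IPop i pc.+2 pc2; IJmp e]) = pc.+2.
      by rewrite size_cat szp addn2.
    by rewrite IH // catA jmp // size_cat sz.
Qed.

Lemma exec_size c st t st' : exec c st t st' -> forall i, size (st' i) <= size (st i) + t.
Proof.
elim=> {c st t st'}.
- by move=> st i; rewrite addn0.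
- by move=> st i b j; rewrite /upd; case: eqP => [->|_] /=; lia.
- by move=> c1 c2 st1 t1 st2 t2 st3 _ IH1 _ IH2 i; have := IH1 i; have := IH2 i; lia.
- by move=> i c0 c1 c2 st t st' _ _ IH j; have := IH j; lia.
- move=> i c0 c1 c2 st t st' b s sti _ IH j; have := IH j; rewrite /upd.
  by case: eqP => [->|_]; rewrite ?sti /=; lia.
- by move=> *; lia.
- move=> i c1 c2 st t st' t' st'' b s sti _ IH1 _ IH2 j; have := IH1 j; have := IH2 j.
  by rewrite /upd; case: eqP => [->|_]; rewrite ?sti /=; lia.
Qed.

(** * Blocks of registers: copying, shifting and deleting *)

Definition st_of (e : seq str) : store := nth [::] e.

Definition tot (e : seq str) : nat := sumn (map size e).

Lemma tot_cat e1 e2 : tot (e1 ++ e2) = tot e1 + tot e2.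
Proof. by rewrite /tot map_cat sumn_cat. Qed.

Lemma tot_cons s e : tot (s :: e) = size s + tot e. Proof. by []. Qed.

(** Registers beyond the end of the list read as empty, so trailing empty registers appear and
    vanish at will. This provides the scratch registers. *)
Lemma st_of_nil p : st_of (p ++ [:: [::]]) = st_of p.
Proof.
apply: functional_extensionality => i; rewrite /st_of nth_cat.
case: ltnP => // le_pi; rewrite [RHS]nth_default //.
by case: (i - size p) => [|[]].
Qed.

Lemma st_of_at p s q : st_of (p ++ s :: q) (size p) = s.
Proof. by rewrite /st_of nth_cat ltnn subnn. Qed.

Lemma upd_st_of p s q s' i : size p = i -> upd (st_of (p ++ s :: q)) i s' = st_of (p ++ s' :: q).
Proof.
move=> <-; apply: functional_extensionality => j; rewrite /upd /st_of !nth_cat.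
case: ltngtP => // [|->]; last by rewrite subnn.
by move=> lt; rewrite -(subnSK lt).
Qed.

Lemma upd_st_of_end p s i : size p = i -> upd (st_of p) i s = st_of (p ++ [:: s]).
Proof. by move=> szp; rewrite -(st_of_nil p) upd_st_of. Qed.

(** Pouring one stack into another reverses it; a second pouring restores the order. *)
Definition mv i j := Loop i (Push j false) (Push j true).

Lemma exec_mv i j st : i != j ->
  exec (mv i j) st (3 * size (st i) + 2) (upd (upd st j (catrev (st i) (st j))) i [::]).
Proof.
move=> nij; move Es: (st i) => s; elim: s st Es => [|b s IH] st Es.
  have -> : upd (upd st j (catrev [::] (st j))) i [::] = st.
    by apply: functional_extensionality => k; rewrite /upd; do 2![case: eqP => [->|_] /=; rewrite ?Es //].
  exact: ExLoopNil.
pose st1 := upd st i s; pose st2 := upd st1 j (b :: st1 j).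
have -> : 3 * size (b :: s) + 2 = 1 + (3 * size s + 2) + 2 by rewrite /=; lia.
have -> : upd (upd st j (catrev (b :: s) (st j))) i [::] = upd (upd st2 j (catrev s (st2 j))) i [::].
  apply: functional_extensionality => k; rewrite /st2 /st1 /upd eqxx (eq_sym j) (negPf nij).
  by case: eqP => //; case: eqP.
apply: (ExLoopCons (st' := st2) (b := b) (s := s)) => //.
  by case: b {Es} @st2 => st2; apply: ExPush.
by apply: IH; rewrite /st2 /st1 /upd (negPf nij) eqxx.
Qed.

Definition mv2 k i j := Loop k (Seq (Push i false) (Push j false)) (Seq (Push i true) (Push j true)).

Lemma exec_mv2 k i j st : k != i -> k != j -> i != j ->
  exec (mv2 k i j) st (4 * size (st k) + 2)
    (upd (upd (upd st i (catrev (st k) (st i))) j (catrev (st k) (st j))) k [::]).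
Proof.
move=> nki nkj nij; move Es: (st k) => s; elim: s st Es => [|b s IH] st Es.
  have -> : upd (upd (upd st i (catrev [::] (st i))) j (catrev [::] (st j))) k [::] = st.
    by apply: functional_extensionality => l; rewrite /upd; do 3![case: eqP => [->|_] /=; rewrite ?Es //].
  exact: ExLoopNil.
pose st1 := upd st k s; pose st2 := upd st1 i (b :: st1 i); pose st3 := upd st2 j (b :: st2 j).
have -> : 4 * size (b :: s) + 2 = (1 + 1) + (4 * size s + 2) + 2 by rewrite /=; lia.
have -> : upd (upd (upd st i (catrev (b :: s) (st i))) j (catrev (b :: s) (st j))) k [::] =
          upd (upd (upd st3 i (catrev s (st3 i))) j (catrev s (st3 j))) k [::].
  apply: functional_extensionality => l; rewrite /st3 /st2 /st1 /upd !eqxx.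
  rewrite (negPf nij) (eq_sym j i) (negPf nij) (eq_sym i k) (negPf nki) (eq_sym j k) (negPf nkj).
  by do 3![case: eqP => // _].
apply: (ExLoopCons (st' := st3) (b := b) (s := s)) => //.
  by case: b {Es} @st2 @st3 => st2 st3; apply: ExSeq; apply: ExPush.
by apply: IH; rewrite /st3 /st2 /st1 /upd (negPf nki) (negPf nkj) eqxx.
Qed.

Definition clr i := Loop i Skip Skip.

Lemma exec_clr i st : exec (clr i) st (2 * size (st i) + 2) (upd st i [::]).
Proof.
move Es: (st i) => s; elim: s st Es => [|b s IH] st Es.
  have -> : upd st i [::] = st.
    by apply: functional_extensionality => k; rewrite /upd; case: eqP => // ->; rewrite Es.
  exact: ExLoopNil.
have -> : 2 * size (b :: s) + 2 = 0 + (2 * size s + 2) + 2 by rewrite /=; lia.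
have -> : upd st i [::] = upd (upd st i s) i [::].
  by apply: functional_extensionality => k; rewrite /upd; case: eqP.
apply: (ExLoopCons (st' := upd st i s) (b := b) (s := s)) => //.
  by case: b {Es}; apply: ExSkip.
by apply: IH; rewrite /upd eqxx.
Qed.

Definition lexec c e t e' := exec c (st_of e) t (st_of e').

Lemma lexec_seq c1 c2 e1 t1 e2 t2 e3 : lexec c1 e1 t1 e2 -> lexec c2 e2 t2 e3 ->
  lexec (Seq c1 c2) e1 (t1 + t2) e3.
Proof. exact: ExSeq. Qed.

(* Register [j.+1] is scratch: it has to be empty, as well as [j]. *)
Definition copy i j := Seq (mv i j.+1) (mv2 j.+1 i j).

(** The content is poured into the scratch register, which reverses it, and from there into [i] and
    [j] simultaneously, which restores the order in both. *)
Lemma lexec_copy p s q i j : size p = i -> size p + (size q).+1 = j ->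
  lexec (copy i j) (p ++ s :: q) (7 * size s + 4) (p ++ s :: q ++ [:: s]).
Proof.
move=> szp szj; have -> : 7 * size s + 4 = (3 * size s + 2) + (4 * size s + 2) by lia.
have E1 : upd (upd (st_of (p ++ s :: q)) j.+1 (rev s)) i [::] =
   st_of (p ++ [::] :: q ++ [:: [::]; rev s]).
  rewrite -st_of_nil upd_st_of_end; last by rewrite !size_cat /=; lia.
  by rewrite -!catA /= upd_st_of.
apply: (@lexec_seq _ _ _ _ (p ++ [::] :: q ++ [:: [::]; rev s])).
  have := @exec_mv i j.+1 (st_of (p ++ s :: q)).
  have -> : st_of (p ++ s :: q) i = s by rewrite -szp st_of_at.
  rewrite [st_of _ j.+1]nth_default ?size_cat /=; last by lia.
  by rewrite -/(rev s) E1; apply; lia.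
rewrite /lexec; set st := st_of _.
have stj : st j.+1 = rev s.
  rewrite /st /st_of nth_cat ltnNge -szj leqW ?leq_addr //=.
  have -> : (size p + (size q).+1).+1 - size p = (size q).+2 by lia.
  by rewrite /= nth_cat ltnNge leqnSn /= subSnn.
have stj1 : st j = [::].
  rewrite /st /st_of nth_cat ltnNge -szj ?leq_addr //=.
  have -> : (size p + (size q).+1) - size p = (size q).+1 by lia.
  by rewrite /= nth_cat ltnn /= subnn.
have sti : st i = [::] by rewrite /st -szp st_of_at.
have := @exec_mv2 j.+1 i j st; rewrite stj stj1 sti size_rev.
rewrite -/(rev (rev s)) revK.
have -> : upd (upd (upd st i s) j s) j.+1 [::] = st_of (p ++ s :: q ++ [:: s]).
  rewrite /st upd_st_of // -cat_cons catA upd_st_of; last by rewrite size_cat /=; lia.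
  have -> : (p ++ s :: q) ++ [:: s; rev s] = ((p ++ s :: q) ++ [:: s]) ++ rev s :: [::].
    by rewrite -[RHS]catA.
  rewrite upd_st_of; last by rewrite !size_cat /=; lia.
  by rewrite st_of_nil -catA.
by apply; lia.
Qed.

(* Register [k] is scratch: it has to be empty, as well as [i]. *)
Definition shift1 i k := Seq (mv i.+1 k) (mv k i).

Lemma lexec_shift1 p s q i k : size p = i -> size p + (size q).+2 = k ->
  lexec (shift1 i k) (p ++ [::] :: s :: q) (6 * size s + 4) (p ++ s :: [::] :: q).
Proof.
move=> szp szk; have -> : 6 * size s + 4 = (3 * size s + 2) + (3 * size s + 2) by lia.
apply: (@lexec_seq _ _ _ _ (p ++ [::] :: [::] :: q ++ [:: rev s])).
  have := @exec_mv i.+1 k (st_of (p ++ [::] :: s :: q)).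
  have E : p ++ [::] :: s :: q = (p ++ [:: [::]]) ++ s :: q by rewrite -catA.
  have szp' : size (p ++ [:: [::] : str]) = i.+1 by rewrite size_cat /= addn1 szp.
  have -> : st_of (p ++ [::] :: s :: q) i.+1 = s by rewrite E -szp' st_of_at.
  rewrite [st_of _ k]nth_default ?size_cat /=; last by lia.
  rewrite -/(rev s) upd_st_of_end; last by rewrite size_cat /=; lia.
  have -> : (p ++ [::] :: s :: q) ++ [:: rev s] = (p ++ [:: [::]]) ++ s :: q ++ [:: rev s].
    by rewrite -!catA.
  by rewrite upd_st_of // -catA /=; apply; lia.
have := @exec_mv k i (st_of (p ++ [::] :: [::] :: q ++ [:: rev s])).
have E : p ++ [::] :: [::] :: q ++ [:: rev s] = (p ++ [::] :: [::] :: q) ++ [:: rev s] by rewrite -catA.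
have szp' : size (p ++ [::] :: ([::] : str) :: q) = k by rewrite size_cat /=; lia.
have stk : st_of (p ++ [::] :: [::] :: q ++ [:: rev s]) k = rev s by rewrite E -szp' st_of_at.
have sti : st_of (p ++ [::] :: [::] :: q ++ [:: rev s]) i = [::] by rewrite -szp st_of_at.
rewrite stk sti size_rev -/(rev (rev s)) revK.
rewrite upd_st_of //.
have -> : p ++ s :: [::] :: q ++ [:: rev s] = (p ++ s :: [::] :: q) ++ [:: rev s] by rewrite -catA.
rewrite upd_st_of ?st_of_nil; last by rewrite size_cat /=; lia.
by apply; lia.
Qed.

Fixpoint copyblk m i d := if m is m'.+1 then Seq (copy i (i + d)) (copyblk m' i.+1 d) else Skip.

Lemma lexec_copyblk p x q i d : size p = i -> size x + size q = d ->
  lexec (copyblk (size x) i d) (p ++ x ++ q) (7 * tot x + 4 * size x) (p ++ x ++ q ++ x).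
Proof.
elim: x p q i => [|s x IH] p q i szp szd; first by rewrite cats0; apply: ExSkip.
have -> : 7 * tot (s :: x) + 4 * size (s :: x) = (7 * size s + 4) + (7 * tot x + 4 * size x).
  by rewrite /tot /=; lia.
apply: (@lexec_seq _ _ _ _ (p ++ s :: (x ++ q) ++ [:: s])).
  by apply: lexec_copy => //; rewrite size_cat -szd szp.
have := IH (p ++ [:: s]) (q ++ [:: s]) i.+1; rewrite !size_cat /= !addn1 szp -!catA /=; apply=> //.
by rewrite addnS.
Qed.

(* Removes the empty register [i], shifting down the [m] registers above it. *)
Fixpoint shiftdown m i := if m is m'.+1 then Seq (shift1 i (i + m'.+2)) (shiftdown m' i.+1) else Skip.

Lemma lexec_shiftdown p q i : size p = i ->
  lexec (shiftdown (size q) i) (p ++ [::] :: q) (6 * tot q + 4 * size q) (p ++ q).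
Proof.
elim: q p i => [|s q IH] p i szp; first by rewrite /lexec st_of_nil cats0; apply: ExSkip.
have -> : 6 * tot (s :: q) + 4 * size (s :: q) = (6 * size s + 4) + (6 * tot q + 4 * size q).
  by rewrite /tot /=; lia.
apply: (@lexec_seq _ _ _ _ (p ++ s :: [::] :: q)); first by apply: lexec_shift1; rewrite ?szp.
by have := IH (p ++ [:: s]) i.+1; rewrite size_cat addn1 szp -!catA /=; apply.
Qed.

(** Drops [k] registers from position [i] on; the [m] registers above move down to close the gap.
    Intermediate values are discarded this way. *)
Fixpoint delblk k i m :=
  if k is k'.+1 then Seq (Seq (clr i) (shiftdown (k' + m) i)) (delblk k' i m) else Skip.

Lemma lexec_delblk p x q i : size p = i ->
  exists2 t, t <= (size x).+1 * (6 * tot (x ++ q) + 4 * size (x ++ q)) &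
    lexec (delblk (size x) i (size q)) (p ++ x ++ q) t (p ++ q).
Proof.
elim: x p => [|s x IH] p szp; first by exists 0; [|apply: ExSkip].
have [t le_t Ht] := IH p szp.
exists ((2 * size s + 2) + (6 * tot (x ++ q) + 4 * size (x ++ q)) + t).
  by move: le_t; rewrite /= tot_cons; nia.
apply: lexec_seq Ht; apply: (@lexec_seq _ _ _ _ (p ++ [::] :: x ++ q)).
  have := exec_clr i (st_of (p ++ s :: x ++ q)).
  have -> : st_of (p ++ s :: x ++ q) i = s by rewrite -szp st_of_at.
  by rewrite upd_st_of.
by rewrite -size_cat; apply: lexec_shiftdown.
Qed.

(** * Polynomial-time functions *)

(** The number of registers depends on the type only, so that programs address them statically; a
    pair is a mere concatenation. [Enc1] singles out the types held in one register, whose values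
    can become entries of a list. *)
Class Enc (X : Type) := { arity : nat; regs : X -> seq str; size_regs : forall x, size (regs x) = arity }.
Arguments arity X {_}.
Arguments regs {X _} : simpl never.

Class Enc1 (A : Type) := enc1 : A -> str.

#[export] Instance Enc_of_Enc1 (A : Type) `{Enc1 A} : Enc A :=
  {| arity := 1; regs := fun a => [:: enc1 a]; size_regs := fun _ => erefl |}.

#[export] Program Instance Enc_prod (X Y : Type) `{Enc X} `{Enc Y} : Enc (X * Y) :=
  {| arity := arity X + arity Y; regs := fun x => regs x.1 ++ regs x.2 |}.
Next Obligation. by rewrite size_cat !size_regs. Qed.

#[export] Instance Enc1_str : Enc1 str := id.
(** Unary notation makes a number its own loop counter and its size equal to its value. It restricts
    [FP] to numbers bounded polynomially. *)
#[export] Instance Enc1_nat : Enc1 nat := fun n => nseq n true.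
#[export] Instance Enc1_bool : Enc1 bool := fun b => [:: b].

Definition sz {X} `{Enc X} (x : X) : nat := tot (regs x).

Lemma sz_pair X Y `{Enc X} `{Enc Y} (x : X) (y : Y) : sz (x, y) = sz x + sz y.
Proof. exact: tot_cat. Qed.

Lemma sz_fst X Y `{Enc X} `{Enc Y} (x : X * Y) : sz x.1 <= sz x.
Proof. by case: x => x y; rewrite sz_pair leq_addr. Qed.

Lemma sz_snd X Y `{Enc X} `{Enc Y} (x : X * Y) : sz x.2 <= sz x.
Proof. by case: x => x y; rewrite sz_pair leq_addl. Qed.

Lemma sz1 A `{Enc1 A} (a : A) : sz a = size (enc1 a).
Proof. exact: addn0. Qed.

Lemma sz_nat (n : nat) : sz n = n.
Proof. by rewrite sz1 /enc1 /Enc1_nat size_nseq. Qed.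

Lemma sz_str (s : str) : sz s = size s.
Proof. exact: sz1. Qed.

Lemma sz_bool (b : bool) : sz b = 1.
Proof. exact: sz1. Qed.

Section PolyBound.
Context {X : Type} `{Enc X}.
Implicit Types m : X -> nat.

(** Since the base is at least 2, one exponent absorbs constants, factors and sums. *)
Definition pb m := exists D, forall x, m x <= (sz x + 2) ^ D.

Lemma pb_leq m m' : (forall x, m x <= m' x) -> pb m' -> pb m.
Proof. by move=> le_m [D HD]; exists D => x; apply: leq_trans (le_m x) (HD x). Qed.

Lemma pb_exp D : pb (fun x => (sz x + 2) ^ D).
Proof. by exists D. Qed.

Lemma pb_sz : pb (fun x => sz x).
Proof. by exists 1 => x; rewrite expn1 leq_addr. Qed.

Lemma pb_const c : pb (fun=> c).
Proof.
exists c => x; apply: leq_trans (ltnW (ltn_expl c (ltnSn 1))) _.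
by case: c => // c; rewrite leq_exp2r // leq_addl.
Qed.

Lemma pb_mul m1 m2 : pb m1 -> pb m2 -> pb (fun x => m1 x * m2 x).
Proof.
by move=> [D1 H1] [D2 H2]; exists (D1 + D2) => x; rewrite expnD leq_mul ?H1 ?H2.
Qed.

Lemma pb_add m1 m2 : pb m1 -> pb m2 -> pb (fun x => m1 x + m2 x).
Proof.
move=> [D1 H1] [D2 H2]; exists (1 + (D1 + D2)) => x; rewrite !expnD expn1.
have a_gt0 : 0 < (sz x + 2) ^ D1 by rewrite expn_gt0 addn2.
have b_gt0 : 0 < (sz x + 2) ^ D2 by rewrite expn_gt0 addn2.
apply: leq_trans (leq_add (H1 x) (H2 x)) _.
move: (_ ^ D1) (_ ^ D2) a_gt0 b_gt0 => a b a_gt0 b_gt0.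
have : a + b <= 2 * (a * b) by nia.
by move=> le_ab; apply: leq_trans le_ab _; rewrite leq_mul2r leq_addl orbT.
Qed.
End PolyBound.

Lemma poly_comp D E : exists F, forall n, ((n + 2) ^ D + 2) ^ E <= (n + 2) ^ F.
Proof.
exists (D.+2 * E) => n; case: E => [|E]; first by rewrite muln0.
rewrite expnM leq_exp2r // !expnSr.
have : 0 < (n + 2) ^ D by rewrite expn_gt0 addn2.
by move: (_ ^ D) => a; nia.
Qed.

(* The command is given the number of registers already in use; it must preserve them. *)
Definition FP X Y `{Enc X} `{Enc Y} (f : X -> Y) :=
  exists (c : nat -> cmd) (D : nat), forall p x, exists2 t, t <= (sz x + 2) ^ D &
    lexec (c (size p)) (p ++ regs x) t (p ++ regs x ++ regs (f x)).

Lemma FP_intro X Y `{Enc X} `{Enc Y} (f : X -> Y) (c : nat -> cmd) (m : X -> nat) : pb m ->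
  (forall p x, exists2 t, t <= m x &
    lexec (c (size p)) (p ++ regs x) t (p ++ regs x ++ regs (f x))) -> FP f.
Proof.
move=> [D HD] Hc; exists c, D => p x; have [t le_t Ht] := Hc p x.
by exists t => //; apply: leq_trans le_t (HD x).
Qed.

Lemma FP_regs X Y Y' `{Enc X} `{Enc Y} `{Enc Y'} (f : X -> Y) (g : X -> Y') :
  FP g -> (forall x, regs (f x) = regs (g x)) -> FP f.
Proof. by move=> [c [D Hc]] eq_fg; exists c, D => p x; rewrite eq_fg. Qed.

Lemma FP_ext X Y `{Enc X} `{Enc Y} (g f : X -> Y) : FP g -> f =1 g -> FP f.
Proof. by move=> FPg eq_fg; apply: (FP_regs FPg) => x; rewrite eq_fg. Qed.

Lemma lexec_tot c e t e1 e2 : lexec c e t (e1 ++ e2) -> size e <= size e1 -> tot e2 <= size e2 * t.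
Proof.
move=> /exec_size Hc le_e; elim: e2 e1 le_e Hc => [|s e2 IH] e1 le_e Hc //.
rewrite tot_cons /= mulSn leq_add //.
  by have := Hc (size e1); rewrite st_of_at [st_of e _]nth_default.
apply: (IH (e1 ++ [:: s])); first by rewrite size_cat addn1 leqW.
by rewrite -catA.
Qed.

(** The result registers are empty at the start and gain at most one bit per time unit, so the
    running time bounds the size of the result. *)
Lemma FP_size X Y `{Enc X} `{Enc Y} (f : X -> Y) : FP f -> pb (fun x => sz (f x)).
Proof.
move=> [c [D Hc]]; apply: pb_leq (pb_mul (pb_const (arity Y)) (pb_exp D)) => x.
have [t le_t Ht] := Hc [::] x; rewrite -(size_regs (f x)).
apply: leq_trans (lexec_tot (e1 := regs x) Ht _) _ => //.
by rewrite leq_mul2l le_t orbT.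
Qed.

Lemma pb_comp X Y `{Enc X} `{Enc Y} (f : X -> Y) (m : Y -> nat) : FP f -> pb m -> pb (fun x => m (f x)).
Proof.
move=> /FP_size [D HD] [E HE]; have [F HF] := poly_comp D E.
exists F => x; apply: leq_trans (HE _) (leq_trans _ (HF _)).
by case: (E) => // n; rewrite leq_exp2r // leq_add2r.
Qed.

(** Results are appended above the argument: [g] runs on top of [f x], and the block of [f x] below
    its result is then deleted. *)
Lemma FP_comp X Y Z `{Enc X} `{Enc Y} `{Enc Z} (g : Y -> Z) (f : X -> Y) :
  FP g -> FP f -> FP (fun x => g (f x)).
Proof.
move=> FPg FPf; have := FPg => -[cg [Dg Hg]]; have := FPf => -[cf [Df Hf]].
apply: (FP_intro (c := fun n => Seq (cf n) (Seq (cg (n + arity X))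
  (delblk (arity Y) (n + arity X) (arity Z))))
  (m := fun x => (sz x + 2) ^ Df + ((sz (f x) + 2) ^ Dg +
    (arity Y).+1 * (6 * (sz (f x) + sz (g (f x))) + 4 * (arity Y + arity Z))))).
  apply: pb_add (pb_exp Df) (pb_comp (m := fun y => (sz y + 2) ^ Dg +
    (arity Y).+1 * (6 * (sz y + sz (g y)) + 4 * (arity Y + arity Z))) FPf _).
  apply: pb_add (pb_exp Dg) (pb_mul (pb_const _) (pb_add (pb_mul (pb_const _) _) (pb_const _))).
  exact: pb_add (@pb_sz _ _) (FP_size FPg).
move=> p x; have [t1 le1 K1] := Hf p x; have [t2 le2 K2] := Hg (p ++ regs x) (f x).
have szp : size (p ++ regs x) = size p + arity X by rewrite size_cat size_regs.
have [t3 le3 K3] := lexec_delblk (regs (f x)) (regs (g (f x))) szp.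
rewrite tot_cat size_cat !size_regs in le3 K3; rewrite szp in K2.
exists (t1 + (t2 + t3)); first by rewrite leq_add // leq_add.
apply: lexec_seq K1 _; rewrite catA; apply: lexec_seq K2 _.
by rewrite [in X in lexec _ _ _ X]catA.
Qed.

(** A command expects its argument in the topmost registers, so [x] is copied above [f x] for the
    benefit of [g], and this copy is deleted afterwards. *)
Lemma FP_pair X Y Z `{Enc X} `{Enc Y} `{Enc Z} (f : X -> Y) (g : X -> Z) :
  FP f -> FP g -> FP (fun x => (f x, g x)).
Proof.
move=> FPf FPg; have := FPg => -[cg [Dg Hg]]; have := FPf => -[cf [Df Hf]].
apply: (FP_intro (c := fun n => Seq (cf n) (Seq (copyblk (arity X) n (arity X + arity Y))
  (Seq (cg (n + (arity X + arity Y))) (delblk (arity X) (n + (arity X + arity Y)) (arity Z)))))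
  (m := fun x => (sz x + 2) ^ Df + ((7 * sz x + 4 * arity X) + ((sz x + 2) ^ Dg +
    (arity X).+1 * (6 * (sz x + sz (g x)) + 4 * (arity X + arity Z)))))).
  apply: pb_add (pb_exp Df) (pb_add _ (pb_add (pb_exp Dg) (pb_mul (pb_const _)
    (pb_add (pb_mul (pb_const _) _) (pb_const _))))).
    exact: pb_add (pb_mul (pb_const _) (@pb_sz _ _)) (pb_const _).
  exact: pb_add (@pb_sz _ _) (FP_size FPg).
move=> p x; have [t1 le1 K1] := Hf p x.
have [t2 le2 K2] := Hg (p ++ regs x ++ regs (f x)) x.
have szp : size (p ++ regs x ++ regs (f x)) = size p + (arity X + arity Y).
  by rewrite !size_cat !size_regs.
have [t3 le3 K3] := lexec_delblk (regs x) (regs (g x)) szp.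
rewrite tot_cat size_cat !size_regs in le3 K3; rewrite szp in K2.
exists (t1 + ((7 * sz x + 4 * arity X) + (t2 + t3))); first by rewrite leq_add // leq_add // leq_add.
apply: lexec_seq K1 (lexec_seq (e2 := (p ++ regs x ++ regs (f x)) ++ regs x) _ _).
  pose proof (@lexec_copyblk p (regs x) (regs (f x)) _ _ erefl erefl) as K.
  by move: K; rewrite !size_regs -!catA.
have -> : p ++ regs x ++ regs (f x, g x) = (p ++ regs x ++ regs (f x)) ++ regs (g x).
  by rewrite -!catA.
exact: lexec_seq K2 K3.
Qed.

Lemma FP_id X `{Enc X} : FP (fun x : X => x).
Proof.
apply: (FP_intro (c := fun n => copyblk (arity X) n (arity X)) (m := fun x => 7 * sz x + 4 * arity X)).
  exact: pb_add (pb_mul (pb_const _) (@pb_sz _ _)) (pb_const _).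
move=> p x; pose proof (@lexec_copyblk p (regs x) [::] _ _ erefl erefl) as K.
by rewrite cats0 addn0 size_regs in K; exists (7 * sz x + 4 * arity X).
Qed.

Lemma FP_fst X Y `{Enc X} `{Enc Y} : FP (fun x : X * Y => x.1).
Proof.
apply: (FP_intro (c := fun n => copyblk (arity X) n (arity X + arity Y))
  (m := fun x => 7 * sz x + 4 * arity X)).
  exact: pb_add (pb_mul (pb_const _) (@pb_sz _ _)) (pb_const _).
move=> p x; pose proof (@lexec_copyblk p (regs x.1) (regs x.2) _ _ erefl erefl) as K.
rewrite !size_regs in K;  exists (7 * sz x.1 + 4 * arity X).
  by pose proof (sz_fst x); lia.
by move: K; rewrite /regs /= -!catA.
Qed.

Lemma FP_snd X Y `{Enc X} `{Enc Y} : FP (fun x : X * Y => x.2).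
Proof.
apply: (FP_intro (c := fun n => copyblk (arity Y) (n + arity X) (arity Y))
  (m := fun x => 7 * sz x + 4 * arity Y)).
  exact: pb_add (pb_mul (pb_const _) (@pb_sz _ _)) (pb_const _).
move=> p x; pose proof (@lexec_copyblk (p ++ regs x.1) (regs x.2) [::] _ _ erefl erefl) as K.
rewrite size_cat !size_regs addn0 !cats0 in K;  exists (7 * sz x.2 + 4 * arity Y).
  by pose proof (sz_snd x); lia.
by move: K; rewrite /regs /= -!catA.
Qed.

Fixpoint pushes (i : nat) (s : str) : cmd :=
  if s is b :: s' then Seq (pushes i s') (Push i b) else Skip.

Lemma lexec_pushes p s i : size p = i -> lexec (pushes i s) p (size s) (p ++ [:: s]).
Proof.
move=> szp; elim: s => [|b s IH] /=; first by rewrite /lexec st_of_nil; apply: ExSkip.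
rewrite -addn1; apply: lexec_seq IH _.
have := ExPush (st_of (p ++ [:: s])) i b; rewrite upd_st_of // -{2}szp st_of_at; exact.
Qed.

Fixpoint pushblk (i : nat) (e : seq str) : cmd :=
  if e is s :: e' then Seq (pushes i s) (pushblk i.+1 e') else Skip.

Lemma lexec_pushblk p e i : size p = i -> lexec (pushblk i e) p (tot e) (p ++ e).
Proof.
elim: e p i => [|s e IH] p i szp; first by rewrite cats0; apply: ExSkip.
rewrite tot_cons; apply: lexec_seq (lexec_pushes s szp) _.
by have := IH (p ++ [:: s]) i.+1; rewrite size_cat addn1 szp -catA; apply.
Qed.

Lemma FP_const X Y `{Enc X} `{Enc Y} (y : Y) : FP (fun _ : X => y).
Proof.
apply: (FP_intro (c := fun n => pushblk (n + arity X) (regs y)) (m := fun x => sz y)).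
  exact: pb_const.
move=> p x; exists (sz y) => //; rewrite catA; apply: lexec_pushblk.
by rewrite size_cat size_regs.
Qed.

Lemma FP_cons_id b : FP (fun s : str => b :: s).
Proof.
apply: (FP_intro (c := fun n => Seq (copyblk 1 n 1) (Push n.+1 b)) (m := fun s => 7 * sz s + 5)).
  exact: pb_add (pb_mul (pb_const _) (@pb_sz _ _)) (pb_const _).
move=> p s; exists (7 * sz s + 4 + 1); first by lia.
apply: (lexec_seq (e2 := p ++ [:: s] ++ [:: s])).
  by pose proof (@lexec_copyblk p [:: s] [::] _ _ erefl erefl) as K; move: K; rewrite cats0.
have szp : size (p ++ [:: s]) = (size p).+1 by rewrite size_cat addn1.
have := ExPush (st_of ((p ++ [:: s]) ++ [:: s])) (size p).+1 b.
by rewrite upd_st_of // -{2}szp st_of_at /lexec !catA.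
Qed.

(** The string is the last register of a copy of [x]. Popping its head turns the copy into the
    encoding of the pair of [x.1] and the tail; if it is empty, it is a trailing empty register, and
    the copy already encodes [x.1]. *)
Lemma FP_case_id X Y `{Enc X} `{Enc Y} (g0 : X -> Y) (g : bool -> X * str -> Y) :
  FP g0 -> FP (g false) -> FP (g true) ->
  FP (fun x : X * str => if x.2 is b :: s then g b (x.1, s) else g0 x.1).
Proof.
move=> [c0 [D0 K0]] [c1 [D1 K1]] [c2 [D2 K2]].
pose (n0 := arity X + 1).
set f := (f in FP f).
apply: (FP_intro
  (c := fun n => Seq (copyblk n0 n n0) (Case (n + n0 + arity X)
    (Seq (c0 (n + n0)) (delblk (arity X) (n + n0) (arity Y)))
    (Seq (c1 (n + n0)) (delblk n0 (n + n0) (arity Y)))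
    (Seq (c2 (n + n0)) (delblk n0 (n + n0) (arity Y)))))
  (m := fun x : X * str => (7 * sz x + 4 * n0) + ((sz x + 2) ^ (D0 + D1 + D2) +
    n0.+1 * (6 * (sz x + (arity Y) * (sz x + 2) ^ (D0 + D1 + D2)) + 4 * (n0 + arity Y)) + 2))).
  apply: pb_add (pb_add (pb_mul (pb_const _) (@pb_sz _ _)) (pb_const _)) _.
  apply: pb_add (pb_add (pb_exp _) (pb_mul (pb_const _) (pb_add (pb_mul (pb_const _) _) (pb_const _)))) (pb_const _).
  exact: pb_add (@pb_sz _ _) (pb_mul (pb_const _) (pb_exp _)).
move=> p x; set P := (sz x + 2) ^ _.
have szx : size (regs x) = n0 by rewrite size_regs.
pose (p1 := p ++ regs x).
have szp : size p1 = size p + n0 by rewrite size_cat szx.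
have HC : lexec (copyblk n0 (size p) n0) (p ++ regs x) (7 * sz x + 4 * n0) (p1 ++ regs x).
  pose proof (@lexec_copyblk p (regs x) [::] _ _ erefl erefl) as K.
  by move: K; rewrite cats0 addn0 szx /p1 catA.
enough (exists2 t, t <= P + n0.+1 * (6 * (sz x + (arity Y) * P) + 4 * (n0 + arity Y)) + 2 &
  lexec (Case (size p + n0 + arity X)
    (Seq (c0 (size p + n0)) (delblk (arity X) (size p + n0) (arity Y)))
    (Seq (c1 (size p + n0)) (delblk n0 (size p + n0) (arity Y)))
    (Seq (c2 (size p + n0)) (delblk n0 (size p + n0) (arity Y)))) (p1 ++ regs x) t (p1 ++ regs (f x)))
  as [t le_t Ht].
  exists (7 * sz x + 4 * n0 + t); first by rewrite leq_add2l.
  by rewrite catA; apply: lexec_seq HC Ht.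
have leP D (x' : nat) : D <= D0 + D1 + D2 -> x' <= sz x -> (x' + 2) ^ D <= P.
  move=> leD le_x; apply: (leq_trans (n := (sz x + 2) ^ D)).
    by case: (D) => // d; rewrite leq_exp2r // leq_add2r.
  by rewrite leq_exp2l // addn2.
have sz1 : size (p1 ++ regs x.1) = size p + n0 + arity X by rewrite size_cat szp size_regs.
have ep s : p1 ++ regs (x.1, s) = (p1 ++ regs x.1) ++ [:: s] by rewrite -catA.
have ex : x = (x.1, x.2) by case: (x).
have nthx : st_of (p1 ++ regs x) (size p + n0 + arity X) = x.2.
  by rewrite {1}ex ep -sz1 st_of_at.
have updx s : upd (st_of (p1 ++ regs x)) (size p + n0 + arity X) s = st_of (p1 ++ regs (x.1, s)).
  by rewrite {1}ex ep -sz1 upd_st_of // ep.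
assert (fin : forall c D (X' : Type) (EX' : Enc X') (x' : X') (k : nat),
    (exists2 t, t <= (sz x' + 2) ^ D & lexec (c (size p1)) (p1 ++ regs x') t (p1 ++ regs x' ++ regs (f x))) ->
    D <= D0 + D1 + D2 -> sz x' <= sz x -> size (regs x') = k -> k <= n0 ->
    exists2 t, t <= P + n0.+1 * (6 * (sz x + (arity Y) * P) + 4 * (n0 + arity Y)) &
    lexec (Seq (c (size p + n0)) (delblk k (size p + n0) (arity Y))) (p1 ++ regs x') t (p1 ++ regs (f x))).
  move=> c D X' EX' x' k [t le_t Ht] leD le_x' szk le_k; have [t' le_t' Ht'] := lexec_delblk (regs x') (regs (f x)) szp.
  exists (t + t'); last by rewrite -szk -(size_regs (f x)) -szp; apply: lexec_seq Ht _; rewrite szp.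
  have le_tP : t <= P := leq_trans le_t (leP _ _ leD le_x').
  apply: leq_add => //; apply: leq_trans le_t' (leq_mul _ _); first by rewrite szk.
  rewrite tot_cat size_cat szk size_regs leq_add ?leq_mul2l //=; last by rewrite leq_add2r.
  rewrite leq_add //; apply: leq_trans (lexec_tot (e1 := p1 ++ regs x') _ _) _.
  - by rewrite -catA; exact: Ht.
  - by [].
  - by rewrite size_regs leq_mul2l le_tP orbT.
case E2: x.2 => [|b s].
- have fx : f x = g0 x.1 by rewrite /f E2.
  have [||||t le_t Ht] := fin c0 D0 X _ x.1 (arity X) _ _ _ (size_regs _) _.
  + by rewrite fx; apply: K0.
  + by rewrite -addnA leq_addr.
  + exact: sz_fst.
  + by rewrite leq_addr.
  exists (t + 2); first by rewrite leq_add2r.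
  apply: ExCaseNil; first by rewrite nthx.
  by rewrite {1}ex ep E2 st_of_nil; exact: Ht.
- have fx : f x = g b (x.1, s) by rewrite /f E2.
  have [|||||t le_t Ht] := fin (if b then c2 else c1) (if b then D2 else D1) (X * str)%type _ (x.1, s) n0.
  + by rewrite fx; case: (b); [apply: K2|apply: K1].
  + by case: (b); lia.
  + by rewrite [in leqRHS]ex E2 !sz_pair leq_add2l !sz_str /=.
  + by rewrite size_regs.
  + by [].
  exists (t + 2); first by rewrite leq_add2r.
  apply: (@ExCaseCons _ _ _ _ _ _ _ b s); first by rewrite nthx.
  by rewrite updx; case: (b) Ht.
Qed.

Lemma pb_pow X `{Enc X} (m : X -> nat) E : pb m -> pb (fun x => (m x + 2) ^ E).
Proof.
move=> [D HD]; have [F HF] := poly_comp D E; exists F => x; apply: leq_trans (HF _).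
by case: (E) => // n; rewrite leq_exp2r // leq_add2r.
Qed.

(** Polynomial time for one round does not limit the iterates, which might be squared in length each
    time; [B] supplies the limit. The registers hold [x], the rest of the counter [N x] and the
    current value. A round computes the next value above fresh copies of [x] and of the current
    value, then deletes these copies and the old value. *)
Lemma FP_iter X Y `{Enc X} `{Enc Y} (N : X -> str) (y0 : X -> Y) (h : X * Y -> Y) (B : X -> nat) :
  FP N -> FP y0 -> FP h -> pb B ->
  (forall x i, i <= size (N x) -> sz (iter i (fun y => h (x, y)) (y0 x)) <= B x) ->
  FP (fun x => iter (size (N x)) (fun y => h (x, y)) (y0 x)).
Proof.
move=> FPN FPy0 FPh pbB HB; have := FPh => -[ch [Dh Kh]].
have := FP_pair FPN FPy0 => -[c0 [D0 K0]].
pose (nx := arity X); pose (ny := arity Y).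
pose body n := Seq (copyblk nx n (nx + (1 + ny))) (Seq (copyblk ny (n + nx + 1) (ny + nx))
  (Seq (ch (n + nx + 1 + ny)) (delblk (ny + nx + ny) (n + nx + 1) ny))).
pose (T := fun x : X => (7 * sz x + 4 * nx) + ((7 * B x + 4 * ny) + ((sz x + B x + 2) ^ Dh +
  (ny + nx + ny).+1 * (6 * (sz x + 3 * B x) + 4 * (nx + 3 * ny))))).
have pbT : pb T.
  apply: pb_add (pb_add (pb_mul (pb_const _) (@pb_sz _ _)) (pb_const _)) _.
  apply: pb_add (pb_add (pb_mul (pb_const _) pbB) (pb_const _)) _.
  apply: pb_add (pb_pow _ (pb_add (@pb_sz _ _) pbB)) (pb_mul (pb_const _) _).
  apply: pb_add (pb_mul (pb_const _) _) (pb_const _).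
  exact: pb_add (@pb_sz _ _) (pb_mul (pb_const _) pbB).
assert (body_ok : forall p s (x : X) (y : Y), sz y <= B x -> sz (h (x, y)) <= B x ->
    exists2 t, t <= T x & lexec (body (size p)) (p ++ regs x ++ [:: s] ++ regs y) t
                                (p ++ regs x ++ [:: s] ++ regs (h (x, y)))).
  move=> p s x y le_y le_y'.
  have C1 : lexec (copyblk nx (size p) (nx + (1 + ny))) (p ++ regs x ++ [:: s] ++ regs y)
      (7 * sz x + 4 * nx) (p ++ regs x ++ ([:: s] ++ regs y) ++ regs x).
    pose proof (@lexec_copyblk p (regs x) ([:: s] ++ regs y) _ _ erefl erefl) as K.
    by move: K; rewrite size_cat !size_regs.
  pose (p1 := p ++ regs x ++ [:: s]).
  have szp1 : size p1 = size p + nx + 1 by rewrite !size_cat size_regs addnA.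
  have C2 : lexec (copyblk ny (size p + nx + 1) (ny + nx)) (p ++ regs x ++ ([:: s] ++ regs y) ++ regs x)
      (7 * sz y + 4 * ny) (p1 ++ regs y ++ regs x ++ regs y).
    pose proof (@lexec_copyblk p1 (regs y) (regs x) _ _ erefl erefl) as K.
    by move: K; rewrite !size_regs szp1 /p1 -!catA.
  have [t le_t C3] := Kh (p1 ++ regs y) (x, y).
  have [t' le_t' C4] := @lexec_delblk p1 (regs y ++ regs x ++ regs y) (regs (h (x, y))) _ szp1.
  rewrite !size_cat !size_regs addnA in le_t' C4; rewrite !tot_cat in le_t'.
  exists ((7 * sz x + 4 * nx) + ((7 * sz y + 4 * ny) + (t + t'))).
    rewrite leq_add2l; apply: leq_add; first by rewrite leq_add2r leq_mul2l le_y orbT.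
    apply: leq_add.
      apply: leq_trans le_t _; rewrite sz_pair; case: (Dh) => // d.
      by rewrite leq_exp2r // leq_add2r leq_add2l.
    apply: leq_trans le_t' _; rewrite leq_mul2l /=; apply: leq_add.
      by rewrite leq_mul2l /=; move: le_y le_y'; rewrite /sz; lia.
    by rewrite leq_mul2l /= /ny /nx; lia.
  apply: lexec_seq C1 (lexec_seq C2 (lexec_seq (e2 := p1 ++ (regs y ++ regs x ++ regs y) ++ regs (h (x, y))) _ _)).
    by move: C3; rewrite size_cat szp1 size_regs -!catA.
  by move: C4; rewrite /p1 -!catA.
assert (loop_ok : forall p (x : X) s, size s <= size (N x) ->
    exists2 t, t <= size s * (T x + 2) + 2 &
    lexec (Loop (size p + nx) (body (size p)) (body (size p)))
      (p ++ regs x ++ [:: s] ++ regs (iter (size (N x) - size s) (fun y => h (x, y)) (y0 x))) t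
      (p ++ regs x ++ [:: [::]] ++ regs (iter (size (N x)) (fun y => h (x, y)) (y0 x)))).
  move=> p x s; have szp : size (p ++ regs x) = size p + nx by rewrite size_cat size_regs.
  elim: s => [|b s IH] lt_s.
    exists 2; first by [].
    by rewrite subn0; apply: ExLoopNil; rewrite catA -szp st_of_at.
  have Ey : iter (size (N x) - size s) (fun y => h (x, y)) (y0 x) =
            h (x, iter (size (N x) - (size s).+1) (fun y => h (x, y)) (y0 x)).
    by rewrite -(subnSK lt_s).
  have [t le_t Ht] := IH (ltnW lt_s).
  have [||t' le_t' Ht'] := body_ok p s x (iter (size (N x) - (size s).+1) (fun y => h (x, y)) (y0 x)).
  - by apply: HB; rewrite leq_subr.
  - by rewrite -Ey; apply: HB; rewrite leq_subr.
  exists (t' + t + 2); first by rewrite /= mulSn; lia.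
  apply: (@ExLoopCons _ _ _ _ _ _ _ _ b s) Ht.
    by rewrite catA -szp st_of_at.
  rewrite catA upd_st_of // -catA if_same; move: Ht'; rewrite -Ey; exact.
apply: (FP_intro (c := fun n => Seq (c0 n) (Seq (Loop (n + nx) (body n) (body n)) (delblk 1 (n + nx) ny)))
  (m := fun x => (sz x + 2) ^ D0 + ((sz (N x) * (T x + 2) + 2) + 2 * (6 * B x + 4 * (1 + ny))))).
  apply: pb_add (pb_exp _) (pb_add (pb_add (pb_mul (FP_size FPN) (pb_add pbT (pb_const _))) (pb_const _)) _).
  exact: pb_mul (pb_const _) (pb_add (pb_mul (pb_const _) pbB) (pb_const _)).
move=> p x; have [t0 le_t0 C0] := K0 p x; have [t1 le_t1 C1] := loop_ok p x (N x) (leqnn _).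
have szp : size (p ++ regs x) = size p + nx by rewrite size_cat size_regs.
have [t2 le_t2 C2] := @lexec_delblk (p ++ regs x) [:: [::]] (regs (iter (size (N x)) (fun y => h (x, y)) (y0 x))) _ szp.
rewrite subnn in C1; rewrite size_cat !size_regs tot_cat add0n in le_t2; rewrite size_regs in C2.
exists (t0 + (t1 + t2)).
  rewrite leq_add // leq_add //; first by rewrite sz_str.
  by apply: leq_trans le_t2 _; rewrite leq_mul2l leq_add2r leq_mul2l /=; apply: HB.
apply: lexec_seq C0 (lexec_seq C1 _).
by move: C2; rewrite -!catA.
Qed.

Lemma pb_poly_bound (m : str -> nat) : pb m -> exists c d, forall w, m w <= poly_bound c d (size w).
Proof.
move=> [D HD]; exists (3 ^ D), D => w; apply: leq_trans (HD w) _; rewrite sz_str /poly_bound.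
case: (size w) => [|n]; last first.
  rewrite -expnMn; apply: leq_trans (leq_addr _ _); case: (D) => // d.
  by rewrite leq_exp2r //; lia.
by apply: leq_trans (leq_addl _ _); case: (D) => // d; rewrite leq_exp2r.
Qed.

(** Register 0 receives the word reversed and has to return the result reversed. Pouring it into
    register 1 straightens it; the command of [f] runs above the empty register 0, and a last
    pouring reverses the result. *)
Lemma FP_machine (f : str -> str) : FP f ->
  exists Q S (M : TM Q S) c d, forall w, exists t,
    [/\ t <= poly_bound c d (size w), halted M (run M w t), output (run M w t) = f w
      & tm_accept M (cstate (run M w t)) = head false (f w)].
Proof.
move=> FPf; have := FPf => -[cf [D Hf]].
pose c := Seq (mv 0 1) (Seq (cf 1) (Seq (clr 1) (mv 2 0))).
pose prog := compile 0 c.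
assert (pbN : pb (fun w : str => 3 * size w + 2 + ((sz w + 2) ^ D + (2 * size w + 2 + (3 * sz (f w) + 2))))).
  have pb_size : pb (fun w : str => size w) by apply: pb_leq (@pb_sz _ _) => w; rewrite sz_str.
  apply: pb_add (pb_add (pb_mul (pb_const _) pb_size) (pb_const _)) (pb_add (pb_exp _) _).
  apply: pb_add (pb_add (pb_mul (pb_const _) pb_size) (pb_const _)) _.
  exact: pb_add (pb_mul (pb_const _) (FP_size FPf)) (pb_const _).
set N := (N in pb N) in pbN.
have pbT : pb (fun w : str => N w * (2 * (size w + N w) + 3) + 2).
  apply: pb_add (pb_mul pbN (pb_add (pb_mul (pb_const _) (pb_add _ pbN)) (pb_const _))) (pb_const _).
  by apply: pb_leq (@pb_sz _ _) => w; rewrite sz_str.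
have [a [d Hd]] := pb_poly_bound pbT.
exists (nstates prog).-1, (nsyms prog - 3), (machine prog), a, d => w.
have [t le_t Ht] := Hf [:: [::]] w.
have store1E s : store1 s = st_of [:: s].
  by apply: functional_extensionality => -[|[]].
have Hc : exec c (store1 (rev w)) (3 * size w + 2 + (t + (2 * size w + 2 + (3 * sz (f w) + 2))))
    (store1 (rev (f w))).
  rewrite !store1E; apply: (@lexec_seq _ _ _ _ [:: [::]; w]).
    have := @exec_mv 0 1 (st_of [:: rev w]) erefl; rewrite /= size_rev -/(rev (rev w)) revK.
    rewrite /lexec; congr exec.
    by apply: functional_extensionality => -[|[|[]]].
  apply: (lexec_seq Ht); apply: (@lexec_seq _ _ _ _ [:: [::]; [::]; f w]).
    have := exec_clr 1 (st_of [:: [::]; w; f w]); rewrite /lexec; congr exec.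
    by apply: functional_extensionality => -[|[|[|[]]]].
  have := @exec_mv 2 0 (st_of [:: [::]; [::]; f w]) erefl; rewrite sz_str /lexec; congr exec.
  by apply: functional_extensionality => -[|[|[|[]]]].
have := @compile_correct _ _ _ _ Hc [::] [::] 0 erefl; rewrite cats0 /= => Hrun.
have [T le_T [HT1 HT2 HT3]] := machine_correct Hrun.
exists T; split=> //; apply: leq_trans (Hd w); apply: leq_trans le_T _; rewrite leq_add2r.
set n := _ + (t + _); have le_n : n <= N w by rewrite /n /N leq_add2l leq_add2r.
by apply: leq_mul => //; lia.
Qed.

Lemma FP_poly_computable f : FP f -> poly_computable f.
Proof.
move=> /FP_machine[Q [S [M [c [d H]]]]]; exists Q, S, M, c, d => w.
by have [t [le_t hM oM _]] := H w; exists t.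
Qed.

(** The answer is computed as a word of one letter, which is the bit that the halting state
    reports. *)
Lemma FP_in_P (f : str -> bool) : FP f -> in_P (fun w => f w).
Proof.
move=> FPf; have FPf' : FP (fun w : str => [:: f w]) by exact: FP_regs FPf _.
move: FPf' => /FP_machine[Q [S [M [c [d H]]]]]; exists Q, S, M, c, d => w.
by have [t [le_t hM _ aM]] := H w; exists t; rewrite aM.
Qed.

(** * Arithmetic and string operations *)

Section Combinators.
Context {X : Type} `{EX : Enc X}.

Lemma FP_proj1 Y Z `{Enc Y} `{Enc Z} (f : X -> Y * Z) : FP f -> FP (fun x => (f x).1).
Proof. exact: FP_comp (@FP_fst _ _ _ _). Qed.

Lemma FP_proj2 Y Z `{Enc Y} `{Enc Z} (f : X -> Y * Z) : FP f -> FP (fun x => (f x).2).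
Proof. exact: FP_comp (@FP_snd _ _ _ _). Qed.

Lemma FP_comp2 Y1 Y2 Z `{Enc Y1} `{Enc Y2} `{Enc Z} (g : Y1 -> Y2 -> Z) (f1 : X -> Y1) (f2 : X -> Y2) :
  FP (fun z : Y1 * Y2 => g z.1 z.2) -> FP f1 -> FP f2 -> FP (fun x => g (f1 x) (f2 x)).
Proof. by move=> Hg K1 K2; exact: FP_comp Hg (FP_pair K1 K2). Qed.

Lemma FP_cons b (s : X -> str) : FP s -> FP (fun x => b :: s x).
Proof. exact: FP_comp (@FP_cons_id b). Qed.

Lemma FP_case Y `{Enc Y} (s : X -> str) (g0 : X -> Y) (g : bool -> X -> str -> Y) :
  FP s -> FP g0 -> FP (fun z : X * str => g false z.1 z.2) -> FP (fun z : X * str => g true z.1 z.2) ->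
  FP (fun x => if s x is b :: t then g b x t else g0 x).
Proof.
move=> Hs K0 K1 K2.
exact: (FP_comp (FP_case_id (g := fun b z => g b z.1 z.2) K0 K1 K2) (FP_pair (@FP_id _ _) Hs)).
Qed.

Lemma FP_if Y `{Enc Y} (b : X -> bool) (f g : X -> Y) :
  FP b -> FP f -> FP g -> FP (fun x => if b x then f x else g x).
Proof.
move=> Hb Hf Hg; have Hs : FP (fun x => [:: b x] : str) by exact: FP_regs Hb _.
apply: FP_ext (FP_case (g := fun b x _ => if b then f x else g x) Hs Hg _ _) _ => //=.
- exact: FP_comp Hg (@FP_fst _ _ _ _).
- exact: FP_comp Hf (@FP_fst _ _ _ _).
Qed.

Lemma FP_negb (b : X -> bool) : FP b -> FP (fun x => ~~ b x).
Proof. by move=> Hb; apply: FP_ext (FP_if Hb (FP_const false) (FP_const true)) _ => x; case: (b x). Qed.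

Lemma FP_andb (b c : X -> bool) : FP b -> FP c -> FP (fun x => b x && c x).
Proof. by move=> Hb Hc; apply: FP_ext (FP_if Hb Hc (FP_const false)) _ => x; case: (b x). Qed.

Lemma FP_orb (b c : X -> bool) : FP b -> FP c -> FP (fun x => b x || c x).
Proof. by move=> Hb Hc; apply: FP_ext (FP_if Hb (FP_const true) Hc) _ => x; case: (b x). Qed.

Lemma FP_eqb (b c : X -> bool) : FP b -> FP c -> FP (fun x => b x == c x).
Proof.
by move=> Hb Hc; apply: FP_ext (FP_if Hb Hc (FP_negb Hc)) _ => x; case: (b x); case: (c x).
Qed.

Lemma FP_behead (s : X -> str) : FP s -> FP (fun x => behead (s x)).
Proof.
move=> Hs; apply: FP_ext (FP_case (g := fun _ _ t => t) Hs (FP_const [::]) (@FP_snd _ _ _ _) (@FP_snd _ _ _ _)) _.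
by move=> x; case: (s x).
Qed.

Lemma FP_head d (s : X -> str) : FP s -> FP (fun x => head d (s x)).
Proof.
move=> Hs; apply: FP_ext (FP_case (g := fun b _ _ => b) Hs (FP_const d) (FP_const false) (FP_const true)) _.
by move=> x; case: (s x).
Qed.

Lemma FP_nilp (s : X -> str) : FP s -> FP (fun x => nilp (s x)).
Proof.
move=> Hs; apply: FP_ext (FP_case (g := fun _ _ _ => false) Hs (FP_const true) (FP_const false) (FP_const false)) _.
by move=> x; case: (s x).
Qed.

Lemma FP_unary (n : X -> nat) : FP n -> FP (fun x => nseq (n x) true).
Proof. by move=> Hn; exact: FP_regs Hn _. Qed.

Lemma FP_succ (n : X -> nat) : FP n -> FP (fun x => (n x).+1).
Proof. by move=> /FP_unary/(FP_cons true) Hn; exact: FP_regs Hn _. Qed.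

Lemma FP_pred (n : X -> nat) : FP n -> FP (fun x => (n x).-1).
Proof. by move=> /FP_unary/FP_behead Hn; apply: FP_regs Hn _ => x; case: (n x). Qed.

End Combinators.

Lemma FP_iterate X Y `{Enc X} `{Enc Y} (N : X -> str) (y0 : X -> Y) (h : X -> Y -> Y) (B : X -> nat) :
  FP N -> FP y0 -> FP (fun z : X * Y => h z.1 z.2) -> pb B ->
  (forall x i, i <= size (N x) -> sz (iter i (h x) (y0 x)) <= B x) ->
  FP (fun x => iter (size (N x)) (h x) (y0 x)).
Proof. exact: FP_iter. Qed.

Section Iteration.
Context {X : Type} `{EX : Enc X}.

Lemma FP_size_str (s : X -> str) : FP s -> FP (fun x => size (s x)).
Proof.
move=> Hs.
have It n : iter n S 0 = n by elim: n => //= n ->.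
apply: FP_ext (FP_iterate (y0 := fun=> 0) (h := fun=> S) Hs (FP_const 0) (FP_succ (@FP_snd _ _ _ _)) (FP_size Hs) _) _.
  by move=> x i le_i; rewrite It sz_nat sz_str.
by move=> x; rewrite It.
Qed.

Lemma FP_iter_nat Y `{Enc Y} (n : X -> nat) (y0 : X -> Y) (h : X -> Y -> Y) (B : X -> nat) :
  FP n -> FP y0 -> FP (fun z : X * Y => h z.1 z.2) -> pb B ->
  (forall x i, i <= n x -> sz (iter i (h x) (y0 x)) <= B x) ->
  FP (fun x => iter (n x) (h x) (y0 x)).
Proof.
move=> /FP_unary Hn K0 Hh pbB HB; apply: FP_ext (FP_iterate Hn K0 Hh pbB _) _ => x.
  by move=> i; rewrite size_nseq; apply: HB.
by rewrite size_nseq.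
Qed.

Lemma FP_iteri Y `{Enc Y} (n : X -> nat) (y0 : X -> Y) (h : X -> nat -> Y -> Y) (B : X -> nat) :
  FP n -> FP y0 -> FP (fun z : X * nat * Y => h z.1.1 z.1.2 z.2) -> pb B ->
  (forall x i, i <= n x -> sz (iteri i (h x) (y0 x)) <= B x) ->
  FP (fun x => iteri (n x) (h x) (y0 x)).
Proof.
move=> Hn K0 Hh pbB HB.
pose g x (z : nat * Y) := (z.1.+1, h x z.1 z.2).
have It x i : iter i (g x) (0, y0 x) = (i, iteri i (h x) (y0 x)).
  by elim: i => //= i ->.
apply: FP_ext (FP_proj2 (FP_iter_nat (y0 := fun x => (0, y0 x)) (h := g) (B := fun x => sz (n x) + B x) Hn _ _ _ _)) _.
- exact: FP_pair (FP_const 0) K0.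
- apply: FP_pair; first exact: FP_succ (FP_proj1 (@FP_snd _ _ _ _)).
  apply: (FP_comp Hh (f := fun z : X * (nat * Y) => (z.1, z.2.1, z.2.2))).
  apply: FP_pair (FP_pair (@FP_fst _ _ _ _) (FP_proj1 (@FP_snd _ _ _ _))) (FP_proj2 (@FP_snd _ _ _ _)).
- exact: pb_add (FP_size Hn) pbB.
- by move=> x i le_i; rewrite It sz_pair !sz_nat leq_add // HB.
- by move=> x; rewrite It.
Qed.

Lemma FP_foldl Y `{Enc Y} (s : X -> str) (y0 : X -> Y) (h : X -> Y -> bool -> Y) (B : X -> nat) :
  FP s -> FP y0 -> FP (fun z : X * Y => h z.1 z.2 false) -> FP (fun z : X * Y => h z.1 z.2 true) -> pb B ->
  (forall x i, i <= size (s x) -> sz (foldl (h x) (y0 x) (take i (s x))) <= B x) ->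
  FP (fun x => foldl (h x) (y0 x) (s x)).
Proof.
move=> Hs K0 Hh1 Hh2 pbB HB.
pose g x (z : str * Y) := if z.1 is b :: t then (t, h x z.2 b) else z.
have It x i : iter i (g x) (s x, y0 x) = (drop i (s x), foldl (h x) (y0 x) (take i (s x))).
  elim: i => [|i IH]; first by rewrite drop0 take0.
  rewrite iterS IH /g /=; case: (ltnP i (size (s x))) => [lt_i|le_i].
    by rewrite (drop_nth false) // (take_nth false) // foldl_rcons.
  by rewrite !drop_oversize ?take_oversize // leqW.
apply: FP_ext (FP_proj2 (FP_iterate (y0 := fun x => (s x, y0 x)) (h := g) (B := fun x => sz (s x) + B x) Hs _ _ _ _)) _.
- exact: FP_pair Hs K0.
- apply: (FP_case (X := X * (str * Y)) (s := fun z => z.2.1) (g0 := fun z => z.2)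
    (g := fun b z t => (t, h z.1 z.2.2 b))).
  + exact: FP_proj1 (@FP_snd _ _ _ _).
  + exact: FP_snd.
  + apply: FP_pair (@FP_snd _ _ _ _) (FP_comp Hh1 (FP_pair (FP_proj1 (@FP_fst _ _ _ _)) _)).
    exact: FP_proj2 (FP_proj2 (@FP_fst _ _ _ _)).
  + apply: FP_pair (@FP_snd _ _ _ _) (FP_comp Hh2 (FP_pair (FP_proj1 (@FP_fst _ _ _ _)) _)).
    exact: FP_proj2 (FP_proj2 (@FP_fst _ _ _ _)).
- exact: pb_add (FP_size Hs) pbB.
- move=> x i le_i; rewrite It sz_pair !sz_str leq_add ?HB //.
  by rewrite size_drop leq_subr.
- by move=> x; rewrite It take_size.
Qed.
End Iteration.

(** The search is directed by the syntax of the function; here a hypothesis about [f] is applied to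
    arbitrary computable arguments. *)
Ltac fp_hyp := match goal with
  | H : FP ?f |- FP (fun z => ?f (@?a z)) => eapply (FP_comp (f := a) H)
  | H : FP (fun w => ?f w.1 w.2) |- FP (fun z => ?f (@?a z) (@?b z)) => eapply (FP_comp2 (f1 := a) (f2 := b) H)
  | H : FP (fun w => ?f w.1.1 w.1.2 w.2) |- FP (fun z => ?f (@?a z) (@?b z) (@?c z)) =>
      eapply (FP_comp (f := fun z => (a z, b z, c z)) H)
  end.
Ltac fp_step := first [assumption | fp_hyp | simple apply FP_const | simple apply FP_id | simple apply FP_pair
 | simple eapply FP_proj1 | simple eapply FP_proj2 | simple apply FP_cons | simple apply FP_succ
 | simple apply FP_pred | simple apply FP_negb | simple apply FP_andb | simple apply FP_orb
 | simple apply FP_eqb | simple apply FP_head | simple apply FP_behead | simple apply FP_nilp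
 | simple apply FP_size_str | simple apply FP_if].
Ltac fp := repeat fp_step.

Lemma foldl_cons (A : Type) (s acc : seq A) : foldl (fun t a => a :: t) acc s = catrev s acc.
Proof. by elim: s acc => //= a s IH acc; rewrite IH. Qed.

Section Strings.
Context {X : Type} `{EX : Enc X}.
Implicit Types s t : X -> str.

Lemma FP_catrev s t : FP s -> FP t -> FP (fun x => catrev (s x) (t x)).
Proof.
move=> Hs Ht; 
apply: FP_ext (FP_foldl (y0 := t) (h := fun _ u b => b :: u)
  (B := fun x => sz (s x) + sz (t x)) Hs Ht _ _ _ _) _; fp.
- exact: pb_add (FP_size Hs) (FP_size Ht).
- move=> x i le_i; rewrite foldl_cons !sz_str catrevE size_cat size_rev leq_add2r size_take.
  by case: ltnP.
- by move=> x; rewrite foldl_cons.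
Qed.

Lemma FP_rev s : FP s -> FP (fun x => rev (s x)).
Proof. by move=> Hs; apply: FP_catrev Hs (FP_const [::]). Qed.

Lemma FP_cat s t : FP s -> FP t -> FP (fun x => s x ++ t x).
Proof. by move=> Hs Ht; apply: FP_ext (FP_catrev (FP_rev Hs) Ht) _ => x; rewrite catrevE revK. Qed.

Lemma FP_consb (b : X -> bool) s : FP b -> FP s -> FP (fun x => b x :: s x).
Proof.
move=> Hb Hs; have Hb' : FP (fun x => [:: b x] : str) by exact: FP_regs Hb _.
exact: FP_cat Hb' Hs.
Qed.

Lemma FP_drop (n : X -> nat) s : FP n -> FP s -> FP (fun x => drop (n x) (s x)).
Proof.
have It i (u : str) : iter i behead u = drop i u.
  elim: i u => [|i IH] u; first by rewrite drop0.
  by rewrite iterSr IH; case: u => //= _; case: i {IH}.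
move=> Hn Hs; apply: FP_ext (FP_iter_nat (y0 := s) (h := fun _ => behead) Hn Hs _ (FP_size Hs) _) _; fp.
  by move=> x i _; rewrite It !sz_str size_drop leq_subr.
by move=> x; rewrite It.
Qed.

Lemma FP_nth d (n : X -> nat) s : FP n -> FP s -> FP (fun x => nth d (s x) (n x)).
Proof.
by move=> Hn Hs; apply: FP_ext (FP_head d (FP_drop Hn Hs)) _ => x; rewrite -nth0 nth_drop addn0.
Qed.

Lemma FP_addn (m n : X -> nat) : FP m -> FP n -> FP (fun x => m x + n x).
Proof.
move=> /FP_unary Hm /FP_unary Hn; apply: FP_ext (FP_size_str (FP_cat Hm Hn)) _ => x.
by rewrite size_cat !size_nseq.
Qed.

Lemma FP_subn (m n : X -> nat) : FP m -> FP n -> FP (fun x => m x - n x).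
Proof.
move=> /FP_unary Hm Hn; apply: FP_ext (FP_size_str (FP_drop Hn Hm)) _ => x.
by rewrite size_drop size_nseq.
Qed.

Lemma FP_leq (m n : X -> nat) : FP m -> FP n -> FP (fun x => m x <= n x).
Proof.
move=> Hm Hn; apply: FP_ext (FP_nilp (FP_unary (FP_subn Hm Hn))) _ => x.
by rewrite /nilp size_nseq.
Qed.

Lemma FP_eqn (m n : X -> nat) : FP m -> FP n -> FP (fun x => m x == n x).
Proof.
by move=> Hm Hn; apply: FP_ext (FP_andb (FP_leq Hm Hn) (FP_leq Hn Hm)) _ => x; rewrite eqn_leq.
Qed.

End Strings.

Ltac fp_str_step := first [fp_step | simple apply FP_consb | simple apply FP_cat | simple apply FP_rev | simple apply FP_drop
  | simple apply FP_nth | simple apply FP_addn | simple apply FP_subn | simple apply FP_leq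
  | simple apply FP_eqn].
Ltac fp_str := repeat fp_str_step.

Section Arith.
Context {X : Type} `{EX : Enc X}.
Implicit Types m n : X -> nat.

Lemma FP_muln m n : FP m -> FP n -> FP (fun x => m x * n x).
Proof.
move=> Hm Hn; have It i k : iter i (addn k) 0 = i * k by elim: i => //= i ->; rewrite mulSn.
apply: FP_ext (FP_iter_nat (y0 := fun=> 0) (h := fun x => addn (n x))
  (B := fun x => sz (m x) * sz (n x)) Hm _ _ _ _) _; fp_str.
- exact: pb_mul (FP_size Hm) (FP_size Hn).
- by move=> x i le_i; rewrite It !sz_nat leq_mul2r le_i orbT.
- by move=> x; rewrite It.
Qed.

Lemma FP_expn m d : FP m -> FP (fun x => m x ^ d).
Proof.
by move=> Hm; elim: d => [|d IH]; [apply: FP_const|apply: FP_ext (FP_muln Hm IH) _ => x; rewrite expnS].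
Qed.

Lemma FP_ltn m n : FP m -> FP n -> FP (fun x => m x < n x).
Proof. by move=> Hm Hn; apply: FP_leq => //; apply: FP_succ. Qed.

(** Remainder and quotient are counted up together. For divisor 0 the remainder never wraps around,
    in agreement with the conventions for [modn] and [divn]. *)
Lemma FP_edivn m n : FP m -> FP n -> FP (fun x => (m x %% n x, m x %/ n x)).
Proof.
move=> Hm Hn; pose h d (z : nat * nat) := if z.1.+1 == d then (0, z.2.+1) else (z.1.+1, z.2).
have It i d : iter i (h d) (0, 0) = (i %% d, i %/ d).
  elim: i => [|i IH]; first by rewrite mod0n div0n.
  rewrite iterS IH /h /=; case: d {IH} => [|d]; first by rewrite !modn0 !divn0.
  rewrite modnS divnS //; case: ifP => [/eqP E|nE].
    have -> : d.+1 %| i.+1.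
      by rewrite /dvdn -addn1 -modnDml addn1 E modnn.
    by rewrite add1n.
  suff -> : (d.+1 %| i.+1) = false by rewrite add0n.
  apply/negP; rewrite /dvdn -addn1 -modnDml addn1 modn_small ?nE //.
  by rewrite ltn_neqAle nE ltn_mod.
apply: FP_ext (FP_iter_nat (y0 := fun=> (0, 0)) (h := fun x => h (n x))
  (B := fun x => sz (m x) + sz (m x)) Hm _ _ _ _) _; rewrite /h; fp_str.
- exact: pb_add (FP_size Hm) (FP_size Hm).
- move=> x i le_i; rewrite It sz_pair !sz_nat leq_add //.
    exact: leq_trans (leq_mod _ _) le_i.
  exact: leq_trans (leq_div _ _) le_i.
- by move=> x; rewrite It.
Qed.

Lemma FP_modn m n : FP m -> FP n -> FP (fun x => m x %% n x).
Proof. by move=> Hm Hn; exact: FP_proj1 (FP_edivn Hm Hn). Qed.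

Lemma FP_divn m n : FP m -> FP n -> FP (fun x => m x %/ n x).
Proof. by move=> Hm Hn; exact: FP_proj2 (FP_edivn Hm Hn). Qed.

Lemma FP_nat_of_bool (b : X -> bool) : FP b -> FP (fun x => nat_of_bool (b x)).
Proof. by move=> Hb; apply: FP_ext (FP_if Hb (FP_const 1) (FP_const 0)) _ => x; case: (b x). Qed.

Lemma FP_odd m : FP m -> FP (fun x => odd (m x)).
Proof.
by move=> Hm; apply: FP_ext (FP_eqn (FP_modn Hm (FP_const 2)) (FP_const 1)) _ => x; rewrite modn2; case: odd.
Qed.

Lemma FP_half m : FP m -> FP (fun x => (m x)./2).
Proof. by move=> Hm; apply: FP_ext (FP_divn Hm (FP_const 2)) _ => x; rewrite divn2. Qed.

Lemma pb_bounded Y `{Enc Y} m (g : X -> nat -> Y) : FP m -> FP (fun z : X * nat => g z.1 z.2) ->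
  exists2 B, pb B & forall x i, i <= m x -> sz (g x i) <= B x.
Proof.
move=> Hm /FP_size[D HD]; exists (fun x => (sz x + sz (m x) + 2) ^ D).
  exact: pb_pow (pb_add (@pb_sz _ _) (FP_size Hm)).
move=> x i le_i; apply: leq_trans (HD (x, i)) _; rewrite sz_pair !sz_nat.
by case: (D) => // d; rewrite leq_exp2r // leq_add2r leq_add2l.
Qed.

Lemma FP_flatten_iota m (g : X -> nat -> str) : FP m -> FP (fun z : X * nat => g z.1 z.2) ->
  FP (fun x => flatten [seq g x i | i <- iota 0 (m x)]).
Proof.
move=> Hm Hg; have [B pbB HB] := pb_bounded Hm Hg.
have It x i : iteri i (fun j u => u ++ g x j) [::] = flatten [seq g x i | i <- iota 0 i].
  elim: i => // i IH; have -> : iota 0 i.+1 = iota 0 i ++ [:: i] by rewrite -addn1 iotaD.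
  by rewrite map_cat flatten_cat /= cats0 IH.
apply: FP_ext (FP_iteri (y0 := fun=> [::]) (h := fun x j u => u ++ g x j)
  (B := fun x => sz (m x) * B x) Hm _ _ _ _) _; fp_str.
- exact: pb_mul (FP_size Hm) pbB.
- move=> x i le_i; rewrite sz_nat; apply: leq_trans (leq_mul le_i (leqnn _)).
  elim: i le_i => //= i IH lt_i; rewrite sz_str size_cat mulSn addnC leq_add //.
    by have := HB x i (ltnW lt_i); rewrite sz_str.
  by have := IH (ltnW lt_i); rewrite sz_str.
- by move=> x; rewrite It.
Qed.
End Arith.

Ltac fp_nat_step := first [fp_str_step | simple apply FP_muln | simple apply FP_expn | simple apply FP_ltn
  | simple apply FP_modn | simple apply FP_divn | simple apply FP_nat_of_bool | simple apply FP_odd | simple apply FP_half].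
Ltac fp_nat := repeat fp_nat_step.

(** * Self-delimiting encodings and lists *)

Definition enc_str (s : str) : str := flatten [seq [:: true; b] | b <- s] ++ [:: false].

Lemma enc_natE n : enc_nat n = enc_str (bits n).
Proof. by []. Qed.

Lemma size_enc_str s : size (enc_str s) = 2 * size s + 1.
Proof.
by rewrite size_cat; elim: s => //= b s IH; rewrite mulnS; lia.
Qed.

Section Encodings.
Context {X : Type} `{EX : Enc X}.

Lemma FP_enc_str (s : X -> str) : FP s -> FP (fun x => enc_str (s x)).
Proof.
move=> Hs; have It (u : str) : foldl (fun v b => [:: true, b & v]) [:: false] u = enc_str (rev u).
  by rewrite -{1}(revK u) foldl_rev; elim: (rev u) => //= b v ->.
apply: FP_ext (FP_foldl (y0 := fun=> [:: false]) (h := fun _ v b => [:: true, b & v])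
  (B := fun x => 2 * sz (s x) + 1) (FP_rev Hs) _ _ _ _ _) _; fp_str.
- exact: pb_add (pb_mul (pb_const _) (FP_size Hs)) (pb_const _).
- move=> x i le_i; rewrite It !sz_str size_enc_str size_rev leq_add2r leq_mul2l /=.
  by rewrite size_take size_rev; case: ltnP => // /ltnW.
- by move=> x; rewrite It revK.
Qed.

Lemma FP_bits (n : X -> nat) : FP n -> FP (fun x => bits (n x)).
Proof.
move=> Hn; pose h (z : nat * str) := if z.1 == 0 then z else (z.1./2, odd z.1 :: z.2).
have It i m u : (iter i h (m, u)).2 = catrev (bits_aux i m) u.
  elim: i m u => // i IH m u; rewrite iterSr /h /=; case: m => [|m]; last by rewrite IH.
  by rewrite IH /=; case: (i).
have Sz i m u : (iter i h (m, u)).1 <= m /\ size (iter i h (m, u)).2 <= size u + i.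
  elim: i m u => [|i IH] m u; first by rewrite addn0.
  rewrite iterS; case: (IH m u); case: (iter _ _ _) => m' u' /= le1 le2.
  by rewrite /h /=; case: eqP => _ /=; split; lia.
apply: FP_ext (FP_rev (FP_proj2 (FP_iter_nat (y0 := fun x => (n x, [::])) (h := fun _ => h)
  (B := fun x => sz (n x) + sz (n x)) Hn _ _ _ _))) _; rewrite /h; fp_nat.
- exact: pb_add (FP_size Hn) (FP_size Hn).
- move=> x i le_i; have := Sz i (n x) [::]; rewrite -/h; case: (iter _ _ _) => m' u' /= [le1 le2].
  by rewrite sz_pair !sz_nat sz_str leq_add // (leq_trans le2).
- by move=> x; rewrite -/h It -/(rev _) revK.
Qed.

Lemma FP_enc_nat (n : X -> nat) : FP n -> FP (fun x => enc_nat (n x)).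
Proof. by move=> Hn; exact: FP_enc_str (FP_bits Hn). Qed.
End Encodings.

(* The low priority keeps [seq bool] encoded as a string. *)
#[export] Instance Enc1_seq (A : Type) `{Enc1 A} : Enc1 (seq A) | 10 :=
  fun l => flatten [seq true :: enc_str (enc1 a) | a <- l] ++ [:: false].

(** Decodes the first entry of a list. The state consists of the unread input, the decoded bits in
    reverse order and a flag set at the end of the entry, after which nothing changes. *)
Definition split_step (z : str * str * bool) : str * str * bool :=
  let: (u, acc, b) := z in
  if b then z else if nilp u then z else
  if head false u then (behead (behead u), head false (behead u) :: acc, false)
  else (behead u, acc, true).

Lemma iter_split_step s u acc k : size s < k ->
  iter k split_step (enc_str s ++ u, acc, false) = (u, catrev s acc, true).
Proof.
have fix_true j v w : iter j split_step (v, w, true) = (v, w, true).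
  by elim: j => //= j ->.
elim: s k acc => [|b s IH] [|k] acc // lt_k; first by rewrite iterSr fix_true.
by rewrite iterSr; exact: IH.
Qed.

Lemma size_split_step k u acc b : let: (v, w, _) := iter k split_step (u, acc, b) in
  size v + size w <= size u + size acc.
Proof.
elim: k => //= k; case: (iter _ _ _) => [[v w] c] /= IH.
case: c => //; case: v IH => [|[] [|b' v]] //= IH; lia.
Qed.

Section Lists.
Context {X : Type} `{EX : Enc X} {A : Type} `{EA : Enc1 A}.
Implicit Types l : X -> seq A.

Lemma enc_cons (a : A) (l : seq A) : enc1 (a :: l) = true :: enc_str (enc1 a) ++ enc1 l.
Proof. by rewrite /enc1 /Enc1_seq /= -catA. Qed.

Lemma sz_cons (a : A) (l : seq A) : sz (a :: l) = (2 * sz a + 2) + sz l.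
Proof. by rewrite !sz1 enc_cons /= size_cat size_enc_str; lia. Qed.

Lemma sz_nil : sz ([::] : seq A) = 1.
Proof. by []. Qed.

Lemma sz_catrev (l l' : seq A) : sz (catrev l l') + 1 = sz l + sz l'.
Proof.
elim: l l' => [|a l IH] l'; first by rewrite sz_nil addnC.
by rewrite [catrev _ _]/= IH !sz_cons; lia.
Qed.

Lemma sz_rev (l : seq A) : sz (catrev l [::]) = sz l.
Proof. by apply: (@addIn 1); rewrite sz_catrev sz_nil. Qed.

Lemma sz_drop i (l : seq A) : sz (drop i l) <= sz l.
Proof.
elim: l i => [|a l IH] [|i] //=; rewrite sz_cons; apply: leq_trans (IH i) _; lia.
Qed.

Lemma sz_take i (l : seq A) : sz (take i l) <= sz l.
Proof.
elim: l i => [|a l IH] i; first by case: i => [|i]; apply: leqnn.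
case: i => [|i]; first by rewrite take0 sz_nil sz_cons; lia.
by rewrite [take _ _]/= !sz_cons leq_add2l.
Qed.

Lemma FP_raw (a : X -> A) : FP a -> FP (fun x => enc1 (a x)).
Proof. by move=> Ha; exact: FP_regs Ha _. Qed.

Lemma FP_lnilp l : FP l -> FP (fun x => nilp (l x)).
Proof.
move=> Hl; have Hr : FP (fun x => enc1 (l x)) by exact: FP_regs Hl _.
by apply: FP_ext (FP_negb (FP_head false Hr)) _ => x; case: (l x).
Qed.

Lemma FP_lcons (a : X -> A) l : FP a -> FP l -> FP (fun x => a x :: l x).
Proof.
move=> /FP_raw Ha Hl; have Hr : FP (fun x => enc1 (l x)) by exact: FP_regs Hl _.
by apply: FP_regs (FP_cons true (FP_cat (FP_enc_str Ha) Hr)) _ => x; rewrite /regs /= enc_cons.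
Qed.

Lemma FP_split l : FP l ->
  FP (fun x => iter (size (enc1 (l x))) split_step (behead (enc1 (l x)), [::], false)).
Proof.
move=> Hl; have Hr : FP (fun x => enc1 (l x)) by exact: FP_regs Hl _.
apply: (FP_iterate (y0 := fun x => (behead (enc1 (l x)), [::], false)) (h := fun _ => split_step)
  (B := fun x => sz (enc1 (l x)) + 1)); fp_str.
- rewrite /split_step; apply: FP_ext (_ : FP (fun z : X * (str * str * bool) =>
    if z.2.2 then z.2 else if nilp z.2.1.1 then z.2 else
    if head false z.2.1.1 then (behead (behead z.2.1.1), head false (behead z.2.1.1) :: z.2.1.2, false)
    else (behead z.2.1.1, z.2.1.2, true))) _; last by move=> [x [[u v] b]].
  by fp_str.
- exact: pb_add (FP_size Hr) (pb_const _).
- move=> x i _; pose proof (size_split_step i (behead (enc1 (l x))) [::] false) as K; move: K.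
  rewrite size_behead addn0; case: (iter _ _ _) => [[v w] b]; rewrite !sz_pair sz_bool !sz_str.
  by move: (size v) (size w) (size _) => ? ? ? ?; lia.
Qed.

Lemma split_cons (a : A) (l : seq A) :
  iter (size (enc1 (a :: l))) split_step (behead (enc1 (a :: l)), [::], false) =
  (enc1 l, rev (enc1 a), true).
Proof.
rewrite enc_cons [behead _]/= iter_split_step //.
by rewrite /= size_cat size_enc_str; lia.
Qed.

Lemma FP_lhead (a0 : A) l : FP l -> FP (fun x => head a0 (l x)).
Proof.
move=> Hl; have Hs := FP_split Hl; have Hn := FP_lnilp Hl.
have H : FP (fun x => if nilp (l x) then enc1 a0 else
   rev (iter (size (enc1 (l x))) split_step (behead (enc1 (l x)), [::], false)).1.2).
  by apply: FP_if => //; [apply: FP_const|apply: FP_rev; fp].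
by apply: FP_regs H _ => x; case: (l x) => // a s; rewrite split_cons /= revK.
Qed.

Lemma FP_lbehead l : FP l -> FP (fun x => behead (l x)).
Proof.
move=> Hl; have Hs := FP_split Hl; have Hn := FP_lnilp Hl.
have H : FP (fun x => if nilp (l x) then enc1 ([::] : seq A) else
   (iter (size (enc1 (l x))) split_step (behead (enc1 (l x)), [::], false)).1.1).
  by apply: FP_if => //; [apply: FP_const|fp].
by apply: FP_regs H _ => x; case: (l x) => // a s; rewrite split_cons.
Qed.
End Lists.

Section ListFolds.
Context {X : Type} `{EX : Enc X} {A : Type} `{EA : Enc1 A}.

(** The loop counter is the encoding of the list, which is longer than the list itself; the surplus
    rounds find an empty list and do nothing. *)
Lemma FP_lfoldl (a0 : A) Y `{Enc Y} (l : X -> seq A) (y0 : X -> Y) (h : X -> Y -> A -> Y) (B : X -> nat) :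
  FP l -> FP y0 -> FP (fun z : X * Y * A => h z.1.1 z.1.2 z.2) -> pb B ->
  (forall x i, sz (foldl (h x) (y0 x) (take i (l x))) <= B x) ->
  FP (fun x => foldl (h x) (y0 x) (l x)).
Proof.
move=> Hl H0 Hh pbB HB.
pose g x (z : seq A * Y) := if nilp z.1 then z else (behead z.1, h x z.2 (head a0 z.1)).
have It x i : iter i (g x) (l x, y0 x) = (drop i (l x), foldl (h x) (y0 x) (take i (l x))).
  elim: i => [|i IH]; first by rewrite drop0 take0.
  rewrite iterS IH /g /=; case: (ltnP i (size (l x))) => [lt_i|le_i].
    by rewrite (drop_nth a0) // (take_nth a0) // foldl_rcons.
  by rewrite !drop_oversize ?take_oversize // leqW.
have Hr : FP (fun x => enc1 (l x)) by exact: FP_regs Hl _.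
apply: FP_ext (FP_proj2 (FP_iterate (y0 := fun x => (l x, y0 x)) (h := g) (B := fun x => sz (l x) + B x) Hr _ _ _ _)) _.
- exact: FP_pair Hl H0.
- rewrite /g; have H1 : FP (fun z : X * (seq A * Y) => z.2.1) by fp.
  apply: FP_if; [exact: FP_lnilp H1|fp|apply: FP_pair; first exact: FP_lbehead H1].
  have := FP_lhead a0 H1; move: head => hd H2.
  by fp.
- exact: pb_add (FP_size Hl) pbB.
- by move=> x i _; rewrite It sz_pair leq_add ?sz_drop ?HB.
- move=> x; rewrite It take_oversize //.
  by elim: (l x) => // a s IH; rewrite enc_cons /= size_cat; lia.
Qed.

Lemma FP_lrev (a0 : A) (l : X -> seq A) : FP l -> FP (fun x => rev (l x)).
Proof.
move=> Hl; apply: FP_ext (FP_lfoldl a0 (y0 := fun=> [::]) (h := fun _ s a => a :: s) Hl _ _ (FP_size Hl) _) _.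
- exact: FP_const.
- by apply: FP_lcons; fp.
- move=> x i; rewrite foldl_cons.
  by rewrite sz_rev sz_take.
- by move=> x; rewrite foldl_cons.
Qed.

Lemma FP_lsize (a0 : A) (l : X -> seq A) : FP l -> FP (fun x => size (l x)).
Proof.
have E (s : seq A) n : foldl (fun m _ => m.+1) n s = n + size s.
  by elim: s n => [|a s IH] n; rewrite ?addn0 //= IH addSnnS.
have le_sz (s : seq A) : size s <= sz s.
  by elim: s => // a s IH; rewrite sz_cons /=; lia.
move=> Hl; apply: FP_ext (FP_lfoldl a0 (y0 := fun=> 0) (h := fun _ m _ => m.+1) Hl _ _ (FP_size Hl) _) _; fp.
  by move=> x i; rewrite E sz_nat; apply: leq_trans (le_sz _) (sz_take _ _).
by move=> x; rewrite E.
Qed.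

Lemma FP_all (a0 : A) (l : X -> seq A) (p : X -> A -> bool) :
  FP l -> FP (fun z : X * A => p z.1 z.2) -> FP (fun x => all (p x) (l x)).
Proof.
move=> Hl Hp; have E q (s : seq A) b : foldl (fun b a => b && q a) b s = b && all q s.
  by elim: s b => [|a s IH] b; rewrite ?andbT //= IH andbA.
apply: FP_ext (FP_lfoldl a0 (y0 := fun=> true) (h := fun x b a => b && p x a)
  (B := fun=> 1) Hl _ _ (pb_const _) _) _; fp.
  by move=> x i; rewrite sz_bool.
by move=> x; rewrite E.
Qed.

Lemma FP_has (a0 : A) (l : X -> seq A) (p : X -> A -> bool) :
  FP l -> FP (fun z : X * A => p z.1 z.2) -> FP (fun x => has (p x) (l x)).
Proof.
move=> Hl Hp; have Hn : FP (fun z : X * A => ~~ p z.1 z.2) by fp.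
apply: FP_ext (FP_negb (FP_all a0 (p := fun x a => ~~ p x a) Hl Hn)) _ => x.
by rewrite -has_predC; apply: eq_has => a; rewrite /= negbK.
Qed.
End ListFolds.

Section Pairwise.
Context {X : Type} `{EX : Enc X} {A : Type} `{EA : Enc1 A}.

(** One fold suffices: it accumulates the entries already seen and compares each new entry with all
    of them. *)
Lemma FP_pairwise (a0 : A) (l : X -> seq A) (r : X -> A -> A -> bool) : FP l ->
  FP (fun z : X * A * A => r z.1.1 z.1.2 z.2) -> FP (fun x => pairwise (r x) (l x)).
Proof.
move=> Hl Hr; pose h x (z : seq A * bool) a := (a :: z.1, z.2 && all (r x ^~ a) z.1).
have E x s t b : foldl (h x) (t, b) s =
    (catrev s t, [&& b, all (fun a => all (r x ^~ a) t) s & pairwise (r x) s]).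
  elim: s t b => [|a s IH] t b; first by rewrite /= andbT.
  rewrite [foldl _ _ _]/= IH /=; congr (_, _).
  have -> : all (fun a' => all (r x ^~ a') (a :: t)) s = all (r x a) s && all (fun a' => all (r x ^~ a') t) s.
    by rewrite -all_predI.
  by case: b (all (r x ^~ a) t) (all (r x a) s) => [] [] [] //=; rewrite ?andbF.
apply: FP_ext (FP_proj2 (FP_lfoldl a0 (y0 := fun=> ([::], true)) (h := h) (B := fun x => sz (l x) + 1) Hl _ _ _ _)) _.
- exact: FP_const.
- rewrite /h; apply: FP_pair; first by apply: FP_lcons; fp.
  apply: FP_andb; first by fp.
  apply: (FP_all a0 (X := X * (seq A * bool) * A) (l := fun z => z.1.2.1) (p := fun z a => r z.1.1 a z.2)); first by fp.
  by fp.
- exact: pb_add (FP_size Hl) (pb_const _).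
- by move=> x i; rewrite E sz_pair sz_bool sz_rev leq_add2r sz_take.
- move=> x; rewrite E /=.
  by have -> : all (fun a => true) (l x) by exact: all_predT.
Qed.
End Pairwise.

Section Strings.
Context {X : Type} `{EX : Enc X}.

Lemma FP_eqstr (s t : X -> str) : FP s -> FP t -> FP (fun x => s x == t x).
Proof.
move=> Hs Ht; pose h (z : str * bool) b := (behead z.1, [&& z.2, ~~ nilp z.1 & head false z.1 == b]).
have E u v b : let: (w, c) := foldl h (v, b) u in (c && nilp w) = b && (u == v).
  elim: u v b => [|a u IH] v b; first by rewrite /=; case: v.
  rewrite [foldl _ _ _]/=; have := IH (behead v) [&& b, ~~ nilp v & head false v == a].
  case: (foldl _ _ _) => w c ->; case: v => [|a' v] /=; first by rewrite !andbF.
  by rewrite eqseq_cons eq_sym; case: b.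
have H : FP (fun x => foldl h (t x, true) (s x)).
  apply: (FP_foldl (y0 := fun x => (t x, true)) (h := fun _ => h) (B := fun x => sz (t x) + 1) Hs).
  - by fp.
  - by rewrite /h; fp.
  - by rewrite /h; fp.
  - exact: pb_add (FP_size Ht) (pb_const _).
  - move=> x i _; elim: (take i (s x)) (t x) true => [|a u IH] v b; first by rewrite sz_pair sz_bool.
    by apply: leq_trans (IH _ _) _; rewrite !sz_str size_behead leq_add2r leq_pred.
apply: FP_ext (FP_andb (FP_proj2 H) (FP_nilp (FP_proj1 H))) _ => x.
by have := E (s x) (t x) true; case: (foldl _ _ _).
Qed.

End Strings.

Lemma FP_mem X `{Enc X} (s : X -> str) (l : X -> seq str) : FP s -> FP l -> FP (fun x => s x \in l x).
Proof.
move=> Hs Hl; have K : FP (fun z : X * str => s z.1 == z.2) by apply: FP_eqstr; fp.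
apply: FP_ext (FP_has [::] (p := fun x u => s x == u) Hl K) _ => x.
by elim: (l x) => //= u v IH; rewrite inE IH.
Qed.

(** * From 3-SAT to temporal stars *)

(* A tour amounts to choosing for each leaf an interval between two of its labels, so that the
   intervals are pairwise disjoint. *)
Definition tour_plan (I : tstar) (a b : nat -> nat) : Prop :=
  (forall i, i < size I -> [/\ a i \in nth [::] I i, b i \in nth [::] I i & a i < b i]) /\
  (forall i j, i < size I -> j < size I -> i != j -> b i < a j \/ b j < a i).

Definition te_chain : rel time_edge := fun e1 e2 => (te_dst e1 == te_src e2) && (te_lab e1 < te_lab e2).

Lemma valid_to_leaf I s i l : valid_time_edge I (s, i.+1, l) -> s = 0 /\ l \in nth [::] I i.
Proof.
rewrite /valid_time_edge /is_edge /edge_labels /te_src /te_dst /te_lab /= orbF.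
by case/andP=> /andP[/eqP-> _].
Qed.

Lemma valid_from_leaf I i d l : valid_time_edge I (i.+1, d, l) -> d = 0 /\ l \in nth [::] I i.
Proof.
rewrite /valid_time_edge /is_edge /edge_labels /te_src /te_dst /te_lab /=.
by case/andP=> /andP[/eqP-> _]; rewrite addn0.
Qed.

(** A leaf may be visited repeatedly; its first visit is retained. Every leaf is entered because the
    journey starts at the center, and left because it ends there. *)
Lemma explorable_tour_plan I : explorable I -> I <> [::] /\ exists a b, tour_plan I a b.
Proof.
move=> [[|e0 p0] [jp vp]] //; set p := e0 :: p0 in jp vp.
have {jp} /and4P[valp sortp /eqP src0 /eqP dstl] : [&& all (valid_time_edge I) p, sorted te_chain p,
  te_src e0 == 0 & te_dst (last e0 p) == 0] := jp.
pose e k := nth e0 p k.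
have validp k : k < size p -> valid_time_edge I (e k) by move=> lt_k; apply: (all_nthP e0 valp).
have chainp k : k.+1 < size p -> te_chain (e k) (e k.+1).
  by move=> lt_k; have := sortp; move/(pathP e0)/(_ k lt_k).
have labp k k' : k' < size p -> k < k' -> te_lab (e k) < te_lab (e k').
  elim: k' => // k' IH lt_k'; rewrite ltnS leq_eqVlt => /orP[/eqP->|lt_kk'].
    by case/andP: (chainp _ lt_k').
  by apply: ltn_trans (IH (ltnW lt_k') lt_kk') _; case/andP: (chainp _ lt_k').
split.
  by move=> I0; have := validp 0 erefl; by rewrite I0; case: (e 0) => [[[|u] [|v]] l].
(* The position of the first time edge that enters leaf [i]; the next one leaves it. *)
pose k i := index i.+1 (map te_dst p).
have kP i : i < size I -> (k i).+1 < size p /\ te_dst (e (k i)) = i.+1.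
  move=> lt_i; have Hk : i.+1 \in map te_dst p.
    have /hasP[x px /orP[/eqP sx|/eqP dx]] := vp i.+1 lt_i; last by rewrite -dx map_f.
    have := px; rewrite -index_mem => lt_x; have ex := nth_index e0 px.
    case: (index x p) lt_x ex => [|m] lt_m em.
      by move: sx; rewrite -em /= src0.
    have /andP[/eqP dm _] := chainp m lt_m; rewrite -sx -em -/(e m.+1) -dm map_f //.
    by rewrite mem_nth // ltnW.
  have dk : te_dst (e (k i)) = i.+1.
    by rewrite -(nth_map _ 0 te_dst) ?nth_index // -[size p](size_map te_dst) index_mem.
  split=> //; move: Hk; rewrite -index_mem size_map -/(k i) => lt_k.
  rewrite ltn_neqAle lt_k andbT; apply/eqP => Ek.
  by move: dk; rewrite /e -[k i]/((k i).+1.-1) Ek nth_last /= dstl.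
exists (fun i => te_lab (e (k i))), (fun i => te_lab (e (k i).+1)); split.
- move=> i /kP[lt_k dk]; have /andP[/eqP ds lt_l] := chainp _ lt_k.
  have := validp _ lt_k; have := validp _ (ltnW lt_k); move: ds dk.
  case: (e (k i)) (e (k i).+1) lt_l => [[s1 d1] l1] [[s2 d2] l2]; rewrite /te_lab /te_dst /te_src /=.
  by move=> lt_l <- -> /valid_to_leaf[_ ?] /valid_from_leaf[_ ?].
- move=> i j /kP[lt_ki di] /kP[lt_kj dj] nij.
  have far u v : (k u).+1 < size p -> te_dst (e (k u)) = u.+1 -> (k v).+1 < size p ->
      te_dst (e (k v)) = v.+1 -> k u < k v -> te_lab (e (k u).+1) < te_lab (e (k v)).
    move=> lt_u du lt_v dv lt_uv; apply: labp; first exact: ltnW.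
    rewrite ltn_neqAle lt_uv andbT; apply/eqP => Euv.
    (* The edge after [k u] starts at a leaf, so it cannot be the edge [k v], which enters one. *)
    have /andP[/eqP ds _] := chainp _ lt_u; have := validp _ lt_u; rewrite Euv in ds *; move: dv ds; rewrite du.
    by case: (e (k v)) => [[s d] l]; rewrite /te_dst /te_src /= => -> <- /valid_to_leaf[].
  case: (ltngtP (k i) (k j)) => [lt_k|lt_k|Ek].
  + by left; apply: far.
  + by right; apply: far.
  + by move: nij; rewrite -eqSS -di -dj Ek eqxx.
Qed.

Definition tour (a b : nat -> nat) (s : seq nat) : seq time_edge :=
  flatten [seq [:: (0, i.+1, a i); (i.+1, 0, b i)] | i <- s].

Lemma tour_sorted a b s : all (fun i => a i < b i) s -> sorted (fun i j => b i < a j) s ->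
  sorted te_chain (tour a b s).
Proof.
have chainE s1 d1 l1 s2 d2 l2 : te_chain (s1, d1, l1) (s2, d2, l2) = (d1 == s2) && (l1 < l2) by [].
case: s => // i s /andP[ab_i]; rewrite [sorted _ (tour _ _ _)]/= chainE eqxx ab_i /=.
elim: s i {ab_i} => // j s IH i /andP[ab_j ab_s] /andP[lt_ij sort_s].
by rewrite [path te_chain _ _]/= !chainE !eqxx lt_ij ab_j /= IH.
Qed.

(** Visiting the leaves in the order of their entry times gives a journey. Some leaf must exist
    because a journey has at least one edge. *)
Lemma tour_plan_explorable I a b : I <> [::] -> tour_plan I a b -> explorable I.
Proof.
move=> I0 [ab disj]; pose s := sort (fun i j => a i <= a j) (iota 0 (size I)).
have mem_s i : (i \in s) = (i < size I) by rewrite mem_sort mem_iota.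
have ab_s : all (fun i => a i < b i) s by apply/allP => i; rewrite mem_s => /ab[].
have sort_s : sorted (fun i j => b i < a j) s.
  apply: pairwise_sorted.
  have p1 : pairwise (fun i j => a i <= a j) s.
    rewrite -sorted_pairwise; last by move=> j i l; apply: leq_trans.
    by apply: sort_sorted => i j; apply: leq_total.
  have : uniq s by rewrite sort_uniq iota_uniq.
  rewrite uniq_pairwise => p2.
  have : pairwise [rel i j | (a i <= a j) && (i != j)] s by rewrite pairwise_relI p1 p2.
  apply: (sub_in_pairwise (P := mem s)); last by apply/allP.
  (* The other side of disjointness, [b j < a i], contradicts [a i <= a j < b j]. *)
  move=> i j si sj /= /andP[le_ij nij].
  have lt_i : i < size I by rewrite -mem_s; exact: si.
  have lt_j : j < size I by rewrite -mem_s; exact: sj.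
  have [//|lt_ji] := disj i j lt_i lt_j nij.
  by have [_ _ lt_j'] := ab j lt_j; lia.
clearbody s; exists (tour a b s); split; last first.
  move=> [|i] le_i.
    case: s {ab_s sort_s} mem_s => // /(_ 0); rewrite in_nil.
    by case: (I) I0.
  apply/hasP; exists (0, i.+1, a i); last by rewrite /te_dst /= eqxx.
  apply/flattenP; exists [:: (0, i.+1, a i); (i.+1, 0, b i)]; last by rewrite inE eqxx.
  by apply/mapP; exists i => //; rewrite mem_s.
have tour0 : tour a b s != [::].
  case: s {ab_s sort_s} mem_s => // /(_ 0); rewrite in_nil.
  by case: (I) I0.
have val_t : all (valid_time_edge I) (tour a b s).
  apply/allP => x /flattenP[y /mapP[i]]; rewrite mem_s => lt_i ->.
  have [ma mb _] := ab i lt_i.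
  rewrite !inE => /orP[] /eqP->; rewrite /valid_time_edge /is_edge /edge_labels /te_src /te_dst /te_lab /=.
    by rewrite lt_i ma.
  by rewrite lt_i addn0 mb.
have last0 e t : te_dst e = 0 -> te_dst (last e (tour a b t)) = 0.
  by elim: t e => //= i t IH e _; apply: IH.
have := tour_sorted ab_s sort_s; case: s tour0 val_t {mem_s ab_s sort_s} => // i s _ val_t sort_t.
by apply/and4P; split=> //; apply/eqP; apply: (last0 (i.+1, 0, b i)).
Qed.

Section Star.
(* A 3-CNF formula: the literal [r] is the variable [r./2], negated if [r] is even, and
   [cl c j] is the [j]-th literal of clause [c]. *)
Variables (NV C : nat) (cl : nat -> nat -> nat).
Hypothesis NV_gt0 : 0 < NV.
Hypothesis cl_lt : forall c j, c < C -> j < 3 -> cl c j < 2 * NV.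

Definition lit_true (a : nat -> bool) r := odd r == a r./2.

Definition satisfiable := exists a, forall c, c < C -> exists2 j, j < 3 & lit_true a (cl c j).

(** Layout of a region: 1 and [6 * C + 2] are the end points for the variable leaf, the six offsets
    from [6 * c + 2] on are reserved for clause [c], and the last two belong to the separator.
    Reserving offsets keeps clauses that share a literal apart. *)
Notation W := (6 * C + 4).
(* The labels [lab r x] with [0 < x <= W] form the time region of the literal [r]. *)
Definition lab r x := r * W + x.

Definition leafV v :=
  [:: lab (2 * v) 1; lab (2 * v) (6 * C + 2); lab (2 * v).+1 1; lab (2 * v).+1 (6 * C + 2)].
Definition leafB r := [:: lab r (6 * C + 3); lab r (6 * C + 4)].
Definition leafC c :=
  [:: lab (cl c 0) (6 * c + 2); lab (cl c 0) (6 * c + 3);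
      lab (cl c 1) (6 * c + 4); lab (cl c 1) (6 * c + 5);
      lab (cl c 2) (6 * c + 6); lab (cl c 2) (6 * c + 7)].
Definition star : tstar :=
  map leafV (iota 0 NV) ++ map leafB (iota 0 (2 * NV)) ++ map leafC (iota 0 C).

Lemma size_star : size star = NV + (2 * NV + C).
Proof. by rewrite !size_cat !size_map !size_iota. Qed.

Lemma nth_star_V v : v < NV -> nth [::] star v = leafV v.
Proof. by move=> lt_v; rewrite nth_cat size_map size_iota lt_v (nth_map 0) ?size_iota // nth_iota. Qed.

Lemma nth_star_B r : r < 2 * NV -> nth [::] star (NV + r) = leafB r.
Proof.
move=> lt_r; rewrite nth_cat size_map size_iota ltnNge leq_addr /= addKn.
by rewrite nth_cat size_map size_iota lt_r (nth_map 0) ?size_iota // nth_iota.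
Qed.

Lemma nth_star_C c : c < C -> nth [::] star (NV + (2 * NV + c)) = leafC c.
Proof.
move=> lt_c; rewrite nth_cat size_map size_iota ltnNge leq_addr /= addKn.
rewrite nth_cat size_map size_iota ltnNge leq_addr /= addKn.
by rewrite (nth_map 0) ?size_iota // nth_iota.
Qed.

Lemma lab_ltr r r' x x' : r < r' -> x <= W -> 0 < x' -> lab r x < lab r' x'.
Proof. by rewrite /lab; nia. Qed.

Lemma lab_inj r r' x x' : 0 < x <= W -> 0 < x' <= W -> lab r x = lab r' x' -> r = r' /\ x = x'.
Proof.
move=> /andP[x0 xW] /andP[x0' xW'] E; case: (ltngtP r r') => [lt_r|lt_r|Er].
- by have := lab_ltr lt_r xW x0'; rewrite E ltnn.
- by have := lab_ltr lt_r xW' x0; rewrite E ltnn.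
- by split=> //; move: E; rewrite Er => /addnI.
Qed.

Lemma lab_lt r x x' : (lab r x < lab r x') = (x < x').
Proof. exact: ltn_add2l. Qed.

Definition blocked s t := forall r, r < 2 * NV -> t < lab r (6 * C + 3) \/ lab r (6 * C + 4) < s.

(** An interval reaching into a later region would contain the separator at the end of the region
    where it starts. *)
Lemma same_region r r' x x' : r < 2 * NV -> 0 < x <= 6 * C + 2 -> 0 < x' <= 6 * C + 2 ->
  lab r x < lab r' x' -> blocked (lab r x) (lab r' x') -> r = r'.
Proof.
move=> lt_r /andP[x0 xW] /andP[x0' xW'] lt_l bl.
case: (ltngtP r r') => // lt_r'.
  have [lt1|] := bl r lt_r.
    have := @lab_ltr r r' (6 * C + 3) x' lt_r'; lia.
  by rewrite lab_lt; lia.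
have := @lab_ltr r' r x' x lt_r'; lia.
Qed.

Lemma star_sat : explorable star -> satisfiable.
Proof.
move=> /explorable_tour_plan[_ [s [t [st disj]]]].
(* A separator has only two labels, so its visit is forced, and all other visits avoid it. *)
have bl i : i < size star -> (forall r, r < 2 * NV -> i != NV + r) -> blocked (s i) (t i).
  move=> lt_i ni r lt_r.
  have lt_r' : NV + r < size star by rewrite size_star; lia.
  have [] := st _ lt_r'; rewrite nth_star_B // !inE => sr tr lt_st.
  have {sr tr lt_st}[<- <-] : s (NV + r) = lab r (6 * C + 3) /\ t (NV + r) = lab r (6 * C + 4).
    by move: sr tr lt_st; do 2![case/orP=> /eqP->]; rewrite ?lab_lt ?ltnn //; lia.
  by apply: disj; last exact: ni.
(* Both ends lie in one region, where the leaf has just two labels; so the visit fills that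
   region. *)
have var v : v < NV -> exists2 r, r = 2 * v \/ r = (2 * v).+1 &
    s v = lab r 1 /\ t v = lab r (6 * C + 2).
  move=> lt_v; have lt_v' : v < size star by rewrite size_star; lia.
  have [] := st _ lt_v'; rewrite nth_star_V // => sv tv lt_st.
  have reg z : z \in leafV v -> exists r x, [/\ z = lab r x, r = 2 * v \/ r = (2 * v).+1 & x = 1 \/ x = 6 * C + 2].
    by rewrite !inE => /or4P[] /eqP->; do 2!eexists; split; try reflexivity; auto.
  have [r [x [sE rE xE]]] := reg _ sv; have [r' [x' [tE rE' xE']]] := reg _ tv.
  exists r => //; rewrite sE tE in lt_st *.
  have Er : r = r'.
    by apply: same_region lt_st _; [lia|lia|lia|rewrite -sE -tE; apply: bl lt_v' _ => r0 lt_r0; lia].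
  by rewrite -Er lab_lt in lt_st *; split; congr lab; lia.
(* A variable is true when its leaf fills the region of the negated literal [2 * v]. *)
exists (fun v => s v == lab (2 * v) 1) => c lt_c.
set i := NV + (2 * NV + c).
have lt_i : i < size star by rewrite size_star /i; lia.
have [] := st _ lt_i; rewrite nth_star_C // => si ti lt_st.
have reg z : z \in leafC c -> exists j x, [/\ j < 3, z = lab (cl c j) x & 2 <= x <= 6 * C + 1].
  rewrite !inE => /orP[/eqP->|/orP[/eqP->|/or4P[]/eqP->]].
  - by exists 0, (6 * c + 2); split=> //; lia.
  - by exists 0, (6 * c + 3); split=> //; lia.
  - by exists 1, (6 * c + 4); split=> //; lia.
  - by exists 1, (6 * c + 5); split=> //; lia.
  - by exists 2, (6 * c + 6); split=> //; lia.
  - by exists 2, (6 * c + 7); split=> //; lia.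
have [j [x [lt_j sE xE]]] := reg _ si; have [j' [x' [lt_j' tE xE']]] := reg _ ti.
have lt_r := cl_lt lt_c lt_j; rewrite sE tE in lt_st.
have Er : cl c j = cl c j'.
  apply: same_region lt_st _; [by []|lia|lia|rewrite -sE -tE; apply: bl lt_i _ => r0 lt_r0; rewrite /i; lia].
exists j => //; rewrite /lit_true; rewrite -Er lab_lt in lt_st tE.
move: (cl c j) lt_r sE tE => r lt_r sE tE.
have lt_v : r./2 < NV by lia.
have [r' r'E [svE tvE]] := var _ lt_v; rewrite svE.
(* The clause offsets lie strictly between 1 and [6 * C + 2], so a visit there would meet the one
   filling the region. Hence [r'] is the opposite literal. *)
have nr : r' <> r.
  move=> Err; rewrite Err in svE tvE.
  have lt_v' : r./2 < size star by rewrite size_star; lia.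
  have [] := disj _ _ lt_i lt_v'; first by rewrite /i; lia.
    by rewrite tE svE lab_lt; lia.
  by rewrite tvE sE lab_lt; lia.
have -> : (lab r' 1 == lab (2 * r./2) 1) = (r' == 2 * r./2).
  by rewrite /lab eqn_add2r eqn_pmul2r //; lia.
by lia.
Qed.

Lemma sat_star : satisfiable -> explorable star.
Proof.
move=> [a Ha]; pose jj c := find (fun j => lit_true a (cl c j)) (iota 0 3).
have jjP c : c < C -> jj c < 3 /\ lit_true a (cl c (jj c)).
  move=> lt_c; have [j lt_j Hj] := Ha c lt_c.
  have hasj : has (fun j => lit_true a (cl c j)) (iota 0 3).
    by apply/hasP; exists j => //; rewrite mem_iota.
  have lt_jj : jj c < 3 by move: hasj; rewrite has_find.
  by have := nth_find 0 hasj; rewrite -/(jj c) nth_iota.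
(* Region, entry and exit for each leaf, in the order variables, separators, clauses. The false
   literal of variable [i] is [2 * i + ~~ a i]; a clause uses its first true literal. *)
pose iv i : nat * nat * nat :=
  if i < NV then (2 * i + ~~ a i, 1, 6 * C + 2)
  else if i < 3 * NV then (i - NV, 6 * C + 3, 6 * C + 4)
  else let c := i - 3 * NV in (cl c (jj c), 6 * c + 2 * jj c + 2, 6 * c + 2 * jj c + 3).
have ivP i j : i < size star -> j < size star -> i < j ->
    let: (r, x, x') := iv i in let: (r', y, y') := iv j in
    r != r' \/ (x' < y \/ y' < x).
  rewrite size_star => lt_i lt_j lt_ij; rewrite /iv.
  case: (ltnP i NV) => [lt_iV|le_iV]; case: (ltnP j NV) => [lt_jV|le_jV] /=; try lia.
  - case: (ltnP j (3 * NV)) => [lt_jB|le_jB] /=; first by right; left; lia.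
    have /jjP[lt_jj Hl] : j - 3 * NV < C by lia.
    rewrite /lit_true in Hl; left; apply/eqP => E; rewrite -E in Hl.
    have Eh : (2 * i + ~~ a i)./2 = i by case: (a i); lia.
    have Eo : odd (2 * i + ~~ a i) = ~~ a i by case: (a i); lia.
    by rewrite Eh Eo in Hl; case: (a i) Hl.
  - case: (ltnP i (3 * NV)) => [lt_iB|le_iB]; case: (ltnP j (3 * NV)) => [lt_jB|le_jB] /=; try lia.
    + have /jjP[lt_jj _] : j - 3 * NV < C by lia.
      by right; right; lia.
    + have /jjP[lt_jj _] : j - 3 * NV < C by lia.
      have /jjP[lt_ji _] : i - 3 * NV < C by lia.
      by right; left; lia.
have ivW i : i < size star -> let: (r, x, x') := iv i in 0 < x < x' /\ x' <= W.
  rewrite size_star => lt_i; rewrite /iv.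
  case: (ltnP i NV) => lt_iV; first by split; lia.
  case: (ltnP i (3 * NV)) => lt_iB; first by split; lia.
  have /jjP[lt_jj _] : i - 3 * NV < C by lia.
  by split; lia.
apply: (@tour_plan_explorable _ (fun i => lab (iv i).1.1 (iv i).1.2) (fun i => lab (iv i).1.1 (iv i).2)).
  by move/(congr1 size); rewrite size_star /=; lia.
split=> [i lt_i|].
  have := ivW i lt_i; case E: (iv i) => [[r x] x'] /= [/andP[x0 lt_x] _].
  rewrite lab_lt lt_x; move: E; rewrite /iv; move: lt_i; rewrite size_star => lt_i.
  case: (ltnP i NV) => [lt_iV|le_iV].
    rewrite nth_star_V // => -[<- <- <-]; case: (a i); rewrite ?addn0 ?addn1 !inE !eqxx ?orbT //.
  case: (ltnP i (3 * NV)) => [lt_iB|le_iB].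
    have -> : nth [::] star i = leafB (i - NV) by rewrite -nth_star_B ?subnKC //; lia.
    by move=> [<- <- <-]; rewrite !inE !eqxx orbT.
  have lt_c : i - 3 * NV < C by lia.
  have -> : nth [::] star i = leafC (i - 3 * NV).
    by rewrite -nth_star_C //; congr nth; lia.
  move: (i - 3 * NV) lt_c => c lt_c; have [lt_j _] := jjP c lt_c.
  by case: (jj c) lt_j => [|[|[|]]] // _ [<- <- <-]; split; rewrite ?inE /lab; lia.
have main i j : i < size star -> j < size star -> i < j ->
    lab (iv i).1.1 (iv i).2 < lab (iv j).1.1 (iv j).1.2 \/ lab (iv j).1.1 (iv j).2 < lab (iv i).1.1 (iv i).1.2.
  move=> lt_i lt_j lt_ij; have := ivP i j lt_i lt_j lt_ij; have := ivW i lt_i; have := ivW j lt_j.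
  case: (iv i) (iv j) => [[r x] x'] [[r' y] y'] /= [/andP[y0 lt_y] yW] [/andP[x0 lt_x] xW].
  case: (ltngtP r r') => [lt_r _|lt_r _|-> [//|]].
  - by left; apply: lab_ltr.
  - by right; apply: lab_ltr.
  - by rewrite !lab_lt.
move=> i j lt_i lt_j; case: (ltngtP i j) => // [lt_ij|lt_ji] _; first exact: main.
by case: (main j i lt_j lt_i lt_ji); [right|left].
Qed.

(** The six offsets in a clause leaf are distinct, so its labels are distinct even if the clause
    repeats a literal. *)
Lemma valid_star k : 6 <= k -> valid_tstar k star.
Proof.
move=> le_k.
have nE r r' x x' : 0 < x <= W -> 0 < x' <= W -> (r != r') || (x != x') -> (lab r x == lab r' x') = false.
  by move=> Hx Hx' ne; apply/negP => /eqP/(lab_inj Hx Hx')[Er Ex]; rewrite Er Ex !eqxx in ne.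
have labW r x : 0 < x -> 0 < lab r x by rewrite /lab; lia.
rewrite /valid_tstar !all_cat !all_map; apply/and3P; split; apply/allP => i; rewrite mem_iota => /andP[_ lt_i];
  apply/and3P; split; rewrite /= ?andbT ?labW //; try lia.
- by rewrite !inE !nE //; lia.
- by rewrite !inE !nE //; lia.
- by rewrite !inE !nE //; lia.
Qed.
End Star.

(** * Encoding runs by clauses *)

Local Notation clause := (nat * nat * nat)%type.

Lemma size_pair_enc w y : size (pair_enc w y) = 2 * size w + 2 + size y.
Proof. by rewrite /pair_enc size_cat /=; elim: w => //= b w IH; lia. Qed.

Lemma nth_pair_enc w y p : nth false (pair_enc w y) p =
  if p < 2 * size w then nth false w p./2
  else if p == 2 * size w then true
  else if p == (2 * size w).+1 then false
  else nth false y (p - (2 * size w + 2)).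
Proof.
elim: w p => [|b w IH] p.
  by case: p => [|[|p]] //=; rewrite muln0 add0n /= subSS subSS subn0.
by case: p => [|[|p]]; rewrite ?mulnS //= [nth _ _ _]IH.
Qed.

Section CookLevin.
Variables (Q S : nat) (M : TM Q S).

Definition hmove (d : dir) (h : nat) := match d with Dleft => h.-1 | Dright => h.+1 | Dstay => h end.

Definition hstep (ch : config Q S * nat) :=
  (step M ch.1,
   if tm_delta M (cstate ch.1) (chead ch.1) is Some (_, _, d) then hmove d ch.2 else ch.2).

(* The run of [M], together with the position of the head when it starts at position [T]. *)
Definition hrun x T t := iter t hstep (init Q S x, T).

Lemma hrun_run x T t : (hrun x T t).1 = run M x t.
Proof. by elim: t => //= t ->. Qed.

(** Starting at position [T], the head stays within [2 * T + 1] cells for [T] steps, and the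
    predecessor in [hmove] does not truncate. *)
Lemma hrun_pos x T t : T - t <= (hrun x T t).2 <= T + t.
Proof.
elim: t => [|t IH]; first by rewrite subn0 addn0 leqnn.
rewrite /hrun iterS -/(hrun x T t) /hstep /=.
by case: tm_delta => [[[q s] [] /=]|]; lia.
Qed.

Lemma cell_step c h i : 0 < h ->
  cell (hstep (c, h)).1 (hstep (c, h)).2 i =
  if i == h then (if tm_delta M (cstate c) (chead c) is Some (_, s, _) then s else chead c)
  else cell c h i.
Proof.
move=> h0; rewrite /hstep /step /=; case: tm_delta => [[[q s] d]|]; last first.
  by case: eqP => // ->; rewrite cell_head.
rewrite -(cell_write c q); case: d => //=; first by rewrite cell_left prednK.
by rewrite cell_right.
Qed.

Lemma state_step c h : cstate (hstep (c, h)).1 =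
  if tm_delta M (cstate c) (chead c) is Some (q, _, _) then q else cstate c.
Proof.
rewrite /hstep /step /=; case: tm_delta => [[[q s] [] ]|] //=.
- by rewrite /move_left /=; case: cleft.
- by rewrite /move_right /=; case: cright.
Qed.

Lemma cell_init x T i : cell (init Q S x) T i =
  if i < T then blank S else nth (blank S) (map (sym_of_bit S) x) (i - T).
Proof.
rewrite /cell /init; case: x => //= [|b x]; first by rewrite !nth_nil; case: (i - T) => [|[]].
by rewrite nth_nil.
Qed.

(* Variables: kind [k < Q.+1] is "the head is at [i] in state [k]", kind [Q.+1 + s] is
   "cell [i] contains [s]", and the last kind is "the head is not at [i]". *)
Definition nkinds := (Q.+1 + S.+3).+1.
Definition ncells T := (2 * T).+1.
Definition var T t i k := (t * ncells T + i) * nkinds + k.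
Definition pos v := (2 * v).+1.
Definition neg v := 2 * v.
Definition vsym T t i s := var T t i (Q.+1 + s).
Definition vaway T t i := var T t i (Q.+1 + S.+3).

Lemma lit_pos a v : lit_true a (pos v) = a v.
Proof.
rewrite /lit_true /pos; have -> : odd (2 * v).+1 by lia.
by have -> : (2 * v).+1./2 = v by lia.
Qed.

Lemma lit_neg a v : lit_true a (neg v) = ~~ a v.
Proof.
rewrite /lit_true /neg; have -> : odd (2 * v) = false by lia.
by have -> : (2 * v)./2 = v by lia.
Qed.

Section Clauses.
(* [m] bounds the length of the certificate. *)
Variables (w : str) (m T : nat).
Let n := size w.
Let L := 2 * n + 2 + m.

(** The input row is the doubled bits of [w], the delimiter true, false (symbols 2 and 1), and [m]
    certificate cells. The argument [k] matters on these cells only; elsewhere the three literals of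
    [cl_input] coincide. *)
Definition init_sym i k :=
  if i < T then 0 else
  let p := i - T in
  if p < 2 * n then (nth false w p./2).+1 else
  if p == 2 * n then 2 else
  if p == (2 * n).+1 then 1 else
  if p < 2 * n + 2 + m then k else 0.

(** A halted configuration repeats itself, so the clauses need no case for halting. *)
Definition tm_next (q : 'I_Q.+1) (s : 'I_S.+3) :=
  if tm_delta M q s is Some r then r else (q, s, Dstay).

(** It also replaces the void instances of other families, so that every family is indexed
    uniformly. *)
Definition cl_start : clause := (pos (var T 0 T 0), pos (var T 0 T 0), pos (var T 0 T 0)).
Definition cl_input i : clause :=
  (pos (vsym T 0 i (init_sym i 0)), pos (vsym T 0 i (init_sym i 1)), pos (vsym T 0 i (init_sym i 2))).
(** Blanks propagate to the right among the certificate cells, so that these hold a word shorter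
    than or as long as [m], without gaps. *)
Definition cl_blank i : clause :=
  if (T + (2 * n + 2) <= i) && (i.+1 < T + (2 * n + 2 + m)) then
    (neg (vsym T 0 i 0), pos (vsym T 0 i.+1 0), pos (vsym T 0 i.+1 0)) else cl_start.
Definition cl_write (q : 'I_Q.+1) (s : 'I_S.+3) t i : clause :=
  (neg (var T t i q), neg (vsym T t i s), pos (vsym T t.+1 i (tm_next q s).1.2)).
Definition cl_move (q : 'I_Q.+1) (s : 'I_S.+3) t i : clause :=
  (neg (var T t i q), neg (vsym T t i s), pos (var T t.+1 (hmove (tm_next q s).2 i) (tm_next q s).1.1)).
Definition cl_away (q : 'I_Q.+1) t i j : clause :=
  if i == j then cl_start else (neg (var T t j q), pos (vaway T t i), pos (vaway T t i)).
(** Expressing the absence of the head through its states would take one literal per state; the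
    variable [vaway], forced by [cl_away], keeps the clause at three literals. *)
Definition cl_keep (s : 'I_S.+3) t i : clause :=
  (neg (vaway T t i), neg (vsym T t i s), pos (vsym T t.+1 i s)).
Definition cl_accept (q : 'I_Q.+1) i : clause :=
  if tm_accept M q then cl_start else (neg (var T T i q), neg (var T T i q), neg (var T T i q)).

Definition cl_true a (c : clause) := [|| lit_true a c.1.1, lit_true a c.1.2 | lit_true a c.2].

Definition clauses_true a := forall t i j, t < T -> i < ncells T -> j < ncells T ->
  [/\ cl_true a cl_start, cl_true a (cl_input i) & cl_true a (cl_blank i)] /\
  (forall q s, [/\ cl_true a (cl_write q s t i), cl_true a (cl_move q s t i), cl_true a (cl_away q t i j),
      cl_true a (cl_keep s t i) & cl_true a (cl_accept q i)]).

Hypothesis L_le_T : L <= T.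

Let accepts y := tm_accept M (cstate (run M (pair_enc w y) T)).

Lemma tm_next_step x t : let c := (hrun x T t).1 in let h := (hrun x T t).2 in t < T ->
  [/\ cstate (hrun x T t.+1).1 = (tm_next (cstate c) (chead c)).1.1,
      (hrun x T t.+1).2 = hmove (tm_next (cstate c) (chead c)).2 h &
      forall i, cell (hrun x T t.+1).1 (hrun x T t.+1).2 i =
        if i == h then (tm_next (cstate c) (chead c)).1.2 else cell c h i].
Proof.
move=> c h lt_t; have h0 : 0 < h by have := hrun_pos x T t; rewrite /h; lia.
have -> : hrun x T t.+1 = hstep (c, h) by rewrite /c /h -surjective_pairing.
split.
- by rewrite state_step /tm_next; case: tm_delta => [[[]]|].
- by rewrite /tm_next /=; case: tm_delta => [[[]]|].
- by move=> i; rewrite cell_step // /tm_next; case: tm_delta => [[[]]|].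
Qed.

Lemma init_symE y i : size y <= m ->
  cell (init Q S (pair_enc w y)) T i =
    init_sym i (let p := i - T - (2 * n + 2) in if p < size y then (nth false y p).+1 else 0) :> nat.
Proof.
move=> le_y; rewrite cell_init /init_sym; case: ltnP => // le_i.
have szE := size_pair_enc w y.
have nthE p : p < size (pair_enc w y) ->
    nth (blank S) (map (sym_of_bit S) (pair_enc w y)) p = (nth false (pair_enc w y) p).+1 :> nat.
  by move=> lt_p; rewrite (nth_map false) // /sym_of_bit; case: (nth _ _ _); rewrite inordK.
case: (ltnP (i - T) (size (pair_enc w y))) => [lt_p|le_p]; last first.
  rewrite nth_default ?size_map //=; rewrite szE -/n in le_p.
  by do 5?[case: ifP => ? //]; lia.
rewrite nthE // nth_pair_enc -/n; do 3![case: ifP => //].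
by move=> *; rewrite !ifT //; rewrite -/n in szE; lia.
Qed.

Lemma clauses_complete y : size y <= m -> accepts y -> exists a, clauses_true a.
Proof.
move=> le_y acc; pose x := pair_enc w y.
pose c t := (hrun x T t).1; pose h t := (hrun x T t).2.
(* The assignment decodes a variable into kind, cell and time and reads its value off the run. *)
pose a v := let k := v %% nkinds in let u := v %/ nkinds in
  let i := u %% ncells T in let t := u %/ ncells T in
  if k < Q.+1 then (i == h t) && (cstate (c t) == k :> nat)
  else if k < Q.+1 + S.+3 then cell (c t) (h t) i == k - Q.+1 :> nat
  else i != h t.
have aE t i k : i < ncells T -> k < nkinds -> a (var T t i k) =
  if k < Q.+1 then (i == h t) && (cstate (c t) == k :> nat)
  else if k < Q.+1 + S.+3 then cell (c t) (h t) i == k - Q.+1 :> nat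
  else i != h t.
  move=> lt_i lt_k; rewrite /a /var modnMDl (modn_small lt_k) divnMDl // (divn_small lt_k) addn0.
  by rewrite modnMDl (modn_small lt_i) divnMDl // (divn_small lt_i) addn0.
have aH t i (q : 'I_Q.+1) : i < ncells T -> a (var T t i q) = (i == h t) && (cstate (c t) == q).
  by move=> lt_i; rewrite aE ?ltn_ord // /nkinds; have := ltn_ord q; lia.
have aS t i s : i < ncells T -> s < S.+3 -> a (vsym T t i s) = (cell (c t) (h t) i == s :> nat).
  move=> lt_i lt_s; rewrite aE //; last by rewrite /nkinds; lia.
  by rewrite ltnNge leq_addr ltn_add2l lt_s addKn.
have aA t i : i < ncells T -> a (vaway T t i) = (i != h t).
  by move=> lt_i; rewrite aE // ltnNge leq_addr ltnn.
have c0 : cell (c 0) (h 0) =1 cell (init Q S x) T by [].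
have start : cl_true a cl_start.
  rewrite /cl_true !lit_pos -[0]/(nat_of_ord (ord0 : 'I_Q.+1)) aH ?/ncells; last by lia.
  by rewrite eqxx /c /= /init; case: (map _ x).
exists a => t i j lt_t lt_i lt_j; split; [split=> //|move=> q s; split].
- rewrite /cl_true !lit_pos; set z := init_sym i.
  have [z3 z0] : (forall k, k < 3 -> z k < S.+3) /\ [|| cell (c 0) (h 0) i == z 0 :> nat,
      cell (c 0) (h 0) i == z 1 :> nat | cell (c 0) (h 0) i == z 2 :> nat].
    split.
      by move=> k lt_k; rewrite /z /init_sym; do 5?[case: ifP => ? //]; lia.
    rewrite c0 init_symE // -/z; set p := _ - _ - _.
    by rewrite /=; case: ifP => _; [case: nth|]; rewrite eqxx ?orbT.
  by rewrite !aS ?z3.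
- rewrite /cl_blank; case: ifP => // /andP[le_i lt_i'].
  rewrite /cl_true lit_neg !lit_pos orbb.
  have lt_i1 : i.+1 < ncells T by move: L_le_T lt_i'; rewrite /L /ncells; lia.
  rewrite !aS // !c0 !init_symE // /init_sym.
  have -> : (i < T) = false by lia.
  have -> : (i.+1 < T) = false by lia.
  have -> : (i - T < 2 * n) = false by lia.
  have -> : (i.+1 - T < 2 * n) = false by lia.
  have -> : (i - T == 2 * n) = false by lia.
  have -> : (i.+1 - T == 2 * n) = false by lia.
  have -> : (i - T == (2 * n).+1) = false by lia.
  have -> : (i.+1 - T == (2 * n).+1) = false by lia.
  have -> : i - T < 2 * n + 2 + m by lia.
  have -> : i.+1 - T < 2 * n + 2 + m by lia.
  by case: ifP => //= le_p; rewrite ifN //; lia.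
- rewrite /cl_true !lit_neg lit_pos aH // !aS //.
  have [_ _ cE] := tm_next_step x lt_t; rewrite cE -/(c t) -/(h t).
  case: eqP => //= Ei; rewrite Ei cell_head; case: eqP => //= Eq.
  by case: eqP => //= Es; rewrite Eq (ord_inj Es) eqxx.
- rewrite /cl_true !lit_neg lit_pos aH // aS //=.
  case: eqP => //= Ei; rewrite Ei cell_head; case: eqP => //= Eq.
  case: eqP => //= Es; have [qE hE _] := tm_next_step x lt_t.
  have hT := hrun_pos x T t.+1; rewrite aH.
    by rewrite [h t.+1]hE [cstate (c t.+1)]qE -/(c t) -/(h t) Eq (ord_inj Es) !eqxx.
  by rewrite /ncells -Eq -(ord_inj Es) -[h t]/(hrun x T t).2 -hE; lia.
- rewrite /cl_away; case: eqP => // /eqP nij; rewrite /cl_true lit_neg !lit_pos orbb aH // aA //.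
  by case: eqP => //= <-; rewrite nij orbT.
- rewrite /cl_true !lit_neg !lit_pos aA // !aS // negbK.
  have [_ _ cE] := tm_next_step x lt_t; rewrite cE -/(c t) -/(h t).
  by case: eqP => //= _; case: eqP.
- rewrite /cl_accept; case: ifP => // nacc; rewrite /cl_true !lit_neg !orbb aH //.
  rewrite negb_and orbC; case: eqP => //= Eq; move: acc.
  by rewrite /accepts -(hrun_run _ T) -/x -/(c T) Eq nacc.
Qed.

(** Several symbols of a cell or several head positions may be true under [a] at once. This does no
    harm: unit propagation makes the variables of the actual run true, and [cl_accept] excludes its
    rejecting states by negative literals. *)
Lemma clauses_sound a : clauses_true a -> exists2 y, size y <= m & accepts y.
Proof.
move=> Ha.
have T0 : 0 < T by move: L_le_T; rewrite /L; lia.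
pose P k := T + (2 * n + 2) + k.
have PN k : k < m -> P k < ncells T by move=> lt_k; move: L_le_T; rewrite /P /L /ncells; lia.
(* The certificate ends at the first of its cells that [a] declares blank, or has full length
   [m]. *)
pose e := find (fun k => a (vsym T 0 (P k) 0)) (iota 0 m).
have le_e : e <= m by rewrite -[m](size_iota 0) find_size.
have beforeE k : k < e -> a (vsym T 0 (P k) 0) = false.
  move=> lt_k; have := before_find 0 lt_k; rewrite nth_iota //; exact: leq_trans lt_k le_e.
have afterE k : e <= k -> k < m -> a (vsym T 0 (P k) 0).
  elim: k => [|k IH].
    rewrite leqn0 => /eqP Ee lt_0; have : has (fun k => a (vsym T 0 (P k) 0)) (iota 0 m).
      by rewrite has_find -/e size_iota Ee.
    by move/(nth_find 0); rewrite -/e Ee nth_iota.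
  rewrite leq_eqVlt => /orP[/eqP Ee lt_k|le_k lt_k].
    have : has (fun k => a (vsym T 0 (P k) 0)) (iota 0 m).
      by rewrite has_find -/e size_iota Ee.
    by move/(nth_find 0); rewrite -/e Ee nth_iota.
  have [[_ _]] := Ha 0 (P k) 0 T0 (PN k (ltnW lt_k)) isT.
  rewrite /cl_blank ifT; last by rewrite /P; lia.
  rewrite /cl_true lit_neg !lit_pos orbb /= (IH le_k (ltnW lt_k)) /=.
  by rewrite /P -addnS.
(* Before [e] the blank literal fails, so [cl_input] leaves symbol 1 or 2; if both hold, the bit
   true is read. *)
pose y := mkseq (fun k => a (vsym T 0 (P k) 2)) e.
have szy : size y = e by rewrite size_mkseq.
exists y; first by rewrite szy.
pose x := pair_enc w y.
have row0 i : i < ncells T -> a (vsym T 0 i (cell (init Q S x) T i)).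
  move=> lt_i; have [[_ + _] _] := Ha 0 i 0 T0 lt_i isT.
  rewrite init_symE ?szy // /cl_true !lit_pos.
  case: (boolP ((T + (2 * n + 2) <= i) && (i < T + (2 * n + 2 + m)))) => [/andP[le_i lt_i']|out].
    have zE k : init_sym i k = k.
      rewrite /init_sym ifN; last by lia.
      rewrite ifN; last by lia.
      rewrite ifN; last by lia.
      rewrite ifN; last by lia.
      by rewrite ifT //; lia.
    rewrite !zE /=; set p := i - T - (2 * n + 2).
    have Ei : i = P p by rewrite /P /p; lia.
    case: ifP => [lt_p|ge_p _]; last first.
      by rewrite Ei; apply: afterE; rewrite /p; lia.
    rewrite nth_mkseq //; rewrite Ei beforeE //=.
    by case E2: (a (vsym T 0 (P p) 2)); rewrite ?orbF.
  have zE k k' : init_sym i k = init_sym i k'.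
    rewrite /init_sym; do 4![case: ifP => //]; case: ifP => //; lia.
  by rewrite -(zE 2 0) -(zE 2 1) !orbb -(zE 2 (if _ then _ else _)).
pose c t := (hrun x T t).1; pose h t := (hrun x T t).2.
have main t : t <= T -> a (var T t (h t) (cstate (c t))) /\
    forall i, i < ncells T -> a (vsym T t i (cell (c t) (h t) i)).
  elim: t => [|t IH] lt_t.
    split; last by move=> i lt_i; apply: row0.
    have [[+ _ _] _] := Ha 0 0 0 T0 isT isT.
    by rewrite /cl_true !orbb lit_pos /c /h /= /init; case: (map _ x).
  have [aH aS] := IH (ltnW lt_t); have [qE hE cE] := tm_next_step x lt_t.
  have hT := hrun_pos x T t; have lt_h : h t < ncells T by rewrite /ncells /h; lia.
  have aSh := aS _ lt_h; rewrite cell_head in aSh.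
  have [_ /(_ (cstate (c t)) (chead (c t)))[]] := Ha t (h t) 0 lt_t lt_h isT.
  rewrite /cl_true !lit_neg !lit_pos /= aH aSh /= => Hw Hm _ _ _.
  split; first by rewrite /c /h qE hE.
  move=> i lt_i; rewrite /c /h cE -/(c t) -/(h t); case: eqP => [->//|/eqP ni].
  have [_ /(_ (cstate (c t)) (cell (c t) (h t) i))[_ _ + + _]] := Ha t i (h t) lt_t lt_i lt_h.
  rewrite /cl_away (negPf ni) /cl_true !lit_neg !lit_pos /= orbb aH /= => aA.
  by rewrite aA (aS _ lt_i).
have [aH _] := main T (leqnn _).
have hT := hrun_pos x T T; have lt_h : h T < ncells T by rewrite /ncells /h; lia.
have [_ /(_ (cstate (c T)) ord0)[_ _ _ _]] := Ha 0 (h T) 0 T0 lt_h isT.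
rewrite /cl_accept /accepts -/x -(hrun_run _ T) -/(c T); case: ifP => // _.
by rewrite /cl_true !orbb lit_neg aH.
Qed.
End Clauses.
End CookLevin.

(** * The reduction and its computation in polynomial time *)

Lemma FP_poly_bound c d X `{Enc X} (n : X -> nat) : FP n -> FP (fun x => poly_bound c d (n x)).
Proof. by move=> Hn; rewrite /poly_bound; fp_nat. Qed.

(** Choosing from a fixed finite list unfolds into a chain of comparisons, so each [F a] may have a
    program of its own. *)
Lemma FP_nth_fun (A : Type) (a0 : A) (s : seq A) X Y `{Enc X} `{Enc Y} (F : A -> X -> Y) (i : X -> nat) :
  (forall a, FP (F a)) -> FP i -> FP (fun x => F (nth a0 s (i x)) x).
Proof.
move=> HF; elim: s i => [|a s IH] i Hi; first by apply: FP_ext (HF a0) _ => x; rewrite nth_nil.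
apply: FP_ext (FP_if (FP_eqn Hi (FP_const 0)) (HF a) (IH _ (FP_pred Hi))) _ => x.
by case: (i x).
Qed.

Lemma FP_enc_list_cons X `{Enc X} (a : X -> nat) (s : X -> seq nat) :
  FP a -> FP (fun x => enc_list (s x)) -> FP (fun x => enc_list (a x :: s x)).
Proof.
move=> Ha Hs; apply: FP_ext (FP_cons true (FP_cat (FP_enc_nat Ha) Hs)) _ => x.
by rewrite /enc_list /= -catA.
Qed.

Section Reduction.
Variables (Q S : nat) (M : TM Q S) (c1 d1 c2 d2 : nat).

Definition mlen (w : str) := poly_bound c1 d1 (size w).
Definition plen (w : str) := 2 * size w + 2 + mlen w.
(** The first summand bounds the run on the longest input, of length [plen w]; the second makes the
    input fit into the cells to the right of the start. *)
Definition time (w : str) := poly_bound c2 d2 (plen w) + plen w.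

(** All eight families take the same parameters, at the price of repeated clauses, so that a clause
    number decodes by division with remainder. *)
Definition fcode := ('I_8 * 'I_Q.+1 * 'I_S.+3)%type.

Definition family (f : fcode) (w : str) (t i j : nat) : clause :=
  let: (k, q, s) := f in
  match val k with
  | 0 => cl_start Q S (time w)
  | 1 => cl_input Q S w (mlen w) (time w) i
  | 2 => cl_blank Q S w (mlen w) (time w) i
  | 3 => cl_write M (time w) q s t i
  | 4 => cl_move M (time w) q s t i
  | 5 => cl_away S (time w) q t i j
  | 6 => cl_keep Q (time w) s t i
  | _ => cl_accept M (time w) q i
  end.

Definition fcode0 : fcode := (ord0, ord0, ord0).
(** Rows 0 to [time w] occur, and [cl_move] at the last cell of a row refers to one cell beyond it;
    the term 2 leaves room for both. *)
Definition nvars (w : str) := (time w + 2) * ncells (time w) * nkinds Q S.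
Definition nclauses (w : str) := time w * ncells (time w) * ncells (time w) * #|{: fcode}|.

Definition clause_at (w : str) (c : nat) : clause :=
  let N := ncells (time w) in
  let r := c %/ #|{: fcode}| in
  family (nth fcode0 (enum {: fcode}) (c %% #|{: fcode}|)) w (r %/ N %/ N) (r %/ N %% N) (r %% N).

Definition pick3 (c : clause) (p : nat) : nat :=
  if p == 0 then c.1.1 else if p == 1 then c.1.2 else c.2.

Definition literal_at (w : str) (c p : nat) : nat := pick3 (clause_at w c) p.

Lemma clause_atP (P : clause -> Prop) w :
  (forall c, c < nclauses w -> P (clause_at w c)) <->
  (forall f t i j, t < time w -> i < ncells (time w) -> j < ncells (time w) -> P (family f w t i j)).
Proof.
set T := time w; set N := ncells T; have N0 : 0 < N by [].
have card0 : 0 < #|{: fcode}| by apply/card_gt0P; exists fcode0.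
split=> [H f t i j lt_t lt_i lt_j|H c lt_c].
  have lt_f : index f (enum {: fcode}) < #|{: fcode}| by rewrite cardE index_mem mem_enum.
  have := H (((t * N + i) * N + j) * #|{: fcode}| + index f (enum {: fcode})).
  rewrite /clause_at -/T -/N divnMDl // (divn_small lt_f) addn0 modnMDl (modn_small lt_f).
  have mulK u v : v < N -> ((u * N + v) %/ N = u) * ((u * N + v) %% N = v).
    by move=> lt_v; rewrite divnMDl // divn_small // addn0 modnMDl modn_small.
  rewrite nth_index ?mem_enum // !(mulK _ j lt_j) !(mulK _ i lt_i); apply.
  rewrite /nclauses -/T -/N; move: (index _ _) #|_| lt_f => f' F lt_f.
  have H1 : t * N + i < T * N by nia.
  have H2 : (t * N + i) * N + j < T * N * N by nia.
  by nia.
apply: H; rewrite -/T -/N ?ltn_mod //.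
by rewrite !ltn_divLR // mulnC -!mulnA mulnC -!mulnA mulnC in lt_c *; rewrite /nclauses -/T -/N in lt_c; nia.
Qed.

Lemma le_plen_time w : plen w <= time w.
Proof. exact: leq_addl. Qed.

Lemma families_true w a :
  (forall f t i j, t < time w -> i < ncells (time w) -> j < ncells (time w) -> cl_true a (family f w t i j)) <->
  clauses_true M w (mlen w) (time w) a.
Proof.
split=> [H t i j lt_t lt_i lt_j|H [[k q] s] t i j lt_t lt_i lt_j].
  have G k (lt_k : k < 8) q s : cl_true a (family (Ordinal lt_k, q, s) w t i j) by apply: H.
  split; [split|move=> q s; split].
  - exact: (G 0 isT ord0 ord0).
  - exact: (G 1 isT ord0 ord0).
  - exact: (G 2 isT ord0 ord0).
  - exact: (G 3 isT q s).
  - exact: (G 4 isT q s).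
  - exact: (G 5 isT q s).
  - exact: (G 6 isT q s).
  - exact: (G 7 isT q s).
have [[G0 G1 G2] /(_ q s)[G3 G4 G5 G6 G7]] := H t i j lt_t lt_i lt_j.
by case: k => [[|[|[|[|[|[|[|[|k]]]]]]]] lt_k].
Qed.

Lemma cl_true_pick3 a (c : clause) : cl_true a c <-> exists2 p, p < 3 & lit_true a (pick3 c p).
Proof.
split; first by case/or3P=> H; [exists 0|exists 1|exists 2].
by move=> [[|[|[|p]]] // _ H]; rewrite /cl_true; apply/or3P; [constructor 1|constructor 2|constructor 3].
Qed.

Lemma satisfiable_clauses w :
  satisfiable (nclauses w) (literal_at w) <-> exists a, clauses_true M w (mlen w) (time w) a.
Proof.
have E a : (forall c, c < nclauses w -> exists2 p, p < 3 & lit_true a (literal_at w c p)) <->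
    clauses_true M w (mlen w) (time w) a.
  rewrite -families_true -(clause_atP (fun c => cl_true a c)).
  by split=> H c /H; rewrite cl_true_pick3.
by split=> -[a /E Ha]; exists a.
Qed.

Lemma family_lt f w t i j p : t < time w -> i < ncells (time w) -> j < ncells (time w) -> p < 3 ->
  pick3 (family f w t i j) p < 2 * nvars w.
Proof.
case: f => [[k q] s]; set T := time w => lt_t lt_i lt_j lt_p.
have var_lt t' i' k' : t' <= T -> i' <= ncells T -> k' < nkinds Q S -> var Q S T t' i' k' < nvars w.
  rewrite /var /nvars -/T => le_t le_i lt_k.
  have : t' * ncells T + i' < (T + 2) * ncells T by rewrite /ncells in le_i *; nia.
  by move: (_ + i') => u lt_u; nia.
have lt_q (q' : 'I_Q.+1) : q' < nkinds Q S by rewrite /nkinds; have := ltn_ord q'; lia.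
have lt_s s' : s' < S.+3 -> Q.+1 + s' < nkinds Q S by rewrite /nkinds; lia.
have lt_a : Q.+1 + S.+3 < nkinds Q S by rewrite /nkinds.
have posP v : v < nvars w -> pos v < 2 * nvars w by rewrite /pos; lia.
have negP v : v < nvars w -> neg v < 2 * nvars w by rewrite /neg; lia.
have le_T : T <= ncells T by rewrite /ncells; lia.
have st p' : pick3 (cl_start Q S T) p' < 2 * nvars w.
  by rewrite /pick3 /cl_start /= !if_same; apply/posP/var_lt.
have pick (c : clause) : c.1.1 < 2 * nvars w -> c.1.2 < 2 * nvars w -> c.2 < 2 * nvars w -> 
    pick3 c p < 2 * nvars w.
  by rewrite /pick3; do 2![case: ifP => //].
have hm d : hmove d i <= ncells T.
  by move: (ncells T) lt_i => N lt_i; case: d => /=; lia.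
have isym k' : k' < 3 -> init_sym w (mlen w) T i k' < S.+3.
  by move=> lt_k; rewrite /init_sym; do 5?[case: ifP => ? //]; lia.
rewrite /family; case: k => [[|[|[|[|[|[|[|k]]]]]]] lt_k] /=; rewrite -/T.
- exact: st.
- by apply: pick => /=; apply/posP/var_lt => //; rewrite ?lt_s ?isym // ltnW.
- rewrite /cl_blank; case: ifP => _; last exact: st.
  by apply: pick => /=; (apply/posP || apply/negP); apply/var_lt => //; rewrite ?lt_s // ltnW.
- by apply: pick => /=; (apply/posP || apply/negP); apply/var_lt => //; rewrite ?lt_s // ltnW.
- by apply: pick => /=; (apply/posP || apply/negP); apply/var_lt => //; rewrite ?lt_s // ltnW.
- rewrite /cl_away; case: ifP => _; first exact: st.
  by apply: pick => /=; (apply/posP || apply/negP); apply/var_lt => //; rewrite ?lt_s // ltnW.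
- by apply: pick => /=; (apply/posP || apply/negP); apply/var_lt => //; rewrite ?lt_s // ltnW.
- rewrite /cl_accept; case: ifP => _; first exact: st.
  by apply: pick => /=; (apply/posP || apply/negP); apply/var_lt => //; rewrite ?lt_s // ltnW.
Qed.

Lemma literal_lt w c p : c < nclauses w -> p < 3 -> literal_at w c p < 2 * nvars w.
Proof.
move=> lt_c lt_p; rewrite /literal_at; move: c lt_c.
by apply/(clause_atP (fun c => pick3 c p < 2 * nvars w)) => f t i j *; apply: family_lt.
Qed.

Lemma FP_time : FP time.
Proof.
rewrite /time /plen /mlen; apply: FP_addn; last by rewrite /poly_bound; fp_nat.
by apply: FP_poly_bound; rewrite /poly_bound; fp_nat.
Qed.

Lemma FP_mlen : FP mlen.
Proof. by rewrite /mlen; apply: FP_poly_bound; fp_nat. Qed.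

(** For a fixed code [f] the transition table is consulted at constants only, and what remains is
    arithmetic. *)
Lemma FP_family f : FP (fun z : str * (nat * nat * nat) => family f z.1 z.2.1.1 z.2.1.2 z.2.2).
Proof.
have Ht := FP_time; have Hm := FP_mlen; case: f => [[k q] s].
rewrite /family; case: (val k) => [|[|[|[|[|[|[|_]]]]]]];
  rewrite /cl_input /cl_blank /cl_write /cl_move /cl_away /cl_keep /cl_accept
    /cl_start /pos /neg /vsym /vaway /var /init_sym /ncells; fp_nat.
by case: (tm_next M q s).2 => /=; fp_nat.
Qed.

Lemma FP_clause_at : FP (fun z : str * nat => clause_at z.1 z.2).
Proof.
have Ht := FP_time; rewrite /clause_at.
apply: (FP_nth_fun (X := str * nat) fcode0 (enum {: fcode})
  (F := fun f z => let N := ncells (time z.1) in let r := z.2 %/ #|{: fcode}| in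
    family f z.1 (r %/ N %/ N) (r %/ N %% N) (r %% N))); last by fp_nat.
move=> f; have Hf := FP_family f; rewrite /=.
apply: (FP_comp Hf (f := fun z : str * nat => let N := ncells (time z.1) in let r := z.2 %/ #|{: fcode}| in
  (z.1, (r %/ N %/ N, r %/ N %% N, r %% N)))).
by rewrite /= /ncells; fp_nat.
Qed.

Lemma FP_literal_at p : FP (fun z : str * nat => literal_at z.1 z.2 p).
Proof.
have Hc := FP_clause_at; rewrite /literal_at /pick3.
by case: p => [|[|p]] /=; fp_nat.
Qed.

Lemma FP_nvars : FP nvars.
Proof. by have Ht := FP_time; rewrite /nvars /ncells; fp_nat. Qed.

Lemma FP_nclauses : FP nclauses.
Proof. by have Ht := FP_time; rewrite /nclauses /ncells; fp_nat. Qed.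

Definition reduction w := star (nvars w) (nclauses w) (literal_at w).

Lemma FP_reduction : FP (fun w => enc_tstar (reduction w)).
Proof.
have Hv := FP_nvars; have Hc := FP_nclauses; have Hl := FP_literal_at.
have starE w : enc_tstar (reduction w) =
   flatten [seq true :: enc_list (leafV (nclauses w) v) | v <- iota 0 (nvars w)] ++
   flatten [seq true :: enc_list (leafB (nclauses w) r) | r <- iota 0 (2 * nvars w)] ++
   flatten [seq true :: enc_list (leafC (nclauses w) (literal_at w) c) | c <- iota 0 (nclauses w)] ++ [:: false].
  by rewrite /enc_tstar /reduction /star !map_cat !flatten_cat -!map_comp -!catA.
apply: FP_ext starE.
apply: FP_cat; last apply: FP_cat; last apply: FP_cat; last exact: FP_const.
- apply: (FP_flatten_iota (g := fun w v => true :: enc_list (leafV (nclauses w) v))) => //.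
  by rewrite /leafV /lab; apply: FP_cons; do ![apply: FP_enc_list_cons]; fp_nat.
- apply: (FP_flatten_iota (g := fun w r => true :: enc_list (leafB (nclauses w) r))); first by fp_nat.
  by rewrite /leafB /lab; apply: FP_cons; do ![apply: FP_enc_list_cons]; fp_nat.
- apply: (FP_flatten_iota (g := fun w c => true :: enc_list (leafC (nclauses w) (literal_at w) c))) => //.
  rewrite /leafC /lab; apply: FP_cons.
  have := Hl 0; have := Hl 1; have := Hl 2; move: literal_at => l H2 H1 H0.
  by do ![apply: FP_enc_list_cons]; fp_nat.
Qed.
End Reduction.

(** * Membership in NP *)

Local Arguments enc1 : simpl never.

Definition bval (s : str) : nat := foldr (fun (b : bool) n => b + 2 * n) 0 s.

Lemma bits_auxE f n : n <= f -> bval (bits_aux f n) = n.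
Proof.
elim: f n => [|f IH] [|n] //= le_n; rewrite IH; last by lia.
by have := odd_double_half n.+1; rewrite /= -mul2n.
Qed.

Lemma bitsK n : bval (bits n) = n.
Proof. exact: bits_auxE. Qed.

Lemma last_bits n : 0 < n -> last false (bits n).
Proof.
rewrite /bits; have : forall f m (b : bool), m <= f -> (m == 0 -> b) -> last b (bits_aux f m).
  elim=> [|f IH] [|m] b //= le_m Hb; rewrite ?Hb //; apply: IH; lia.
by case: n => // n H _; rewrite [bits_aux _ _]/=; apply: H; lia.
Qed.

Lemma bval_gt0 s : last false s -> 0 < bval s.
Proof.
case: s => //= b s; elim: s b => [|c s IH] b /=; first by case: b.
by move=> /IH; rewrite /=; lia.
Qed.

(** Bits are stored least significant first, so [last false s] says both that [s] is canonical and
    that its value is positive; the empty word is excluded. *)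
Lemma bval_bits s : last false s -> bits (bval s) = s.
Proof.
have aux f t : bval t <= f -> (t == [::]) || last false t -> bits_aux f (bval t) = t.
  elim: f t => [|f IH] [|b t] //= le_f.
    by move=> /(@bval_gt0 (b :: t)) /=; lia.
  move=> lt_bt; have pos : 0 < b + 2 * bval t := @bval_gt0 (b :: t) lt_bt.
  change (bits_aux f.+1 (b + 2 * bval t) = b :: t).
  have -> : bits_aux f.+1 (b + 2 * bval t) = odd (b + 2 * bval t) :: bits_aux f (b + 2 * bval t)./2.
    by case: (b + 2 * bval t) pos.
  have -> : odd (b + 2 * bval t) = b by case: (b); lia.
  have -> : (b + 2 * bval t)./2 = bval t by case: (b); lia.
  by rewrite IH //; [lia|case: (t) lt_bt].
by move=> ls; apply: aux => //; rewrite ls orbT.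
Qed.

(** The most significant difference decides and comes last, so each difference overrides the verdict
    so far. Missing bits read as false. *)
Definition ltb_step (z : str * str * bool) : str * str * bool :=
  (behead z.1.1, behead z.1.2,
   if head false z.1.1 == head false z.1.2 then z.2 else head false z.1.2).

Definition ltb (s t : str) : bool := (iter (size (s ++ t)) ltb_step (s, t, false)).2.

Lemma ltbE s t : ltb s t = (bval s < bval t).
Proof.
have aux n u v b : size u <= n -> size v <= n ->
    (iter n ltb_step (u, v, b)).2 = (bval u < bval v) || (bval u == bval v) && b.
  elim: n u v b => [|n IH] u v b; first by case: u => //; case: v.
  rewrite iterSr => le_u le_v; rewrite /ltb_step IH /= ?size_behead; try lia.
  by case: u le_u => [|[] u] le_u; case: v le_v => [|[] v] le_v /=; case: b; lia.
by rewrite /ltb aux ?andbF ?orbF // size_cat ?leq_addl ?leq_addr.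
Qed.

(* Parsing automaton; the components are the mode, the current label, the current leaf and the
   leaves read so far, the last three being reversed. Modes: 0 between leaves, 1 between labels,
   2 between bits, 3 in front of a bit, 4 after the end. *)
Definition pstate := (nat * str * seq str * seq (seq str))%type.

Definition pstep (z : pstate) (b : bool) : pstate :=
  let m := z.1.1.1 in let num := z.1.1.2 in let leaf := z.1.2 in let acc := z.2 in
  if m == 0 then (if b then 1 else 4, num, leaf, acc)
  else if m == 1 then if b then (2, num, leaf, acc) else (0, num, [::], rev leaf :: acc)
  else if m == 2 then if b then (3, num, leaf, acc) else (1, [::], rev num :: leaf, acc)
  else if m == 3 then (2, b :: num, leaf, acc)
  else z.

Definition parse (w : str) : seq (seq str) := rev (foldl pstep (0, [::], [::], [::]) w).2.

Definition enc_leaves (l : seq (seq str)) : str := flatten [seq true :: enc1 leaf | leaf <- l] ++ [:: false].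

Lemma foldl_pstep_str s num leaf acc u :
  foldl pstep (2, num, leaf, acc) (enc_str s ++ u) = foldl pstep (1, [::], rev (catrev s num) :: leaf, acc) u.
Proof. by elim: s num => [|b s IH] num //=; exact: IH. Qed.

Lemma foldl_pstep_leaf (l : seq str) leaf acc u :
  foldl pstep (1, [::], leaf, acc) (enc1 l ++ u) = foldl pstep (0, [::], [::], rev (catrev l leaf) :: acc) u.
Proof.
elim: l leaf => [|s l IH] leaf //; rewrite enc_cons /= -catA foldl_pstep_str -/(rev s) revK.
exact: IH.
Qed.

Lemma parseK l : parse (enc_leaves l) = l.
Proof.
suff H acc : (foldl pstep (0, [::], [::], acc) (enc_leaves l)).2 = catrev l acc.
  by rewrite /parse H -/(rev l) revK.
rewrite /enc_leaves; elim: l acc => [|leaf l IH] acc //=.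
by rewrite -catA foldl_pstep_leaf -/(rev leaf) revK IH.
Qed.

Definition bits2 (I : tstar) : seq (seq str) := map (map bits) I.

Lemma enc_tstarE I : enc_tstar I = enc_leaves (bits2 I).
Proof. by rewrite /enc_tstar /enc_leaves /bits2 -map_comp; congr (flatten _ ++ _); apply: eq_map => s; rewrite /= /enc1 /Enc1_seq -map_comp. Qed.

Lemma bits2_inj : injective bits2.
Proof. exact: inj_map (inj_map (can_inj bitsK)). Qed.

Lemma enc_tstar_inj : injective enc_tstar.
Proof.
by move=> I J; rewrite !enc_tstarE => E; apply: bits2_inj; rewrite -[LHS]parseK E parseK.
Qed.

(* Modes: 0 at an even position, 1 and 2 after the first bit of a pair, 3 in the second component. *)
Definition ustate := (nat * str * str)%type.
Definition ustep (z : ustate) (b : bool) : ustate :=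
  let m := z.1.1 in let w := z.1.2 in let y := z.2 in
  if m == 0 then (if b then 2 else 1, w, y)
  else if m == 1 then (0, false :: w, y)
  else if m == 2 then if b then (0, true :: w, y) else (3, w, y)
  else (3, w, b :: y).

Definition unpair (x : str) : str * str :=
  let z := foldl ustep (0, [::], [::]) x in (rev z.1.2, rev z.2).

Lemma unpairK w y : unpair (pair_enc w y) = (w, y).
Proof.
have H v : foldl ustep (0, v, [::]) (pair_enc w y) = (3, catrev w v, catrev y [::]).
  elim: w v => [|b w IH] v; last by case: b; exact: IH.
  change (foldl ustep (3, v, [::]) y = (3, v, catrev y [::])).
  elim: y [::] => // b y IH u; exact: IH.
by rewrite /unpair H /= -/(rev w) -/(rev y) !revK.
Qed.

(* A certificate lists, leaf by leaf, the two labels at which the leaf is entered and left;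
   here [iv] is the entry for [leaf]. *)
Definition visit_ok (leaf iv : seq str) : bool :=
  [&& head [::] iv \in leaf, head [::] (behead iv) \in leaf & ltb (head [::] iv) (head [::] (behead iv))].

Definition visits_ok (I J : seq (seq str)) : bool :=
  (foldl (fun z leaf => (behead z.1, z.2 && visit_ok leaf (head [::] z.1))) (J, true) I).2.

Definition disjoint_visits (iv iv' : seq str) : bool :=
  ltb (head [::] (behead iv)) (head [::] iv') || ltb (head [::] (behead iv')) (head [::] iv).

Definition leaf_ok (k : nat) (leaf : seq str) : bool :=
  [&& pairwise (fun s t => s != t) leaf, all (fun s => last false s) leaf & size leaf <= k].

(** The parser returns a result on every word; the test [enc_leaves I == w] rejects the words that
    are not encodings. *)
Definition check (k : nat) (w y : str) : bool :=
  let I := parse w in let J := parse y in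
  [&& enc_leaves I == w, ~~ nilp I, size I == size J, all (leaf_ok k) I, visits_ok I J
    & pairwise disjoint_visits J].

Definition verify (k : nat) (x : str) : bool := check k (unpair x).1 (unpair x).2.

Lemma visits_okE I J : visits_ok I J =
  all (fun i => visit_ok (nth [::] I i) (nth [::] J i)) (iota 0 (size I)).
Proof.
rewrite /visits_ok; have H b : (foldl (fun (z : seq (seq str) * bool) leaf => (behead z.1, z.2 && visit_ok leaf (head [::] z.1))) (J, b) I).2 =
  b && all (fun i => visit_ok (nth [::] I i) (nth [::] J i)) (iota 0 (size I)).
  elim: I J b => [|leaf I IH] J b; first by rewrite andbT.
  rewrite [foldl _ _ _]/= IH /= -andbA -(addn0 1) iotaDl all_map nth0; congr (b && (_ && _)).
  by apply: eq_all => i; rewrite /= nth_behead.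
by rewrite H.
Qed.

Lemma check_sound k w y : check k w y -> StarExp k w.
Proof.
case/and5P=> /eqP Ew I0 /eqP szJ leaf_I /andP[]; set I := parse w in Ew I0 szJ leaf_I *.
set J := parse y in szJ *; rewrite visits_okE => /allP vis /(pairwiseP [::]) disj.
pose I' : tstar := map (map bval) I.
(* Canonical words are recovered from their values, so the parsed word encodes an actual star. *)
have bI : bits2 I' = I.
  rewrite /bits2 /I' -map_comp -[RHS]map_id; apply/eq_in_map => leaf /(allP leaf_I)/and3P[_ /allP canon _].
  rewrite /= -map_comp -[RHS]map_id; apply/eq_in_map => s /canon ls; exact: bval_bits.
have szI' : size I' = size I by rewrite size_map.
exists I'; split; first by rewrite enc_tstarE bI.
split.
  apply/allP => s' /mapP[leaf /(allP leaf_I)/and3P[u_leaf /allP canon le_k] ->]; apply/and3P; split.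
  - rewrite map_inj_in_uniq ?uniq_pairwise //.
    by move=> s t /canon ls /canon lt E; rewrite -(bval_bits ls) E bval_bits.
  - by rewrite all_map; apply/allP => s /canon ls /=; apply: bval_gt0.
  - by rewrite size_map.
apply: (@tour_plan_explorable _ (fun i => bval (head [::] (nth [::] J i)))
   (fun i => bval (head [::] (behead (nth [::] J i))))).
  by move=> I'0; move: I0; rewrite /nilp -szI' I'0.
rewrite /tour_plan szI'; split=> [i lt_i|i j lt_i lt_j].
  have /and3P[h1 h2 h3] : visit_ok (nth [::] I i) (nth [::] J i) by apply: vis; rewrite mem_iota.
  by rewrite /I' (nth_map [::]) // !map_f // -ltbE.
have main i' j' : i' < size I -> j' < size I -> i' < j' ->
    disjoint_visits (nth [::] J i') (nth [::] J j').
  by move=> lt_i' lt_j' lt_ij; apply: disj; rewrite ?inE -?szJ.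
case: (ltngtP i j) => // lt_ij _; [have := main i j lt_i lt_j lt_ij|have := main j i lt_j lt_i lt_ij];
  rewrite /disjoint_visits !ltbE => /orP[]; auto.
Qed.

Definition certificate (I : tstar) (a b : nat -> nat) : str :=
  enc_leaves [seq [:: bits (a i); bits (b i)] | i <- iota 0 (size I)].

Lemma check_complete k I a b : I <> [::] -> valid_tstar k I -> tour_plan I a b ->
  check k (enc_tstar I) (certificate I a b).
Proof.
move=> I0 valI [ab disj]; rewrite /check enc_tstarE !parseK eqxx !size_map size_iota eqxx /=.
set J := map _ (iota 0 _).
have nthJ i : i < size I -> nth [::] J i = [:: bits (a i); bits (b i)].
  by move=> lt_i; rewrite (nth_map 0) ?size_iota // nth_iota.
have nthI i : i < size I -> nth [::] (bits2 I) i = map bits (nth [::] I i).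
  by move=> lt_i; rewrite (nth_map [::]).
apply/and4P; split.
- by case: (I) I0.
- rewrite all_map; apply/allP => s /(allP valI)/and3P[us pos_s le_k] /=; apply/and3P; split.
  + by rewrite -uniq_pairwise map_inj_uniq //; apply: can_inj bitsK.
  + by rewrite all_map; apply/allP => l /(allP pos_s) /= l0; apply: last_bits.
  + by rewrite size_map.
- rewrite visits_okE size_map; apply/allP => i; rewrite mem_iota => /andP[_ lt_i].
  have [ma mb lt_ab] := ab i lt_i.
  by rewrite /visit_ok nthJ // nthI //= !map_f // ltbE !bitsK.
- apply/(pairwiseP [::]) => i j; rewrite !inE size_map size_iota => lt_i lt_j lt_ij.
  rewrite !nthJ // /disjoint_visits /= !ltbE !bitsK.
  by apply/orP; apply: disj => //; rewrite ltn_eqF.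
Qed.

Lemma size_enc_nat_leq I i l : i < size I -> l \in nth [::] I i -> size (enc_nat l) <= size (enc_tstar I).
Proof.
move=> lt_i l_i; rewrite /enc_tstar size_cat; apply: leq_trans (leq_addr _ _).
have sub (T : eqType) (f : T -> str) (s : seq T) x : x \in s -> size (f x) <= size (flatten [seq true :: f y | y <- s]).
  elim: s => //= y s IH; rewrite inE size_cat => /orP[/eqP<-|/IH]; first by rewrite /=; lia.
  by move=> le_x; apply: leq_trans le_x (leqW (leq_addl _ _)).
apply: leq_trans (sub _ enc_list I (nth [::] I i) (mem_nth _ lt_i)).
by rewrite /enc_list size_cat; apply: leq_trans (sub _ enc_nat _ _ l_i) (leq_addr _ _).
Qed.

Lemma size_enc_pair (s t : str) : size (enc1 [:: s; t]) = size (enc_str s) + size (enc_str t) + 3.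
Proof.
have -> : enc1 [:: s; t] = true :: enc_str s ++ true :: enc_str t ++ [:: false] by rewrite !enc_cons.
by rewrite /= size_cat /= size_cat /=; lia.
Qed.

(** The chosen labels already occur in the instance, of length [n], so an entry takes at most
    [2 * n + 4] bits; there are at most [n] entries, and one bit ends the list. The constants 8 and
    2 leave ample room. *)
Lemma size_certificate I a b : tour_plan I a b ->
  size (certificate I a b) <= poly_bound 8 2 (size (enc_tstar I)).
Proof.
move=> [ab _]; set n := size (enc_tstar I).
have le_I : size I <= n.
  rewrite /n /enc_tstar size_cat; apply: leq_trans (leq_addr _ _).
  by elim: (I) => //= s J IH; rewrite size_cat; lia.
have le_J : size (certificate I a b) <= size I * (2 * n + 4) + 1.
  rewrite /certificate /enc_leaves size_cat leq_add2r.
  have aux s : all (fun i => i < size I) s ->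
      size (flatten [seq true :: enc1 leaf | leaf <- [seq [:: bits (a i); bits (b i)] | i <- s]]) <=
      size s * (2 * n + 4).
    elim: s => // i s IH /andP[lt_i /IH le_s]; have [ma mb _] := ab i lt_i.
    have := size_enc_nat_leq lt_i ma; have := size_enc_nat_leq lt_i mb; rewrite -/n !enc_natE.
    set F := fun i => [:: bits (a i); bits (b i)] in le_s *; set G := fun leaf => _ in le_s *.
    have -> : flatten [seq G leaf | leaf <- [seq F i | i <- i :: s]] =
      true :: enc1 (F i) ++ flatten [seq G leaf | leaf <- [seq F i | i <- s]] by [].
    rewrite -cat_cons size_cat -add1n -cat1s size_cat size_enc_pair mulSn.
    by move: (size (flatten _)) le_s => u; rewrite /size -/size; lia.
  by rewrite -{2}(size_iota 0 (size I)); apply: aux; apply/allP => i; rewrite mem_iota.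
apply: leq_trans le_J _; rewrite /poly_bound.
have : size I * (2 * n + 4) <= n * (2 * n + 4) by rewrite leq_mul2r le_I orbT.
by rewrite expnS expn1; nia.
Qed.

Lemma StarExp_verify k w :
  StarExp k w <-> exists y, size y <= poly_bound 8 2 (size w) /\ verify k (pair_enc w y).
Proof.
split=> [[I [-> [valI /explorable_tour_plan[I0 [a [b ab]]]]]]|[y [_]]].
  exists (certificate I a b); split; first exact: size_certificate.
  by rewrite /verify unpairK; apply: check_complete.
by rewrite /verify unpairK; apply: check_sound.
Qed.

(** * The verifier runs in polynomial time *)

Ltac fp_seq_step := first [fp_nat_step | simple apply FP_lcons | simple apply (FP_lrev [::])
  | simple apply (FP_lhead [::]) | simple apply FP_lbehead | simple apply FP_lnilp
  | simple apply (FP_lsize [::]) | simple apply FP_mem | simple apply FP_eqstr].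
Ltac fp_seq := repeat fp_seq_step.

Lemma FP_unpair : FP unpair.
Proof.
have inv s z : z.1.1 <= 3 -> (foldl ustep z s).1.1 <= 3 /\
    size (foldl ustep z s).1.2 + size (foldl ustep z s).2 <= size z.1.2 + size z.2 + size s.
  elim: s z => [|b s IH] z le_z; first by rewrite addn0.
  have [] := IH (ustep z b).
    by rewrite /ustep; do 3?[case: ifP => _ //]; case: (b).
  move=> H1 H2; split=> //; apply: leq_trans H2 _; rewrite addnS -addSn leq_add2r.
  by rewrite /ustep; do 3?[case: ifP => _ /=]; case: (b) => /=; lia.
have H : FP (fun x : str => foldl ustep (0, [::], [::]) x).
  apply: (FP_foldl (y0 := fun=> (0, [::], [::])) (h := fun _ => ustep) (B := fun x : str => sz x + 3)).
  - exact: FP_id.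
  - exact: FP_const.
  - by rewrite /ustep; fp_nat.
  - by rewrite /ustep; fp_nat.
  - exact: pb_add (@pb_sz _ _) (pb_const _).
  - move=> x i le_i; have [] := inv (take i x) (0, [::], [::]) isT; rewrite size_takel //.
    by case: foldl => [[m w] y] /= H1 H2; rewrite !sz_pair sz_nat !sz_str; lia.
by rewrite /unpair; fp_nat.
Qed.

Lemma FP_parse : FP parse.
Proof.
(* Entering a list doubles the size of an entry, so a bit of the current label will count 2 in its
   leaf and 4 among the finished leaves. The weights anticipate this growth. *)
pose (phi := fun z : pstate => 4 * sz z.1.1.2 + 2 * sz z.1.2 + sz z.2).
have inv s z : z.1.1.1 <= 4 -> (foldl pstep z s).1.1.1 <= 4 /\ phi (foldl pstep z s) <= phi z + 4 * size s.
  elim: s z => [|b s IH] z le_z; first by rewrite muln0 addn0.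
  have [] := IH (pstep z b).
    by rewrite /pstep; do 4?[case: ifP => _ //]; case: (b).
  move=> H1 H2; split=> //; apply: leq_trans H2 _; rewrite mulnS addnA leq_add2r.
  case: z {IH H1 le_z} => [[[m num] leaf] acc]; rewrite /pstep /phi /=.
  do 4?[case: ifP => _ /=]; rewrite ?sz_cons ?[sz (rev leaf)]sz_rev ?sz_nil ?sz_str ?size_rev /=;
    case: (b); rewrite /= ?sz_cons ?[sz (rev leaf)]sz_rev ?sz_nil ?sz_str ?size_rev /=; lia.
have H : FP (fun w : str => foldl pstep (0, [::], [::], [::]) w).
  (* The 7 is the initial potential 3, from the two empty lists, plus the largest mode 4. *)
  apply: (FP_foldl (y0 := fun=> (0, [::], [::], [::])) (h := fun _ => pstep) (B := fun w : str => 4 * sz w + 7)).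
  - exact: FP_id.
  - exact: FP_const.
  - by rewrite /pstep; fp_seq.
  - by rewrite /pstep; fp_seq.
  - exact: pb_add (pb_mul (pb_const _) (@pb_sz _ _)) (pb_const _).
  - move=> w i le_i; have [] := inv (take i w) (0, [::], [::], [::]) isT; rewrite size_takel // {2}/phi.
    case: foldl => [[[m num] leaf] acc]; rewrite /phi /= !sz_pair sz_nat !sz_str /= !sz_nil; lia.
by rewrite /parse; fp_seq.
Qed.

Section Verify.
Context {X : Type} `{EX : Enc X}.

Lemma FP_ltb (s t : X -> str) : FP s -> FP t -> FP (fun x => ltb (s x) (t x)).
Proof.
have bound i u v b : sz (iter i ltb_step (u, v, b)) <= sz u + sz v + 1.
  elim: i u v b => [|i IH] u v b; first by rewrite !sz_pair sz_bool.
  rewrite iterSr; apply: leq_trans (IH _ _ _) _; rewrite !sz_str !size_behead leq_add2r /=; lia.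
move=> Hs Ht; rewrite /ltb; apply: FP_proj2.
apply: (FP_iterate (N := fun x => s x ++ t x) (y0 := fun x => (s x, t x, false)) (h := fun _ => ltb_step)
  (B := fun x => sz (s x) + sz (t x) + 1)) => [|||| x i _]; last exact: bound.
- by fp_nat.
- by fp_nat.
- by rewrite /ltb_step; fp_nat.
- exact: pb_add (pb_add (FP_size Hs) (FP_size Ht)) (pb_const _).
Qed.

Lemma FP_last d (s : X -> str) : FP s -> FP (fun x => last d (s x)).
Proof.
move=> Hs; apply: FP_ext (FP_head d (FP_rev Hs)) _ => x.
by case/lastP: (s x) => // u b; rewrite last_rcons rev_rcons.
Qed.
End Verify.

Lemma FP_visit_ok X `{Enc X} (leaf iv : X -> seq str) : FP leaf -> FP iv ->
  FP (fun x => visit_ok (leaf x) (iv x)).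
Proof. by move=> H1 H2; rewrite /visit_ok; fp_seq; apply: FP_ltb; fp_seq. Qed.

Lemma FP_visits_ok X `{Enc X} (I J : X -> seq (seq str)) : FP I -> FP J -> FP (fun x => visits_ok (I x) (J x)).
Proof.
move=> HI HJ; apply: FP_proj2.
apply: (FP_lfoldl [::] (y0 := fun x => (J x, true)) (B := fun x => sz (J x) + 1)
  (h := fun _ (z : seq (seq str) * bool) leaf => (behead z.1, z.2 && visit_ok leaf (head [::] z.1))) HI).
- by fp_seq.
- by fp_seq; apply: FP_visit_ok; fp_seq.
- exact: pb_add (FP_size HJ) (pb_const _).
- move=> x i; elim: (take i (I x)) (J x) true => [|leaf s IH] v b; first by rewrite sz_pair sz_bool.
  apply: leq_trans (IH (behead v) (b && visit_ok leaf (head [::] v))) _; rewrite leq_add2r.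
  by rewrite -drop1 sz_drop.
Qed.

Lemma FP_leaf_ok k X `{Enc X} (leaf : X -> seq str) : FP leaf -> FP (fun x => leaf_ok k (leaf x)).
Proof.
move=> Hl; rewrite /leaf_ok; apply: FP_andb; last apply: FP_andb.
- by apply: (FP_pairwise [::] (r := fun _ s t => s != t)) => //; fp_seq.
- by apply: (FP_all [::] (p := fun _ s => last false s)) => //; apply: FP_last; fp_seq.
- by fp_seq.
Qed.

Lemma FP_enc_leaves X `{Enc X} (l : X -> seq (seq str)) : FP l -> FP (fun x => enc_leaves (l x)).
Proof.
move=> Hl; pose (h := fun (acc : str) (leaf : seq str) => true :: enc1 leaf ++ acc).
have E s : foldl h [:: false] s = enc_leaves (rev s).
  by rewrite -{1}(revK s) foldl_rev; elim: (rev s) => //= leaf u ->; rewrite /h /enc_leaves /= catA.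
have le_sz s : size (enc_leaves s) <= sz s.
  elim: s => // leaf s IH; rewrite sz_cons (sz1 leaf).
  have -> : enc_leaves (leaf :: s) = true :: enc1 leaf ++ enc_leaves s by rewrite /enc_leaves /= catA.
  by rewrite -cat1s size_cat size_cat; move: IH; rewrite {2}/size; lia.
apply: FP_ext (FP_lfoldl [::] (y0 := fun=> [:: false]) (h := fun _ => h) (FP_lrev [::] Hl) _ _ (FP_size Hl) _) _.
- exact: FP_const.
- rewrite /h; apply: FP_cons; apply: FP_cat; last by fp.
  have Hz : FP (fun z : X * str * seq str => z.2) by fp.
  exact: FP_regs Hz _.
- move=> x i; rewrite E sz_str; apply: leq_trans (le_sz _) _.
  by rewrite [sz (rev _)]sz_rev; apply: leq_trans (sz_take _ _) _; rewrite [sz (rev _)]sz_rev.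
- by move=> x; rewrite E revK.
Qed.

Lemma FP_verify k : FP (verify k).
Proof.
have HU := FP_unpair; have HP := FP_parse.
have HI : FP (fun x => parse (unpair x).1) by apply: (FP_comp HP); fp.
have HJ : FP (fun x => parse (unpair x).2) by apply: (FP_comp HP); fp.
rewrite /verify /check; apply: FP_andb; last apply: FP_andb; last apply: FP_andb; last apply: FP_andb; last apply: FP_andb.
- by apply: FP_eqstr; [apply: FP_enc_leaves|fp].
- by fp_seq.
- by fp_seq.
- by apply: (FP_all [::] (p := fun _ leaf => leaf_ok k leaf) HI); apply: FP_leaf_ok; fp.
- exact: FP_visits_ok.
- apply: (FP_pairwise [::] (r := fun _ => disjoint_visits) HJ).
  by rewrite /disjoint_visits; apply: FP_orb; apply: FP_ltb; fp_seq.
Qed.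

Lemma StarExp_in_NP k : in_NP (StarExp k).
Proof.
exists (fun x => verify k x), 8, 2; split; first exact: FP_in_P (FP_verify k).
exact: StarExp_verify.
Qed.

(** * NP-hardness *)

Lemma explorable_reduction Q S (M : TM Q S) c1 d1 c2 d2 w :
  explorable (reduction M c1 d1 c2 d2 w) <->
  exists2 y, size y <= mlen c1 d1 w & tm_accept M (cstate (run M (pair_enc w y) (time c1 d1 c2 d2 w))).
Proof.
have NV0 : 0 < nvars Q S c1 d1 c2 d2 w by rewrite /nvars !muln_gt0 addn2.
have cl_lt c p := @literal_lt Q S M c1 d1 c2 d2 w c p.
have le_T := le_plen_time c1 d1 c2 d2 w.
split=> [/(star_sat NV0 cl_lt)/satisfiable_clauses[a Ha]|[y le_y acc]].
  exact: clauses_sound Ha.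
apply: sat_star NV0 _ => //; apply/satisfiable_clauses; exact: clauses_complete acc.
Qed.

(** This lets one length of run serve all certificates, whatever their halting times. *)
Lemma run_halted Q S (M : TM Q S) x t u : halted M (run M x t) -> t <= u -> run M x u = run M x t.
Proof.
move=> ht le_tu; rewrite -(subnK le_tu) /run iterD -/(run M x t).
elim: (u - t) => // n IH; rewrite iterS IH.
by move: ht; rewrite /halted /step; case: tm_delta.
Qed.

Lemma StarExp_NP_hard k : 6 <= k -> NP_hard (StarExp k).
Proof.
move=> le_k L [V [c1 [d1 [[Q [S [M [c2 [d2 HM]]]]] HL]]]].
exists (fun w => enc_tstar (reduction M c1 d1 c2 d2 w)); split.
  exact: FP_poly_computable (FP_reduction _ _ _ _ _).
have accE w y : size y <= mlen c1 d1 w ->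
    tm_accept M (cstate (run M (pair_enc w y) (time c1 d1 c2 d2 w))) <-> V (pair_enc w y).
  move=> le_y; have [t [le_t [ht <-]]] := HM (pair_enc w y); rewrite (run_halted ht) //.
  apply: leq_trans le_t (leq_trans _ (leq_addr _ _)).
  rewrite /poly_bound leq_add2r leq_mul2l; apply/orP; right.
  have le_p : size (pair_enc w y) <= plen c1 d1 w by rewrite size_pair_enc /plen leq_add2l.
  by case: (d2) => // d; rewrite leq_exp2r.
(* By injectivity of [enc_tstar], the only star encoded by the produced word is the reduction
   itself. *)
move=> w; rewrite HL; split=> [[y [le_y Vy]]|[I [/enc_tstar_inj <- [_]]]].
  exists (reduction M c1 d1 c2 d2 w); split=> //; split; first by apply: valid_star le_k; rewrite /nvars !muln_gt0 addn2.
  by apply/explorable_reduction; exists y => //; apply/accE.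
by move=> /explorable_reduction[y le_y /accE Vy]; exists y; split=> //; apply: Vy.
Qed.

Theorem theorem3 (k : nat) : 6 <= k -> NP_complete (StarExp k).
Proof.
by move=> le_k; split; [apply: StarExp_in_NP|apply: StarExp_NP_hard].
Qed.
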